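(* Let $\mathfrak g=\widehat{\mathcal L}_\varphi^\nu(\mathfrak k)$ be an arbitrary ($\nu$-slanted and $\varphi$-twisted) affinisation of a simple (infinite-dimensional) Hilbert--Lie algebra $\mathfrak k$, with Cartan subalgebra $\mathfrak t_0^e$ and Weyl group $\widehat{\mathcal W}=\mathcal W(\mathfrak g,\mathfrak t_0^e)$. Let $\lambda=(\lambda_c,\lambda^0,\lambda_d)\in i(\mathfrak t_0^e)^*$ be an integral weight with $\lambda_c\ne0$. Then for any character $\chi=(\chi_c,\chi^0,\chi_d)\colon i(\mathfrak t_0^e)^*\to\mathbb R$ with $\lambda_c\chi_d>0$, the following are equivalent: (1) $\inf\big(\chi(\widehat{\mathcal W}.\lambda-\lambda)\big)>-\infty$. (2) $\chi=\chi_{\min}+\chi_{\mathrm{sum}}$ for some minimal energy character $\chi_{\min}$, i.e. a character satisfying $\inf\big(\chi_{\min}(\widehat{\mathcal W}.\lambda-\lambda)\big)=0$, and some summable character $\chi_{\mathrm{sum}}$.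
   Context: A Hilbert--Lie algebra $\mathfrak k$ is a real Lie algebra with a real Hilbert space structure whose scalar product satisfies $\langle[x,y],z\rangle=\langle x,[y,z]\rangle$. Let $\mathfrak k$ be simple and infinite-dimensional, $\varphi\in\mathrm{Aut}(\mathfrak k)$ of finite order $N_\varphi$, $\mathfrak t_0$ a maximal abelian subalgebra of $\mathfrak k^\varphi=\{x:\varphi(x)=x\}$, $\Delta_\varphi\subseteq i\mathfrak t_0^*$ the set of nonzero weights of $\mathfrak t_0$ on $\mathfrak k_{\mathbb C}$, with weight spaces $\mathfrak k_{\mathbb C}^\alpha$. For $\alpha\in\Delta_\varphi$, $\alpha^\sharp\in i\mathfrak t_0$ is defined by $\langle h,\alpha^\sharp\rangle=\alpha(h)$. Loop algebra: $\mathcal L_\varphi(\mathfrak k)=\{\xi\in C^\infty(\mathbb R,\mathfrak k):\xi(t+\tfrac{2\pi}{N_\varphi})=\varphi^{-1}(\xi(t))\ \forall t\}$ with $\langle\xi,\eta\rangle=\frac1{2\pi}\int_0^{2\pi}\langle\xi(t),\eta(t)\rangle dt$. For $\nu\in i\mathfrak t_0^*$ let $D_\nu=D_0+\overline D_\nu$, where $D_0\xi=\xi'$ and $\overline D_\nu$ acts pointwise by $\overline D_\nu x=i\nu(\alpha^\sharp)x$ on $\mathfrak k_{\mathbb C}^\alpha$ (and $0$ on the zero weight space). The $\nu$-slanted $\varphi$-twisted affinisation is $\widehat{\mathcal L}^\nu_\varphi(\mathfrak k)=\mathbb R\times\mathcal L_\varphi(\mathfrak k)\times\mathbb R$ with bracket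 $[(z_1,x_1,t_1),(z_2,x_2,t_2)]=(\langle D_\nu x_1,x_2\rangle,[x_1,x_2]+t_1D_\nu x_2-t_2D_\nu x_1,0)$, and $\mathfrak t_0^e=\mathbb R\oplus\mathfrak t_0\oplus\mathbb R$. Set $\mathbf c=(i,0,0)$, $\mathbf d=(0,0,-i)\in i\mathfrak t_0^e$. Write $[z,h,t]=z\mathbf c+h+t\mathbf d$ for $h\in i\mathfrak t_0$. A functional $\mu\in i(\mathfrak t_0^e)^*$ (real-valued on $i\mathfrak t_0^e$) is written $\mu=(\mu_c,\mu^0,\mu_d)$ with $\mu_c=\mu(\mathbf c)$, $\mu^0=\mu|_{i\mathfrak t_0}$, $\mu_d=\mu(\mathbf d)$. The compact roots of $\mathfrak g$ are the roots $\gamma$ with nonzero restriction to $i\mathfrak t_0$; they are indexed by pairs $(\alpha,n)$, $\alpha\in\Delta_\varphi$, $n\in\mathbb Z$ (root vectors $e^{int}\otimes x_\alpha$), and as functionals $\gamma=(0,\alpha,n+\nu(\alpha^\sharp))$. The coroot $\gamma^\vee$ is the unique element of $[\mathfrak g_\gamma,\mathfrak g_{-\gamma}]$ with $\gamma(\gamma^\vee)=2$. The Weyl group is generated by the reflections $r_\gamma(\mu)=\mu-\mu(\gamma^\vee)\gamma$ of $i(\mathfrak t_0^e)^*$, $\gamma$ compact. A weight $\lambda$ is integral if $\lambda(\gamma^\vee)\in\mathbb Z$ for all compact $\gamma$. Standard affinisations: $\widehat{\mathcal L}^0_\psi(\mathfrak k)$ with $\psi=\mathrm{id}$ or $\psi$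 one of three standard automorphisms $\psi_Y$ of order 2 ($Y\in\{B,C,BC\}$). For these there are an infinite set $J$ and an orthonormal basis $\{e_j\}_{j\in J}$ of $i\mathfrak t_0$ (scalar product suitably normalised), with dual system $\epsilon_j(e_k)=\delta_{jk}$, such that the set of index pairs $(\alpha,n)$ of compact roots is one of $X_J\times\mathbb Z$ ($X\in\{A,B,C,D\}$, for $\psi=\mathrm{id}$), $B_J^{(2)}=(B_J\times2\mathbb Z)\cup(\{\pm\epsilon_j\}\times(2\mathbb Z+1))$, $C_J^{(2)}=(C_J\times2\mathbb Z)\cup(D_J\times(2\mathbb Z+1))$, $BC_J^{(2)}=(B_J\times2\mathbb Z)\cup(BC_J\times(2\mathbb Z+1))$, where (for $j\neq k$) $A_J=\{\epsilon_j-\epsilon_k\}$, $D_J=\{\pm(\epsilon_j\pm\epsilon_k)\}$, $B_J=D_J\cup\{\pm\epsilon_j\}$, $C_J=D_J\cup\{\pm2\epsilon_j\}$, $BC_J=B_J\cup C_J$. Choice of $\mathfrak t_0$: for every $\varphi$ one can choose $\mathfrak t_0$, a standard (or trivial) automorphism $\psi$ of $\mathfrak k$ of order $N_\psi\in\{1,2\}$ for which $\mathfrak t_0$ is also maximal abelian in $\mathfrak k^\psi$ (and is such that, for some infinite set $J$ and some orthonormal basis $\{e_j\}_{j\in J}$ of $i\mathfrak t_0$ (scalar product suitably normalised) with dual system $\{\epsilon_j\}_{j\in J}$, the set of index pairs $(\alpha,n)$ of compact roots of the standard affinisation $\widehat{\mathcal L}^0_\psi(\mathfrak k)$ with respect to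 $\mathfrak t_0^e=\mathbb R\oplus\mathfrak t_0\oplus\mathbb R$ is one of the seven sets $A_J\times\mathbb Z$, $B_J\times\mathbb Z$, $C_J\times\mathbb Z$, $D_J\times\mathbb Z$ (for $\psi=\mathrm{id}$), $B_J^{(2)}$, $C_J^{(2)}$, $BC_J^{(2)}$ (for $\psi=\psi_B,\psi_C,\psi_{BC}$ respectively)), and $\mu\in i\mathfrak t_0^*$, such that for every $\nu$ there is an isomorphism $\widehat{\mathcal L}^\nu_\varphi(\mathfrak k)\cong\widehat{\mathcal L}_\psi^{Q\nu+N_\psi\mu}(\mathfrak k)$, $Q=N_\psi/N_\varphi$, restricting on $i\mathfrak t_0^e$ to $[z,h,t]\mapsto[Qz,h,t/Q]$. The subalgebra $\mathfrak t_0$ is chosen in this way, and $\{e_j\}$, $\{\epsilon_j\}$ denote the bases associated with the standard affinisation $\widehat{\mathcal L}_\psi^0(\mathfrak k)$. A character $\chi\colon i(\mathfrak t_0^e)^*\to\mathbb R$ is a linear functional, written $\chi=(\chi_c,\chi^0,\chi_d)$ with $\chi_c=\chi((1,0,0))$, $\chi^0=\chi|_{i\mathfrak t_0^*}$, $\chi_d=\chi((0,0,1))$; it is summable if $\chi_c=\chi_d=0$ and $\sum_{j\in J}|\chi^0(\epsilon_j)|<\infty$. *)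

(* Defs.v *)
From HB Require Import structures.
From mathcomp Require Import all_boot all_order all_algebra.
From mathcomp Require Import all_classical all_reals all_analysis.

Set Implicit Arguments.
Unset Strict Implicit.
Unset Printing Implicit Defensive.

Import Order.TTheory GRing.Theory Num.Theory.
Import numFieldNormedType.Exports.

Local Open Scope classical_set_scope.
Local Open Scope ring_scope.

Record hilbertLie (R : realType) := HilbertLie {
  hl_space :> completeNormedModType R;
  ip : hl_space -> hl_space -> R;
  br : hl_space -> hl_space -> hl_space;
  ip_linearl : forall (a : R) x y z, ip (a *: x + y) z = a * ip x z + ip y z;
  ipC : forall x y, ip x y = ip y x;
  ip_norm : forall x, ip x x = `|x| ^+ 2;
  br_linearl : forall (a : R) x y z, br (a *: x + y) z = a *: br x z + br y z;
  br_alt : forall x, br x x = 0;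
  br_jacobi : forall x y z, br x (br y z) + br y (br z x) + br z (br x y) = 0;
  ip_invariant : forall x y z, ip (br x y) z = ip x (br y z)
}.

Section Algebra.
Context (R : realType) (k : hilbertLie R).

Definition infinite_dimensional : Prop :=
  ~ exists (n : nat) (b : 'I_n -> k),
      forall x, exists c : 'I_n -> R, x = \sum_i c i *: b i.

Definition closed_ideal (I : set k) : Prop :=
  [/\ closed I, I 0, forall (a : R) x y, I x -> I y -> I (a *: x + y)
    & forall x y, I y -> I (br x y)].

Definition simple_hilbertLie : Prop :=
  (exists x y : k, br x y != 0) /\
  (forall I : set k, closed_ideal I -> I = [set 0] \/ I = setT).

Definition lie_automorphism (phi : k -> k) : Prop :=
  [/\ linear phi, bijective phi
    & forall x y, phi (br x y) = br (phi x) (phi y)].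

Definition has_order (phi : k -> k) (N : nat) : Prop :=
  [/\ (0 < N)%N, iter N phi =1 id
    & forall m, (0 < m < N)%N -> ~ iter m phi =1 id].

Definition fixed_abelian (phi : k -> k) (a : submodClosed k) : Prop :=
  (forall x, x \in a -> phi x = x) /\
  (forall x y, x \in a -> y \in a -> br x y = 0).

Definition maximal_abelian (phi : k -> k) (t0 : submodClosed k) : Prop :=
  fixed_abelian phi t0 /\
  forall a : submodClosed k, fixed_abelian phi a ->
    {subset t0 <= a} -> {subset a <= t0}.

End Algebra.

Section Subspace.
Context (R : realType) (V : lmodType R) (S : submodClosed V).

Record subspace := Subspace { subspace_val : V; _ : subspace_val \in S }.

HB.instance Definition _ := [isSub for subspace_val].
HB.instance Definition _ := [Choice of subspace by <:].
HB.instance Definition _ := [SubChoice_isSubLmodule of subspace by <:].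

End Subspace.

Section Dual.
Context (R : realType) (V : lmodType R).

Definition linear_pred : {pred V -> R^o} :=
  [pred f : V -> R^o | `[< linear f >]].

Let linear_pred_submod : submod_closed linear_pred.
Proof.
split; first by apply/asboolP => a x y; rewrite /= scaler0 addr0.
move=> c f g /asboolP lf /asboolP lg; apply/asboolP => a x y.
rewrite -[LHS]/(c *: f (a *: x + y) + g (a *: x + y)).
rewrite -[RHS]/(a *: (c *: f x + g x) + (c *: f y + g y)) lf lg.
rewrite !scalerDr !scalerA mulrC -!addrA; congr (_ + _).
by rewrite addrCA.
Qed.

HB.instance Definition _ :=
  GRing.isSubmodClosed.Build R (V -> R^o) linear_pred linear_pred_submod.

Record alg_dual := Dual { dual_fun :> V -> R^o; _ : dual_fun \in linear_pred }.

HB.instance Definition _ := [isSub for dual_fun].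
HB.instance Definition _ := [Choice of alg_dual by <:].
HB.instance Definition _ := [SubChoice_isSubLmodule of alg_dual by <:].

End Dual.

(* The complexification of V is V * V, with (x, y) standing for x + i y. *)
Section Complexification.
Context (R : realType) (V : lmodType R).

Definition imul (x : V * V) : V * V := (- x.2, x.1).

Definition cbr (b : V -> V -> V) (x y : V * V) : V * V :=
  (b x.1 y.1 - b x.2 y.2, b x.1 y.2 + b x.2 y.1).

End Complexification.

(* The real vector space i t0: [h : it0 t0] stands for the vector i h.  The
   scalar product of k_C is Hermitian, so <i h, i h'> = <h, h'>.  A functional in
   (i t0)^* is real-valued on i t0, hence an element of [alg_dual (it0 t0)]. *)
Notation it0 t0 := (subspace t0).

Section Weights.
Context (R : realType) (k : hilbertLie R) (t0 : submodClosed k).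

Definition weight_space (alpha : alg_dual (it0 t0)) : set (k * k) :=
  [set x | forall h : it0 t0,
     cbr (@br R k) (0, val h) x = (alpha h : R) *: x].

Definition Delta : set (alg_dual (it0 t0)) :=
  [set alpha | alpha != 0 /\ exists2 x, weight_space alpha x & x != 0].

Definition sharp (alpha : alg_dual (it0 t0)) : it0 t0 :=
  xget 0 [set s : it0 t0 | forall h : it0 t0, alpha h = ip (val h) (val s)].

Definition is_Dbar (nu : alg_dual (it0 t0)) (D : k -> k) : Prop :=
  [/\ linear D, continuous D,
      forall alpha x, Delta alpha -> weight_space alpha x ->
        (D x.1, D x.2) = (nu (sharp alpha) : R) *: imul x
    & forall x, weight_space 0 x -> (D x.1, D x.2) = 0].

(* i t0^* is the full algebraic dual, and nu must be such that the pointwise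
   prescription on the weight spaces defines an operator on k, i.e. such that
   nu(alpha^sharp) is bounded in alpha. *)
Definition slant (nu : alg_dual (it0 t0)) : Prop := exists D, is_Dbar nu D.

Definition Dbar (nu : alg_dual (it0 t0)) : k -> k :=
  xget (fun=> 0) [set D | is_Dbar nu D].

End Weights.

Section Affinisation.
Context (R : realType) (k : hilbertLie R) (t0 : submodClosed k).

Definition smooth (xi : R -> k) : Prop :=
  forall (n : nat) (t : R), derivable (derive1n n (xi : R^o -> k)) t 1.

Definition loop_algebra (phi : k -> k) (N : nat) : set (R -> k) :=
  [set xi | smooth xi /\
     forall t : R, phi (xi (t + 2 * pi / N%:R)) = xi t].

Definition loop_ip (xi eta : R -> k) : R :=
  (2 * pi)^-1 *
  (\int[@lebesgue_measure R]_(t in `[0, 2 * pi]) ip (xi t) (eta t)).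

Definition Dnu (nu : alg_dual (it0 t0)) (xi : R -> k) : R -> k :=
  fun t => derive1 (xi : R^o -> k) t + Dbar nu (xi t).

(* The affinisation is a subset of R * k^R * R; its bracket is given by a
   formula which makes sense on all of this ambient space. *)
Definition aff_space : lmodType R := (R^o * (R -> k) * R^o)%type.

Definition affinisation (phi : k -> k) (N : nat) : set aff_space :=
  [set x | loop_algebra phi N x.1.2].

Definition aff_br (nu : alg_dual (it0 t0)) (x y : aff_space) : aff_space :=
  (loop_ip (Dnu nu x.1.2) y.1.2,
   (fun s => br (x.1.2 s) (y.1.2 s) + (x.2 : R) *: Dnu nu y.1.2 s
             - (y.2 : R) *: Dnu nu x.1.2 s),
   0).

(* i t0^e: the triple (z, h, t) stands for [z, i h, t] = z c + i h + t d, where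
   c = (i, 0, 0) and d = (0, 0, -i). *)
Definition ite : lmodType R := (R^o * it0 t0 * R^o)%type.

Definition ite_emb (p : ite) : aff_space * aff_space :=
  (0, (p.1.1, (fun=> val p.1.2), - p.2)).

(* i (t0^e)^*: the triple (mu_c, mu^0, mu_d). *)
Definition ite_dual : lmodType R := (R^o * alg_dual (it0 t0) * R^o)%type.

Definition ev (mu : ite_dual) (p : ite) : R :=
  (mu.1.1 : R) * p.1.1 + mu.1.2 p.1.2 + (mu.2 : R) * p.2.

Section Roots.
Context (phi : k -> k) (N : nat) (nu : alg_dual (it0 t0)).

Definition root_space (gamma : ite_dual) : set (aff_space * aff_space) :=
  [set x | [/\ affinisation phi N x.1, affinisation phi N x.2
    & forall p : ite, cbr (aff_br nu) (ite_emb p) x = ev gamma p *: x]].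

Definition compact_root (gamma : ite_dual) : Prop :=
  gamma.1.2 != 0 /\ exists2 x, root_space gamma x & x != 0.

(* [g_gamma, g_-gamma] is contained in the complexification of t0^e, and the
   coroot in i t0^e, where functionals take real values. *)
Definition coroot (gamma : ite_dual) : ite :=
  xget 0 [set p : ite |
    (exists (n : nat) (x y : 'I_n -> aff_space * aff_space),
       [/\ forall i, root_space gamma (x i),
           forall i, root_space (- gamma) (y i)
         & ite_emb p = \sum_i cbr (aff_br nu) (x i) (y i)]) /\
    ev gamma p = 2].

Definition reflection (gamma mu : ite_dual) : ite_dual :=
  mu - ev mu (coroot gamma) *: gamma.

(* Reflections are involutions, so the group they generate consists of their
   finite products. *)
Inductive weyl_group : (ite_dual -> ite_dual) -> Prop :=
| weyl_id : weyl_group id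
| weyl_refl gamma w : compact_root gamma -> weyl_group w ->
    weyl_group (reflection gamma \o w).

Definition integral_weight (lambda : ite_dual) : Prop :=
  forall gamma, compact_root gamma ->
    ev lambda (coroot gamma) \is a Num.int.

Definition orbit_inf (chi : {linear ite_dual -> R^o}) (lambda : ite_dual) :
    \bar R :=
  ereal_inf [set ((chi (w lambda - lambda) : R)%:E) | w in weyl_group].

Definition minimal_energy (lambda : ite_dual)
    (chi : {linear ite_dual -> R^o}) : Prop :=
  orbit_inf chi lambda = 0%E.

End Roots.

(* The affinisations attached to (phi, nu) and (psi, nu') are isomorphic as Lie
   algebras, by a map restricting to [z, h, t] |-> [Q z, h, t / Q]; being real,
   the isomorphism is determined on i t0^e by its restriction to t0^e. *)
Definition aff_iso (phi : k -> k) (Nphi : nat) (nu : alg_dual (it0 t0))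
    (psi : k -> k) (Npsi : nat) (nu' : alg_dual (it0 t0)) (Q : R) : Prop :=
  exists F : aff_space -> aff_space,
    [/\ set_bij (affinisation phi Nphi) (affinisation psi Npsi) F,
        forall (a : R) x y, affinisation phi Nphi x -> affinisation phi Nphi y ->
          F (a *: x + y) = a *: F x + F y,
        forall x y, affinisation phi Nphi x -> affinisation phi Nphi y ->
          F (aff_br nu x y) = aff_br nu' (F x) (F y)
      & forall (z : R) (h : it0 t0) (t : R),
          F (z, (fun=> val h), t) = (Q * z, (fun=> val h), t / Q)].

(* The pairs (alpha, n) indexing the compact roots (0, alpha, n) of the
   non-slanted psi-twisted affinisation. *)
Definition index_pairs (psi : k -> k) (Npsi : nat) : set (alg_dual (it0 t0) * int) :=
  [set p | compact_root psi Npsi 0 (0, p.1, p.2%:~R)].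

Section RootSystems.
Context (J : choiceType) (e : J -> it0 t0) (eps : J -> alg_dual (it0 t0)).

(* Orthonormal for a positive multiple of the scalar product, and total. *)
Definition orthonormal_basis : Prop :=
  (exists2 c : R, 0 < c & forall j l,
     c * ip (val (e j)) (val (e l)) = (j == l)%:R) /\
  (forall (h : it0 t0) (r : R), 0 < r -> exists (s : seq J) (a : J -> R),
     `|val (h - \sum_(j <- s) a j *: e j)| < r).

(* Each eps_j is moreover a bounded functional, hence determined by its values
   on the orthonormal basis. *)
Definition dual_system : Prop :=
  (forall j l, eps j (e l) = (j == l)%:R) /\
  (forall j, exists C : R, forall h : it0 t0, `|eps j h : R| <= C * `|val h|).

Definition rs_A : set (alg_dual (it0 t0)) :=
  [set a | exists j l, j != l /\ a = eps j - eps l].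

Definition rs_D : set (alg_dual (it0 t0)) :=
  [set a | exists j l, j != l /\
     [\/ a = eps j + eps l, a = - (eps j + eps l),
         a = eps j - eps l | a = - (eps j - eps l)]].

Definition rs_short : set (alg_dual (it0 t0)) :=
  [set a | exists j, a = eps j \/ a = - eps j].

Definition rs_long : set (alg_dual (it0 t0)) :=
  [set a | exists j, a = 2 *: eps j \/ a = - (2 *: eps j)].

Definition rs_B : set (alg_dual (it0 t0)) := rs_D `|` rs_short.
Definition rs_C : set (alg_dual (it0 t0)) := rs_D `|` rs_long.
Definition rs_BC : set (alg_dual (it0 t0)) := rs_B `|` rs_C.

Definition evenz : set int := [set n | (2 %| n)%Z].
Definition oddz : set int := [set n | ~~ (2 %| n)%Z].

Definition rs_B2 : set (alg_dual (it0 t0) * int) :=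
  (rs_B `*` evenz) `|` (rs_short `*` oddz).
Definition rs_C2 : set (alg_dual (it0 t0) * int) :=
  (rs_C `*` evenz) `|` (rs_D `*` oddz).
Definition rs_BC2 : set (alg_dual (it0 t0) * int) :=
  (rs_B `*` evenz) `|` (rs_BC `*` oddz).

(* A trivial (Npsi = 1) or standard (Npsi = 2) automorphism psi, with the
   bases attached to its non-slanted affinisation. *)
Definition standard_automorphism (psi : k -> k) (Npsi : nat) : Prop :=
  [/\ lie_automorphism psi, has_order psi Npsi, maximal_abelian psi t0,
      orthonormal_basis /\ dual_system
    & (Npsi = 1%N /\ [\/ index_pairs psi Npsi = rs_A `*` setT,
                         index_pairs psi Npsi = rs_B `*` setT,
                         index_pairs psi Npsi = rs_C `*` setT
                       | index_pairs psi Npsi = rs_D `*` setT]) \/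
      (Npsi = 2%N /\ [\/ index_pairs psi Npsi = rs_B2,
                         index_pairs psi Npsi = rs_C2
                       | index_pairs psi Npsi = rs_BC2])].

Definition summable_character (chi : {linear ite_dual -> R^o}) : Prop :=
  [/\ chi (1, 0, 0) = 0, chi (0, 0, 1) = 0
    & summable [set: J] (fun j => (chi (0, eps j, 0) : R)%:E)].

End RootSystems.

Definition untwisting (phi : k -> k) (Nphi : nat) (psi : k -> k) (Npsi : nat)
    (mu : alg_dual (it0 t0)) : Prop :=
  let Q : R := Npsi%:R / Nphi%:R in
  forall nu : alg_dual (it0 t0), slant nu ->
    slant (Q *: nu + Npsi%:R *: mu) /\
    aff_iso phi Nphi nu psi Npsi (Q *: nu + Npsi%:R *: mu) Q.

End Affinisation.

(* Main.v *)
(* Transported along the isomorphism with a slanted standard affinisation and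
   shifted by a multiple of the slant, the compact reflections act on the weights
   of level lambda_c as the Euclidean affine reflections of R^J in the roots
   eps_j - eps_k, eps_j + eps_k, eps_j, 2 eps_j with offsets in a lattice tau Z,
   and chi(w lambda - lambda) is a positive multiple of the change of the squared
   distance to a centre p, sum_j (y_j - p_j)^2 - (l_j - p_j)^2.

   If this is bounded below on the orbit, then so it is on the moves that alter
   finitely many disjoint pairs of coordinates.  This yields a nondecreasing
   quasi-periodic threshold theta such that p_j lies between theta(l_j) and
   theta(l_j + 1) up to a summable error; correcting that error makes chi a
   minimal energy character.  Conversely theta integrates to a convex G for which
   the sum of the y_j^2 / 2 - G(y_j) is invariant on orbits, and the convexity of
   G gives the lower bound.

   The root sets of the two affinisations match because twisted weight spaces have
   multiplicity one, by unitarity of the compact sl2-triples. *)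
From HB Require Import structures.
Require Import Defs.
From mathcomp Require Import all_boot all_order all_algebra.
From mathcomp Require Import all_classical all_reals all_analysis.
From mathcomp Require Import zify ring lra.
Import Order.TTheory GRing.Theory Num.Theory.
Import numFieldNormedType.Exports.
Local Open Scope classical_set_scope.
Local Open Scope ring_scope.
Set Implicit Arguments.
Unset Strict Implicit.
Unset Printing Implicit Defensive.

(** The seven types of roots enter only through a flag [sg] (whether signs occur) and a step
    [sigma]. What all types share are the pair reflections, while the roots along a single [eps j]
    vary. So boundedness is exploited for pair moves alone, whereas the lower bound is proved with
    every flip that [sg] permits. The two meet because, when signs occur, the threshold built from
    pairs is odd, [theta (1 - x) = - theta x], which is what invariance under flips requires. The
    threshold comes from cutting at a lattice point x. Translate [l j] and [p j] together by the
    multiple of tau that puts [l j] last below x, and let [P j] be the translate of [p j].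
    Reflecting a pair with [P j - P k > tau] lowers the energy by at least the excess. A bound on
    all disjoint pairs forces [limsup P <= liminf P + tau]; with [theta x] midway between these two
    numbers, [P] lies between [theta x - tau] and [theta x] up to a summable error. Characters live
    on the full algebraic dual of [i t0], whereas the correction is prescribed only on the [eps j];
    extending it takes Zorn's lemma. *)

Lemma sumr_const_seq (V : nmodType) (I : Type) (s : seq I) (x : V) :
  \sum_(i <- s) x = x *+ size s.
Proof. by rewrite big_const_seq count_predT GRing.iter_addr_0. Qed.

(** * Limits superior of doubled families, and disjoint pairs with bounded total excess *)

Section LimsupPairs.
Context (R : realType) (J : choiceType).
Implicit Types P Q : J -> bool -> R.

Definition family_bounded P := exists B : R, forall j b, `|P j b| <= B.

Definition exceeds P (x : R) : set J := [set j | exists b, x < P j b].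

(** The limit superior of [max_b P j b] along the cofinite filter of [J]. The boolean distinguishes
    a coordinate from its mirror image, and an index counts once whichever copy exceeds the
    level. *)
Definition limsup_fam P : R := inf [set x | finite_set (exceeds P x)].

Lemma exceeds_mono P x y : x <= y -> exceeds P y `<=` exceeds P x.
Proof. by move=> xy j [b yP]; exists b; apply: le_lt_trans yP. Qed.

Hypothesis J_infinite : infinite_set [set: J].

Lemma limsup_has_inf P : family_bounded P ->
  has_inf [set x | finite_set (exceeds P x)].
Proof.
move=> [B PB]; split.
  exists B => /=; suff -> : exceeds P B = set0 by [].
  rewrite -subset0 => j [b]; rewrite ltNge => /negP; apply.
  exact: le_trans (ler_norm _) (PB j b).
exists (- B - 1) => x /= fx; rewrite leNgt; apply/negP => xB.
apply: J_infinite; apply: sub_finite_set fx => j _; exists true.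
have := PB j true; rewrite ler_norml => /andP[h _].
by apply: lt_le_trans h; lra.
Qed.

Lemma limsup_lt P x : family_bounded P -> limsup_fam P < x ->
  finite_set (exceeds P x).
Proof.
move=> bP; rewrite /limsup_fam => lx.
have [y /= fy yx] := inf_lt (limsup_has_inf bP).1 lx.
by apply: sub_finite_set fy; apply: exceeds_mono; apply: ltW.
Qed.

Lemma limsup_gt P x : family_bounded P -> x < limsup_fam P ->
  infinite_set (exceeds P x).
Proof.
move=> bP xl fx; have := ge_inf (limsup_has_inf bP).2 fx.
by rewrite leNgt xl.
Qed.

Lemma limsup_le P Q : family_bounded P -> family_bounded Q ->
  (forall j b, exists b', P j b <= Q j b') -> limsup_fam P <= limsup_fam Q.
Proof.
move=> bP bQ PQ; rewrite leNgt; apply/negP => QP.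
pose x := (limsup_fam P + limsup_fam Q) / 2.
have /(limsup_lt bQ) fx : limsup_fam Q < x by rewrite /x; lra.
have /(limsup_gt bP) : x < limsup_fam P by rewrite /x; lra.
apply; apply: sub_finite_set fx => j [b xP].
by have [b' h] := PQ j b; exists b'; apply: lt_le_trans h.
Qed.

Lemma family_boundedD P c : family_bounded P ->
  family_bounded (fun j b => P j b + c).
Proof.
move=> [B PB]; exists (B + `|c|) => j b.
by apply: le_trans (ler_normD _ _) _; rewrite lerD2r.
Qed.

Lemma family_boundedN P : family_bounded P ->
  family_bounded (fun j b => - P j b).
Proof. by move=> [B PB]; exists B => j b; rewrite normrN. Qed.

Lemma limsup_shift P c : family_bounded P ->
  limsup_fam (fun j b => P j b + c) = limsup_fam P + c.
Proof.
move=> bP; have bPc := family_boundedD c bP.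
have exE x : exceeds (fun j b => P j b + c) x = exceeds P (x - c).
  by apply/seteqP; split=> j [b h]; exists b; lra.
apply/eqP; rewrite eq_le; apply/andP; split; rewrite leNgt; apply/negP => h.
  pose x := (limsup_fam P + c + limsup_fam (fun j b => P j b + c)) / 2.
  have /(limsup_gt bPc) : x < limsup_fam (fun j b => P j b + c) by rewrite /x; lra.
  by rewrite exE; apply; apply: limsup_lt => //; rewrite /x; lra.
pose x := (limsup_fam P + c + limsup_fam (fun j b => P j b + c)) / 2.
have /(limsup_lt bPc) : limsup_fam (fun j b => P j b + c) < x by rewrite /x; lra.
by rewrite exE; apply: limsup_gt => //; rewrite /x; lra.
Qed.

(** As [limsup_fam (- P)] is minus the limit inferior, this is the midpoint of
    [[limsup P, liminf P + tau]]. It is interior whenever the interval has positive length, and it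
    respects shifts, order and the mirror [P |-> - P - tau]. *)
Definition midpoint (tau : R) P : R :=
  (limsup_fam P - limsup_fam (fun j b => - P j b) + tau) / 2.

Lemma midpoint_shift tau P c : family_bounded P ->
  midpoint tau (fun j b => P j b + c) = midpoint tau P + c.
Proof.
move=> bP; rewrite /midpoint limsup_shift //.
have -> : (fun j b => - (P j b + c)) = (fun j b => - P j b + (- c)).
  by apply/funext => j; apply/funext => b; rewrite opprD.
rewrite limsup_shift; first by field.
exact: family_boundedN.
Qed.

Lemma midpoint_opp tau P : family_bounded P ->
  midpoint tau (fun j b => - P j b - tau) = - midpoint tau P.
Proof.
move=> bP; have bN := family_boundedN bP.
rewrite (midpoint_shift tau (- tau) bN) /midpoint.
have -> : (fun j b => - - P j b) = P.
  by apply/funext => j; apply/funext => b; rewrite opprK.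
by field.
Qed.

Lemma midpoint_le tau P Q : family_bounded P -> family_bounded Q ->
  (forall j b, P j b <= Q j b) -> midpoint tau P <= midpoint tau Q.
Proof.
move=> bP bQ PQ; rewrite /midpoint ler_pM2r ?invr_gt0 ?ltr0n// lerD2r lerB//.
  by apply: limsup_le => // j b; exists b.
apply: limsup_le; try exact: family_boundedN.
by move=> j b; exists b; rewrite lerN2.
Qed.

Lemma midpoint_swap tau P Q : family_bounded P -> family_bounded Q ->
  (forall j b, P j b = Q j (~~ b)) -> midpoint tau P = midpoint tau Q.
Proof.
move=> bP bQ PQ.
have le1 P1 P2 : family_bounded P1 -> family_bounded P2 ->
    (forall j b, P1 j b = P2 j (~~ b)) -> limsup_fam P1 <= limsup_fam P2.
  by move=> b1 b2 h; apply: limsup_le => // j b; exists (~~ b); rewrite h.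
have QP j b : Q j b = P j (~~ b) by rewrite PQ negbK.
have bNP := family_boundedN bP; have bNQ := family_boundedN bQ.
rewrite /midpoint; congr ((_ - _ + _) / _); apply/eqP; rewrite eq_le;
  apply/andP; split; apply: le1 => // j b; by rewrite ?QP ?PQ ?negbK.
Qed.

Definition pair_support (s : seq ((J * bool) * (J * bool))) : seq J :=
  flatten [seq [:: u.1.1; u.2.1] | u <- s].

Definition pair_excess (tau : R) P (u : (J * bool) * (J * bool)) : R :=
  Num.max 0 (P u.1.1 u.1.2 - P u.2.1 u.2.2 - tau).

(** Disjoint pairs can be reflected independently, so their energy gains add up; this is the form in
    which boundedness on the orbit is used. *)
Definition pairs_bounded tau P (C : R) := forall s, uniq (pair_support s) ->
  \sum_(u <- s) pair_excess tau P u <= C.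

(** Exchanging the two members of every pair preserves each excess. *)
Lemma pairs_bounded_opp tau P C : pairs_bounded tau P C ->
  pairs_bounded tau (fun j b => - P j b - tau) C.
Proof.
move=> h s us; pose s' := [seq (u.2, u.1) | u <- s].
have us' : uniq (pair_support s').
  rewrite -(perm_uniq (s1 := pair_support s)) // /pair_support /s'.
  elim: s {us s'} => //= u s IH.
  by rewrite (perm_catCA [:: u.1.1] [:: u.2.1]) /= !perm_cons.
apply: le_trans (h _ us'); rewrite big_map; apply: ler_sum => u _.
rewrite /pair_excess /= (_ : _ - _ - _ - _ = P u.2.1 u.2.2 - P u.1.1 u.1.2 - tau) //.
by ring.
Qed.

Lemma infinite_pick (A : set J) (s : seq J) : infinite_set A ->
  exists2 j, A j & j \notin s.
Proof.
move=> iA; apply: contrapT => h; apply: iA.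
apply: (sub_finite_set (B := [set` s])); last exact: finite_seq.
by move=> j Aj /=; apply: contrapT => js; apply: h; exists j => //; apply/negP.
Qed.

(** A single pair already bounds differences of values at distinct indices. Everything is compared
    with one index [j0], whose own two values enter the bound. *)
Lemma pairs_bounded_family tau P C : pairs_bounded tau P C -> family_bounded P.
Proof.
move=> h.
have single u v : u.1 != v.1 -> P u.1 u.2 - P v.1 v.2 <= C + tau.
  move=> uv; have /(h [:: (u, v)]) : uniq (pair_support [:: (u, v)]).
    by rewrite /= inE uv.
  rewrite big_seq1 /pair_excess /= => h1.
  have : P u.1 u.2 - P v.1 v.2 - tau <= C by apply: le_trans h1; rewrite le_max lexx orbT.
  lra.
have [j0 _ _] := infinite_pick [::] J_infinite.
pose B0 := `|P j0 true| + `|P j0 false| + `|C + tau|.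
exists B0 => j b; have [->|jj0] := eqVneq j j0.
  have := normr_ge0 (C + tau); have := normr_ge0 (P j0 (~~ b)).
  by rewrite /B0; case: b => /=; lra.
have := single (j, b) (j0, true) jj0; rewrite /= => h1.
have := single (j0, true) (j, b); rewrite /= eq_sym => /(_ jj0) h2.
have := normr_ge0 (P j0 false); have := ler_norm (P j0 true).
have := ler_norm (- P j0 true); have := ler_norm (C + tau).
by rewrite normrN /B0 => *; rewrite ler_norml; apply/andP; split; lra.
Qed.

(* Pairing each index of F with a fresh index at which P nearly attains its
   lower limit. *)
Lemma fresh_pairs P x (F : seq (J * bool)) (A : seq J) :
  infinite_set (exceeds (fun j b => - P j b) (- x)) ->
  uniq [seq u.1 | u <- F] ->
  exists s : seq ((J * bool) * (J * bool)),
    [/\ [seq u.1 | u <- s] = F, uniq (pair_support s),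
        forall u, u \in s -> P u.2.1 u.2.2 < x
      & forall u, u \in s -> u.2.1 \notin A].
Proof.
move=> inf_x; elim: F A => [|u F IH] A /=; first by move=> _; exists [::].
move=> /andP[uF unF].
have [k [t xk] kN] := infinite_pick ([:: u.1 & [seq v.1 | v <- F]] ++ A) inf_x.
have [s [sF us sx sA]] := IH ([:: u.1; k] ++ A) unF.
have memsup i : i \in pair_support s ->
    i \in [seq v.1 | v <- F] \/ exists2 v, v \in s & v.2.1 = i.
  move=> /flattenP[_ /mapP[v vs ->]]; rewrite !inE => /orP[]/eqP ->.
    by left; rewrite -sF -map_comp; apply/mapP; exists v.
  by right; exists v.
move: kN; rewrite mem_cat !inE !negb_or => /andP[/andP[ku kF] kA].
exists ((u, (k, t)) :: s); split => /=.
- by rewrite sF.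
- rewrite us andbT inE negb_or eq_sym ku /=; apply/andP; split.
    apply/negP => /memsup[|[v /sA + vu]]; first exact/negP.
    by rewrite vu mem_cat inE eqxx.
  apply/negP => /memsup[|[v /sA + vu]]; first exact/negP.
  by rewrite vu mem_cat !inE eqxx orbT.
- by move=> v; rewrite inE => /orP[/eqP -> /=|/sx//]; rewrite -ltrN2.
- move=> v; rewrite inE => /orP[/eqP ->//|/sA].
  by rewrite mem_cat negb_or => /andP[].
Qed.

(** Otherwise infinitely many indices come close to each of the two limits, and arbitrarily many
    disjoint pairs have an excess bounded away from 0. *)
Lemma pairs_bounded_gap tau P C : pairs_bounded tau P C ->
  limsup_fam P <= - limsup_fam (fun j b => - P j b) + tau.
Proof.
move=> h; have bP := pairs_bounded_family h; have bN := family_boundedN bP.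
set a := limsup_fam P; set l := limsup_fam _.
rewrite leNgt; apply/negP => gap.
(* Two thirds of the gap pay for the two approximations; the remaining third is the excess gained
   per pair. *)
pose e := (a + l - tau) / 3; have e0 : 0 < e by rewrite /e; lra.
have infA : infinite_set (exceeds P (a - e)) by apply: limsup_gt => //; lra.
have infB : infinite_set (exceeds (fun j b => - P j b) (- (- l + e))).
  by apply: limsup_gt => //; rewrite -/l; lra.
have [N CN] : exists N : nat, C < N%:R * e.
  exists (Num.truncn (`|C| / e)).+1; rewrite -ltr_pdivrMr//.
  apply: le_lt_trans (truncnS_gt _); rewrite ler_pM2r ?invr_gt0//.
  exact: ler_norm.
have [F [unF sizF FA]] : exists F : seq (J * bool),
    [/\ uniq [seq u.1 | u <- F], size F = N
      & forall u, u \in F -> a - e < P u.1 u.2].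
  elim: N {CN} => [|N [F [unF sF FA]]]; first by exists [::].
  have [j [b jA] jF] := infinite_pick [seq u.1 | u <- F] infA.
  exists ((j, b) :: F); split => /=; rewrite ?jF ?sF//.
  by move=> u; rewrite inE => /orP[/eqP ->//|/FA].
have [s [sF us sx _]] := fresh_pairs [::] infB unF.
have := h s us; apply/negP; rewrite -ltNge; apply: lt_le_trans CN _.
rewrite -sizF -sF size_map mulr_natl -sumr_const_seq big_seq [leRHS]big_seq.
apply: ler_sum => u us'; rewrite /pair_excess le_max; apply/orP; right.
have := sx _ us'; have /FA : u.1 \in F by rewrite -sF map_f.
by rewrite /e; lra.
Qed.

(** If the limsup is below the midpoint, only finitely many indices contribute. Otherwise the
    midpoint equals both the limsup and [liminf + tau], and a fresh partner near the liminf turns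
    each excess over the midpoint into a pair excess. *)
Lemma pairs_bounded_sum_gt tau P C : pairs_bounded tau P C ->
  exists C' : R, forall (F : seq J) b, uniq F ->
    \sum_(j <- F) Num.max 0 (P j b - midpoint tau P) <= C'.
Proof.
move=> h; have bP := pairs_bounded_family h; have bN := family_boundedN bP.
have := pairs_bounded_gap h; rewrite /midpoint.
set a := limsup_fam P; set l := limsup_fam _ => al; set th := (_ / 2).
have [al'|al'] := ltrP a (- l + tau).
  have /finite_seqP[S SE] : finite_set (exceeds P th).
    by apply: limsup_lt => //; rewrite -/a /th; lra.
  have [B PB] := bP; exists ((B + `|th|) *+ size S) => F b uF.
  have memS j : th < P j b -> j \in S.
    move=> jth; have : exceeds P th j by exists b.
    by rewrite SE.
  rewrite (bigID (mem S)) /= [X in _ + X]big1 ?addr0; last first.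
    move=> j jS; apply/max_idPl; rewrite subr_le0 leNgt.
    by apply: contra jS; apply: memS.
  apply: (le_trans (y := \sum_(j <- F | j \in S) (B + `|th|))).
    apply: ler_sum => j _; rewrite ge_max; apply/andP; split.
      by rewrite addr_ge0// (le_trans _ (PB j b)).
    have := PB j b; rewrite ler_norml => /andP[_ ?].
    by have := ler_norm (- th); rewrite normrN; lra.
  rewrite -big_filter sumr_const_seq.
  have Bth : 0 <= B + `|th|.
    have [j0 _ _] := infinite_pick [::] J_infinite.
    by rewrite addr_ge0// (le_trans _ (PB j0 b)).
  rewrite ler_wpMn2l// uniq_leq_size ?filter_uniq// => j.
  by rewrite mem_filter => /andP[].
exists (C + 1) => F b uF.
have thE : th = a by rewrite /th; lra.
pose F' := [seq j <- F | th < P j b].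
have -> : \sum_(j <- F) Num.max 0 (P j b - th) = \sum_(j <- F') (P j b - th).
  rewrite big_filter (bigID (fun j => th < P j b)) /= [X in _ + X]big1 ?addr0.
    by apply: eq_bigr => j hj; apply/max_idPr; rewrite subr_ge0 ltW.
  by move=> j; rewrite -leNgt => hj; apply/max_idPl; rewrite subr_le0.
(* The partners miss the liminf by less than [e] each, so over [F'] the total error is at most 1;
   hence the bound [C + 1]. *)
pose e : R := (size F').+1%:R^-1.
have e0 : 0 < e by rewrite invr_gt0.
have inf_x : infinite_set (exceeds (fun j b => - P j b) (- (- l + e))).
  by apply: limsup_gt => //; rewrite -/l; lra.
have unF' : uniq [seq u.1 | u <- [seq (j, b) | j <- F']].
  by rewrite -map_comp map_id filter_uniq.
have [s [sF us sx _]] := fresh_pairs [::] inf_x unF'.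
have szs : size s = size F' by rewrite -(size_map (fun j => (j, b)) F') -sF size_map.
have -> : \sum_(j <- F') (P j b - th) = \sum_(u <- s) (P u.1.1 u.1.2 - th).
  rewrite -(big_map (fun j => (j, b)) xpredT (fun v => P v.1 v.2 - th)) -sF.
  by rewrite big_map.
apply: (le_trans (y := \sum_(u <- s) (pair_excess tau P u + e))).
  rewrite big_seq [leRHS]big_seq; apply: ler_sum => u /sx ux.
  rewrite -lerBlDr /pair_excess le_max; apply/orP; right; lra.
rewrite big_split/= lerD ?h// sumr_const_seq szs -mulr_natl /e.
by rewrite ler_pdivrMr ?ltr0n// mul1r ler_nat.
Qed.

Lemma pairs_bounded_sum tau P C : pairs_bounded tau P C ->
  exists C' : R, forall (F : seq J) b, uniq F ->
    \sum_(j <- F) (Num.max 0 (P j b - midpoint tau P)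
                   + Num.max 0 (midpoint tau P - P j b - tau)) <= C'.
Proof.
move=> h; have bP := pairs_bounded_family h.
have [C1 h1] := pairs_bounded_sum_gt h.
have [C2 h2] := pairs_bounded_sum_gt (pairs_bounded_opp h).
exists (C1 + C2) => F b uF; rewrite big_split/= lerD ?h1//.
apply: le_trans (h2 F b uF); rewrite midpoint_opp//; apply: ler_sum => j _.
by rewrite (_ : midpoint tau P - P j b - tau = - P j b - tau - - midpoint tau P)//; ring.
Qed.

End LimsupPairs.

(** * Boundedness on orbits of affine reflections *)

Section Reach.
Context (R : realType) (J : choiceType).

Definition sign_allowed (sg : bool) (a : R) : Prop := a = 1 \/ (sg /\ a = -1).

Definition pair_move (a b : R) (j k : J) (N : R) (y : J -> R) : J -> R :=
  fun i => if i == j then a * b * y k + a * N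
           else if i == k then a * b * y j - b * N else y i.

Definition flip_move (j : J) (N : R) (y : J -> R) : J -> R :=
  fun i => if i == j then - y j + N else y i.

(* [reach sg fl tau l p y v]: y is obtained from l by the affine reflections in
   the roots a eps_j - b eps_k (and, if fl holds, in +-eps_j) with shifts in
   tau Z, and v = \sum_j ((y_j^2/2 - p_j y_j) - (l_j^2/2 - p_j l_j)). *)
Inductive reach (sg fl : bool) (tau : R) (l p : J -> R) : (J -> R) -> R -> Prop :=
| reach_id : reach sg fl tau l p l 0
| reach_pair y v j k a b (n : int) : reach sg fl tau l p y v -> j != k ->
    sign_allowed sg a -> sign_allowed sg b ->
    reach sg fl tau l p (pair_move a b j k (tau * n%:~R) y)
      (v + (a * y j - b * y k - tau * n%:~R) * (a * p j - b * p k - tau * n%:~R))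
| reach_flip y v j (n : int) : reach sg fl tau l p y v -> fl ->
    reach sg fl tau l p (flip_move j (tau * n%:~R) y)
      (v + (2 * y j - tau * n%:~R) * (2 * p j - tau * n%:~R) / 2).

Definition lattice (o : R) : set R := [set x | x - o \is a Num.int].

(** [theta x] is to be the slope of a convex function G between [x - 1] and [x]; the last clause
    then expresses that G is even, which is where [1 - x] comes from. *)
Definition threshold (sg : bool) (o tau : R) (theta : R -> R) : Prop :=
  [/\ forall x, lattice o x -> theta x <= theta (x + 1),
      forall x, lattice o x -> theta (x + tau) = theta x + tau
    & sg -> forall x, lattice o x -> theta (1 - x) = - theta x].

(** For [s = 0] this says that [p j] is a subgradient at [l j] of the function with slopes
    [theta]. *)
Definition in_window (theta : R -> R) (l p s : J -> R) : Prop :=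
  forall j, theta (l j) - s j <= p j <= theta (l j + 1) + s j.

Definition sums_bounded (s : J -> R) (S : R) : Prop :=
  forall F : seq J, uniq F -> \sum_(j <- F) s j <= S.

Lemma latticeD o x y : lattice o x -> y \is a Num.int -> lattice o (x + y).
Proof. by rewrite /lattice /= => ox iy; rewrite addrAC rpredD. Qed.

Lemma lattice_sign (sg : bool) o a x : (sg -> 2 * o \is a Num.int) ->
  sign_allowed sg a -> lattice o x -> lattice o (a * x).
Proof.
move=> h [->|[/h h2 ->]]; rewrite /lattice /= ?mul1r// => ox.
rewrite (_ : _ - _ = - (x - o) - 2 * o); last by ring.
by rewrite rpredB// rpredN.
Qed.

Lemma lattice_sub o x y : lattice o x -> lattice o y -> x - y \is a Num.int.
Proof.
move=> ox oy; rewrite (_ : x - y = (x - o) - (y - o)); last by ring.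
by rewrite rpredB.
Qed.

Lemma int_gt0_ge1 (x : R) : x \is a Num.int -> 0 < x -> 1 <= x.
Proof. by move=> /intrP[m ->]; rewrite ltr0z ler1z. Qed.

Lemma lattice_step_ind o (d : R) (Q : R -> Prop) : d \is a Num.int ->
  (forall x, lattice o x -> Q x <-> Q (x + d)) ->
  forall x (n : int), lattice o x -> Q x -> Q (x + d * n%:~R).
Proof.
move=> id h.
have up (n : nat) x : lattice o x -> Q x <-> Q (x + d * n%:R).
  elim: n x => [|n IH] x ox; first by rewrite mulr0 addr0.
  rewrite IH// h; last by apply: latticeD => //; rewrite rpredM// natr_int.
  by rewrite -addrA -[X in d * _ + X]mulr1 -mulrDr -natr1.
move=> x [n|n] ox Qx; first by rewrite -up.
rewrite NegzE mulrNz mulrN; apply/(up n.+1); last by rewrite -pmulrn addrNK.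
by apply: latticeD => //; rewrite rpredN rpredM// intr_int.
Qed.

(** * From boundedness under pair moves to a threshold *)

Section Upper.
Context (sg : bool) (tau : nat) (o : R) (l p : J -> R).
Hypothesis J_infinite : infinite_set [set: J].
Hypothesis tau_gt0 : (0 < tau)%N.
Hypothesis lL : forall j, lattice o (l j).
Hypothesis oL : sg -> 2 * o \is a Num.int.

Local Notation T := (tau%:R : R).

Let T0 : 0 < T. Proof. by rewrite ltr0n. Qed.

(** Without signs the two copies of a coordinate coincide. *)
Definition copy_sign (b : bool) : R := if sg && ~~ b then -1 else 1.

Lemma copy_signP b : sign_allowed sg (copy_sign b).
Proof. by rewrite /copy_sign; case: sg; case: b => /=; [left|right|left|left]. Qed.

(** The inequality [z + T m < x] is strict: a translate equal to the cut counts as above it. *)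
Definition largest_below (x : R) (z : R) : int := Num.ceil ((x - z) / T) - 1.

(* p_j (or its mirror image) translated by the largest multiple of tau keeping
   the corresponding translate of l_j below x. *)
Definition lowered (x : R) (j : J) (b : bool) : R :=
  copy_sign b * p j + T * (largest_below x (copy_sign b * l j))%:~R.

Lemma largest_below_lt x z : z + T * (largest_below x z)%:~R < x.
Proof.
rewrite /largest_below -ltrBrDl mulrC -ltr_pdivlMr//.
by rewrite intrD; have := ceilB1_lt ((x - z) / T); rewrite intrD.
Qed.

Lemma largest_below_ge x z : x <= z + T * (largest_below x z)%:~R + T.
Proof.
rewrite /largest_below intrD mulrDr -!addrA mulrN1 addNr addr0 -lerBlDl.
by rewrite mulrC -ler_pdivrMr// ceil_ge.
Qed.

Lemma largest_belowD x z : largest_below (x + T) z = largest_below x z + 1.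
Proof.
rewrite /largest_below addrAC mulrDl divff ?gt_eqF// -[1 in LHS]/(1%:~R).
by rewrite ceilDrz ?intr_int// intrKceil; ring.
Qed.

Lemma largest_below_mono x x' z : x <= x' -> largest_below x z <= largest_below x' z.
Proof.
by move=> xx; rewrite lerD2r le_ceil// ler_pM2r ?invr_gt0// lerD2r.
Qed.

(** By integrality [- z + T m < 1 - x] means [z - T m >= x]. So the mirror [x |-> 1 - x] exchanges
    the last translate below the cut with the first one at or above it. *)
Lemma largest_belowN x z : x - z \is a Num.int ->
  largest_below (1 - x) (- z) = - largest_below x z - 1.
Proof.
move=> /intrP[m xz]; rewrite /largest_below (_ : 1 - x - - z = 1 - m%:~R); last first.
  by rewrite -xz; ring.
rewrite xz; congr (_ - 1); rewrite opprB.
set c := Num.ceil (m%:~R / T); apply: ceil_def; rewrite !intrD !intrN.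
have c1 : c%:~R - 1 < m%:~R / T by have := ceilB1_lt (m%:~R / T); rewrite intrD intrN.
have c2 : m%:~R / T <= c%:~R by exact: ceil_ge.
move: c1 c2; rewrite ltr_pdivlMr// ler_pdivrMr// ltr_pdivlMr// ler_pdivrMr// => c1 c2.
have : m%:~R - (c%:~R - 1) * T \is a Num.int.
  by apply: rpredB; rewrite ?intr_int//; apply: rpredM; rewrite ?natr_int// rpredB ?intr_int
      ?rpred1.
move=> /int_gt0_ge1; rewrite subr_gt0 => /(_ c1) c3.
apply/andP; split; lra.
Qed.

(** Reflect each pair of positive excess so as to exchange the last translate of [a l_j] below x
    with the first translate of [b l_k] at or above x. These differ by at least 1, being in one
    coset of the integers, so the energy drops by at least the excess. *)
Lemma reach_pairs x (s : seq ((J * bool) * (J * bool))) :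
  lattice o x -> uniq (pair_support s) ->
  exists y v, [/\ reach sg false T l p y v,
    forall i, i \notin pair_support s -> y i = l i
    & v <= - \sum_(u <- s) pair_excess T (lowered x) u].
Proof.
move=> ox; elim: s => [|u s IH] us.
  by exists l, 0; split=> //; [exact: reach_id | rewrite big_nil oppr0].
move: us; rewrite /pair_support /= inE negb_or => /and3P[/andP[jk js] ks us].
have {IH us} [y [v [yv yl vs]]] := IH us.
set j := u.1.1 in jk js *; set k := u.2.1 in jk ks *.
pose a := copy_sign u.1.2; pose b := copy_sign u.2.2.
pose mj := largest_below x (a * l j); pose mk := largest_below x (b * l k).
pose V := a * p j + T * mj%:~R - (b * p k + T * mk%:~R) - T.
have [V0|V0] := lerP V 0.
  exists y, v; split => //.
    by move=> i; rewrite !inE !negb_or => /and3P[_ _ /yl].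
  by rewrite big_cons [pair_excess _ _ _](max_idPl _)// add0r.
(* The offset matches translate [mj] of the first coordinate, just below the cut, with translate
   [mk + 1] of the second, just above it. *)
pose n : int := mk + 1 - mj.
have nE : n%:~R = mk%:~R + 1 - mj%:~R :> R by rewrite [LHS]intrD intrN intrD.
exists (pair_move a b j k (T * n%:~R) y), (v + (a * y j - b * y k - T * n%:~R) * (a * p j - b *
    p k - T * n%:~R)).
split.
- by apply: reach_pair => //; apply: copy_signP.
- move=> i; rewrite !inE !negb_or => /and3P[/negPf ij /negPf ik /yl].
  by rewrite /pair_move ij ik.
rewrite !yl// big_cons opprD addrC lerD// {1}/pair_excess.
rewrite [Num.max _ _](max_idPr _); last exact: ltW V0.
have -> : lowered x u.1.1 u.1.2 - lowered x u.2.1 u.2.2 - T = V by [].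
have -> : a * p j - b * p k - T * n%:~R = V.
  by rewrite /V nE; ring.
rewrite -[leRHS]mulN1r ler_pM2r// lerBlDr.
have aL : lattice o (a * l j) by apply: lattice_sign oL (copy_signP _) _.
have iM m : T * m%:~R \is a Num.int by rewrite rpredM ?natr_int ?intr_int.
have := largest_below_lt x (a * l j); rewrite -/mj -subr_gt0 => /int_gt0_ge1.
rewrite opprD addrA rpredB ?(lattice_sub ox aL)// => /(_ isT) h1.
have := largest_below_ge x (b * l k); rewrite -/mk => h2.
have -> : T * n%:~R = T * mk%:~R + T - T * mj%:~R by rewrite nE; ring.
lra.
Qed.

Lemma loweredD x j b : lowered (x + T) j b = lowered x j b + T.
Proof. by rewrite /lowered largest_belowD intrD mulrDr mulr1 addrA. Qed.

(** By strictness the last translate of [l j] below the cut [l j] is [l j - T], while below the cut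
    [l j + 1] it is [l j] itself. These two cuts yield the two ends of the window. *)
Lemma lowered_at j : lowered (l j) j true = p j - T.
Proof.
rewrite /lowered /copy_sign andbF !mul1r /largest_below subrr mul0r ceil0.
by rewrite sub0r intrN mulrN1.
Qed.

Lemma lowered_above j : lowered (l j + 1) j true = p j.
Proof.
rewrite /lowered /copy_sign andbF !mul1r /largest_below addrAC subrr add0r.
rewrite (_ : Num.ceil _ = 1) ?subrr ?mulr0 ?addr0//; apply: ceil_def.
rewrite intrD intrN subrr divr_gt0//= ler_pdivrMr// mul1r.
by rewrite (ler_nat _ 1).
Qed.

Lemma loweredN x j b : sg -> lattice o x ->
  lowered (1 - x) j b = - lowered x j (~~ b) - T.
Proof.
move=> sgT ox; rewrite /lowered.
have cN : copy_sign b = - copy_sign (~~ b).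
  by rewrite /copy_sign sgT; case: b => /=; rewrite ?opprK.
rewrite cN !mulNr largest_belowN; first by rewrite intrD !intrN; ring.
apply: lattice_sub ox _; exact: lattice_sign oL (copy_signP _) (lL j).
Qed.

(** The threshold is the midpoint of the lowered family at each cut. The error at a cut depends only
    on the cut modulo [tau], so adding the errors of the [tau] classes gives one summable slack
    valid at all cuts. *)
Lemma exists_threshold (C : R) :
  (forall y v, reach sg false T l p y v -> - C <= v) ->
  exists theta s S, [/\ threshold sg o T theta, forall j, 0 <= s j,
    sums_bounded s S & in_window theta l p s].
Proof.
move=> hC.
have pb x : lattice o x -> pairs_bounded T (lowered x) C.
  move=> ox w uw; have [y [v [yv _ vw]]] := reach_pairs ox uw.
  by rewrite -lerN2; apply: le_trans vw; apply: hC yv.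
have fb x : lattice o x -> family_bounded (lowered x).
  by move=> ox; apply: pairs_bounded_family (pb x ox).
pose theta x := midpoint T (lowered x).
have thD x : lattice o x -> theta (x + T) = theta x + T.
  move=> ox; rewrite /theta -(midpoint_shift J_infinite T T (fb _ ox)).
  congr midpoint; apply/funext => j; apply/funext => b; exact: loweredD.
pose e x j := Num.max 0 (lowered x j true - theta x)
              + Num.max 0 (theta x - lowered x j true - T).
have e0 x j : 0 <= e x j by rewrite addr_ge0// le_max lexx.
have eD x j : lattice o x -> e (x + T) j = e x j.
  move=> ox; rewrite /e thD// loweredD.
  by congr (Num.max _ _ + Num.max _ _); ring.
have ofin x : lattice o x -> exists i : 'I_tau, forall j, e x j = e (o + i%:R) j.
  move=> ox; have /intrP[m xm] := ox.
  have tz : tau%:Z != 0 by rewrite eqz_nat -lt0n.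
  have it : (`|(m %% tau)%Z| < tau)%N.
    by rewrite -ltz_nat gez0_abs ?modz_ge0// ltz_pmod.
  exists (Ordinal it) => j /=.
  have xE : x = o + `|(m %% tau)%Z|%N%:R + T * ((m %/ tau)%Z)%:~R.
    have rE : `|(m %% tau)%Z|%N%:R = (m %% tau)%Z%:~R :> R.
      by rewrite -[in RHS](gez0_abs (modz_ge0 m tz)).
    by rewrite -[LHS](subrK o) xm rE {1}(divz_eq m tau) intrD intrM; ring.
  rewrite xE; set z := o + _.
  have oz : lattice o z by apply: latticeD; rewrite ?natr_int// /lattice /= subrr.
  apply: (lattice_step_ind (o := o) (Q := fun w => e w j = e z j)) => //.
  by move=> w ow; rewrite eD.
have eS x : lattice o x -> exists S, sums_bounded (e x) S.
  move=> ox; have [S hS] := pairs_bounded_sum J_infinite (pb x ox).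
  by exists S => F uF; apply: (hS F true uF).
have oi (i : 'I_tau) : lattice o (o + i%:R).
  by apply: latticeD; rewrite ?natr_int// /lattice /= subrr.
have [S hS] := choice (fun i => eS _ (oi i)).
pose s j := \sum_(i < tau) e (o + i%:R) j.
have es x j : lattice o x -> e x j <= s j.
  move=> /ofin[i ->]; rewrite /s (bigD1 i)//= lerDl.
  by apply: sumr_ge0 => k _.
exists theta, s, (\sum_i S i); split.
- split=> // [x ox|sgT x ox].
    have ox1 : lattice o (x + 1) by apply: latticeD => //; rewrite rpred1.
    apply: (midpoint_le J_infinite T (fb _ ox) (fb _ ox1)) => j b.
    rewrite /lowered lerD2l ler_pM2l// ler_int largest_below_mono//.
    by rewrite lerDl.
  (* The mirrored cut lowers the mirrored copies: up to exchanging the copies, the family at [1 - x]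
     is [- P - T]. *)
  rewrite /theta -(midpoint_opp J_infinite T (fb _ ox)).
  apply: (midpoint_swap J_infinite).
  + apply: fb; rewrite /lattice /= (_ : _ - _ = 1 - (x - o) - 2 * o); last by ring.
    by apply: rpredB (oL sgT); rewrite rpredB ?rpred1.
  + by apply: family_boundedD; apply: family_boundedN; apply: fb.
  + by move=> j b; rewrite loweredN.
- by move=> j; apply: sumr_ge0.
- move=> F uF; rewrite exchange_big; apply: ler_sum => i _; exact: hS.
move=> j; have ol := lL j.
have ol1 : lattice o (l j + 1) by apply: latticeD => //; rewrite rpred1.
apply/andP; split.
  have := es _ j ol; rewrite /e lowered_at => h.
  have : theta (l j) - (p j - T) - T <= s j.
    by apply: le_trans h; rewrite ler_wpDl// ?le_max lexx// orbT.
  lra.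
have := es _ j ol1; rewrite /e lowered_above => h.
have : p j - theta (l j + 1) <= s j.
  by apply: le_trans h; rewrite ler_wpDr// ?le_max lexx// orbT.
lra.
Qed.

End Upper.

Lemma sum_diff1 (F : seq J) (j : J) (g h : J -> R) : uniq F -> j \in F ->
  (forall i, i != j -> g i = h i) ->
  \sum_(i <- F) g i = \sum_(i <- F) h i + (g j - h j).
Proof.
move=> uF jF gh; rewrite !(bigD1_seq j)//= (eq_bigr h); last by move=> i /gh.
by ring.
Qed.

Lemma sum_diff2 (F : seq J) (j k : J) (g h : J -> R) :
  uniq F -> j \in F -> k \in F -> j != k ->
  (forall i, i != j -> i != k -> g i = h i) ->
  \sum_(i <- F) g i = \sum_(i <- F) h i + (g j - h j) + (g k - h k).
Proof.
move=> uF jF kF jk gh; pose h' i := if i == j then g j else h i.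
rewrite (sum_diff1 (h := h') uF kF); last first.
  by move=> i ik; rewrite /h'; case: eqP => [->//|/eqP ij]; apply: gh.
rewrite (sum_diff1 (g := h') (h := h) uF jF); last first.
  by move=> i; rewrite /h' => /negPf ->.
by rewrite /h' eqxx eq_sym (negPf jk).
Qed.

(** * From a threshold to a lower bound *)

Section Lower.
Context (sg : bool) (tau : nat) (o : R) (l p s : J -> R) (S : R) (theta : R -> R).
Hypothesis tau_gt0 : (0 < tau)%N.
Hypothesis lL : forall j, lattice o (l j).
Hypothesis oL : sg -> 2 * o \is a Num.int.

Local Notation T := (tau%:R : R).
Hypothesis thetaP : threshold sg o T theta.

Let T0 : 0 < T. Proof. by rewrite ltr0n. Qed.

Let lattice1 x : lattice o x -> lattice o (x + 1).
Proof. by move=> ox; apply: latticeD => //; rewrite rpred1. Qed.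

Let latticeT x (n : int) : lattice o x -> lattice o (x + T * n%:~R).
Proof. by move=> ox; apply: latticeD => //; rewrite rpredM ?natr_int ?intr_int. Qed.

Let latticeN x : sg -> lattice o x -> lattice o (- x).
Proof.
move=> sgT ox; rewrite -mulN1r; apply: (lattice_sign (sg := sg)) ox => //.
by right.
Qed.

Lemma primitive_exists : exists G : R -> R,
  forall x, lattice o x -> G (x + 1) = G x + theta (x + 1).
Proof.
pose Gi (m : int) : R := match m with
  | Posz n => \sum_(i < n) theta (o + i%:R + 1)
  | Negz n => - \sum_(i < n.+1) theta (o - i%:R) end.
have Gi1 m : Gi (m + 1) = Gi m + theta (o + m%:~R + 1).
  case: m => [n|[|n]].
  - by rewrite -PoszD addn1 /= big_ord_recr.
  - rewrite /= big_ord_recr big_ord0 /= big_ord0 NegzE mulrNz mulr1z.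
    by rewrite subr0 addrNK add0r addNr.
  - rewrite (_ : Negz n.+1 + 1 = Negz n); last by rewrite !NegzE; lia.
    rewrite /= [in RHS]big_ord_recr /= NegzE mulrNz -pmulrn -[n.+2%:R]natr1.
    by rewrite (_ : o - (n.+1%:R + 1) + 1 = o - n.+1%:R); ring.
exists (fun x => Gi (Num.floor (x - o))) => x /intrP[m xm].
have -> : x + 1 - o = (m + 1)%:~R by rewrite addrAC xm intrD.
by rewrite xm !intrKfloor Gi1 -xm (addrC o) subrK.
Qed.

(** Each full period adds [T] and a remainder of at most [T - 1] steps loses nothing; hence
    [d - (T - 1)]. *)
Lemma theta_growth x d : lattice o x ->
  theta x + (d%:R + 1 - T) <= theta (x + d%:R).
Proof.
have [th1 thT _] := thetaP; move=> ox.
have mono e : theta x <= theta (x + e%:R).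
  elim: e => [|e IH]; first by rewrite addr0.
  apply: le_trans IH _; rewrite -natr1 addrA; apply: th1.
  by apply: latticeD; rewrite ?natr_int.
elim/ltn_ind: d => d IH; have [dt|td] := ltnP d tau.
  apply: le_trans (mono d); rewrite gerDl subr_le0 natr1 ler_nat; exact: dt.
have dE : d%:R = (d - tau)%:R + T by rewrite -natrD subnK.
rewrite dE (addrA x) thT; last by apply: latticeD; rewrite ?natr_int.
have := IH (d - tau)%N; rewrite ltn_subrL tau_gt0 (leq_trans tau_gt0 td) => /(_ isT).
lra.
Qed.

Section Primitive.
Variable G : R -> R.
Hypothesis G1 : forall x, lattice o x -> G (x + 1) = G x + theta (x + 1).

Let e d : R := Num.max 0 (d%:R - T).

Let eS d : e d.+1 ^+ 2 / 2 <= e d ^+ 2 / 2 + Num.max 0 (d%:R + 1 - T).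
Proof.
rewrite /e -natr1; have [dt|td] := ltnP d tau.
  rewrite [Num.max _ _](max_idPl _); last by rewrite subr_le0 natr1 ler_nat.
  by rewrite expr0n mul0r addr_ge0 ?le_max ?lexx// divr_ge0// sqr_ge0.
have : 0 <= (d%:R : R) - T by rewrite subr_ge0 ler_nat.
move=> h; rewrite !(max_idPr _)//; last lra.
by nra.
Qed.

(** Beyond one period the slopes grow linearly, so G exceeds its tangent quadratically. The
    quadratic term is what later pays for the slack of the window. *)
Lemma primitive_up x d : lattice o x ->
  G x + d%:R * theta (x + 1) + e d ^+ 2 / 2 <= G (x + d%:R).
Proof.
move=> ox; elim: d => [|d IH].
  by rewrite mul0r !addr0 /e sub0r (max_idPl _) ?oppr_le0 ?ler0n// expr0n mul0r addr0.
have od : lattice o (x + d%:R) by apply: latticeD; rewrite ?natr_int.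
rewrite -natr1 addrA G1//; have := eS d.
have := theta_growth d (lattice1 ox).
have [th1 _ _] := thetaP.
have : theta (x + 1) <= theta (x + 1 + d%:R).
  elim: {IH od} d => [|d IH]; first by rewrite addr0.
  apply: le_trans IH _; rewrite -natr1 addrA; apply: th1.
  by apply: latticeD; rewrite ?natr_int//; apply: lattice1.
rewrite (addrAC x) mulrDl mul1r.
by have [h|h] := lerP (d%:R + 1 - T) 0; lra.
Qed.

Lemma primitive_down x d : lattice o x ->
  G x - d%:R * theta x + e d ^+ 2 / 2 <= G (x - d%:R).
Proof.
move=> ox; elim: d => [|d IH].
  by rewrite mul0r !subr0 /e sub0r (max_idPl _) ?oppr_le0 ?ler0n// expr0n mul0r addr0.
have od n : lattice o (x - n%:R) by apply: latticeD; rewrite ?rpredN ?natr_int.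
have := G1 (od d.+1); rewrite -natr1 opprD addrA addrNK => h1.
have := theta_growth d (od d); rewrite subrK.
have [th1 _ _] := thetaP.
have : theta (x - d%:R) <= theta x.
  elim: {IH h1} d => [|d IH]; first by rewrite subr0.
  apply: le_trans IH; have := th1 _ (od d.+1).
  by rewrite -natr1 opprD addrA addrNK.
rewrite mulrDl mul1r.
have := eS d.
by have [h|h] := lerP (d%:R + 1 - T) 0; lra.
Qed.

(** At distance d a slack r costs at most [d r], while convexity gains [(d - T)^2 / 2] once d
    exceeds [T]; the worst case [d = T + r] gives the constant. For [r = 0] it vanishes, so an exact
    window gives infimum 0. *)
Lemma primitive_ge x z q r : lattice o x -> lattice o z -> 0 <= r ->
  theta x - r <= q <= theta (x + 1) + r ->
  - (r ^+ 2 / 2 + T * r) <= (G z - q * z) - (G x - q * x).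
Proof.
move=> ox oz r0 /andP[q1 q2]; have /intrP[m zx] := lattice_sub oz ox.
have ed d : d%:R <= e d + T by rewrite /e -lerBlDr le_max lexx orbT.
have e0 d : 0 <= e d by rewrite /e le_max lexx.
have key d w : w <= r -> - (r ^+ 2 / 2 + T * r) <= e d ^+ 2 / 2 - d%:R * w.
  move=> wr; have := ed d; have := e0 d; have : 0 <= d%:R :> R by [].
  set a := e d; set b := d%:R => b0 a0 ab.
  have : b * w <= (a + T) * r by rewrite (le_trans (ler_wpM2l b0 wr))// ler_wpM2r.
  have := sqr_ge0 (a - r); rewrite sqrrB => *; lra.
case: m zx => [n|n] zx.
  have -> : z = x + n%:R by rewrite -[z](subrK x) zx addrC.
  have := primitive_up n ox; have := key n (q - theta (x + 1)).
  by rewrite lerBlDl => /(_ q2); lra.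
have -> : z = x - n.+1%:R by rewrite -[z](subrK x) zx addrC NegzE mulrNz.
have := primitive_down n.+1 ox; have := key n.+1 (theta x - q).
by rewrite lerBlDl -lerBlDr => /(_ q1); lra.
Qed.

Let H x : R := x ^+ 2 / 2 - G x.

Lemma lattice_const (f : R -> R) : (forall x, lattice o x -> f (x + 1) = f x) ->
  forall x z, lattice o x -> lattice o z -> f x = f z.
Proof.
move=> f1 x z ox oz; have /intrP[m zx] := lattice_sub oz ox.
have -> : z = x + 1 * m%:~R by rewrite -[z](subrK x) zx mul1r addrC.
apply: (lattice_step_ind (o := o) (Q := fun w => f x = f w)) => //.
by move=> w ow; rewrite f1.
Qed.

(** The increment [x + 1/2 - theta (x + 1)] of H is T-periodic, so [H (x + T) - H x] does not depend
    on x. *)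
Lemma H_periodic : exists c, forall x (n : int), lattice o x ->
  H (x + T * n%:~R) = H x + n%:~R * c.
Proof.
have [_ thT _] := thetaP.
have oo : lattice o o by rewrite /lattice /= subrr.
pose c := H (o + T) - H o; exists c.
have HT x : lattice o x -> H (x + T) = H x + c.
  move=> ox; suff : H (x + T) - H x = c by lra.
  apply: (lattice_const (f := fun x => H (x + T) - H x)) => // w ow.
  have owT : lattice o (w + T) by have := latticeT 1 ow; rewrite mulr1.
  have ow1 := lattice1 ow.
  by rewrite /H (addrAC w) !G1// (addrAC w) thT//; field.
move=> x n ox; pose K w := H w - w / T * c.
suff : K (x + T * n%:~R) = K x.
  rewrite /K mulrDl [T * _]mulrC mulfK ?gt_eqF// => h.
  by rewrite -[LHS](subrK ((x / T + n%:~R) * c)) h; ring.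
apply: (lattice_step_ind (o := o) (Q := fun w => K w = K x)) => //.
by move=> w ow; rewrite /K HT// mulrDl divff ?gt_eqF// (_ : _ + c - _ = H w - w / T * c)//; ring.
Qed.

(** Oddness of [theta] about 1/2 makes [G (- z) - G z] constant on the lattice; as it is odd in z,
    it is 0. *)
Lemma H_even : sg -> forall x, lattice o x -> H (- x) = H x.
Proof.
have [_ _ thN] := thetaP; move=> sgT.
have GN x : lattice o x -> G (- x) = G x.
  move=> ox; have oNx := latticeN sgT ox.
  pose f z := G (- z) - G z.
  have : f x = f (- x).
    apply: lattice_const => // w ow; rewrite /f G1//.
    have ow1 := lattice1 ow; have := G1 (latticeN sgT ow1).
    rewrite opprD subrK => ->; have := thN sgT _ (latticeN sgT ow).
    by rewrite opprK addrC => ->; ring.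
  by rewrite /f opprK; lra.
by move=> x ox; rewrite /H sqrrN GN.
Qed.

Lemma H_flip : sg -> forall x (n : int), lattice o x ->
  H (x + T * n%:~R) = H x /\ H (- x + T * n%:~R) = H x.
Proof.
move=> sgT x n ox; have [c Hc] := H_periodic.
suff c0 : c = 0 by rewrite !Hc ?H_even ?c0 ?mulr0 ?addr0//; exact: latticeN.
have oo : lattice o o by rewrite /lattice /= subrr.
have := H_even sgT (latticeT 1 oo); rewrite opprD.
rewrite -mulrN -intrN !Hc//; last exact: latticeN.
by rewrite H_even// intrN; lra.
Qed.

Lemma reach_lattice y v : reach sg sg T l p y v -> forall j, lattice o (y j).
Proof.
elim=> [//|{}y {}v j k a b n _ IH jk aS bS i|{}y {}v j n _ IH sgT i].
  rewrite /pair_move; case: ifP => _; last case: ifP => _ //.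
    rewrite (_ : _ + _ = a * (b * y k + T * n%:~R)); last by ring.
    by apply: (lattice_sign oL aS); apply: latticeT; apply: (lattice_sign oL bS).
  rewrite (_ : _ - _ = b * (a * y j + T * (- n)%:~R)); last by rewrite intrN; ring.
  by apply: (lattice_sign oL bS); apply: latticeT; apply: (lattice_sign oL aS).
by rewrite /flip_move; case: ifP => _ //; apply: latticeT; apply: latticeN.
Qed.

(** Without signs the constant of [H_periodic] may be nonzero, but the two coordinates shift by
    opposite multiples of [T]. With signs H is invariant coordinate by coordinate. *)
Lemma H_pair a b x z (n : int) : sign_allowed sg a -> sign_allowed sg b ->
  lattice o x -> lattice o z ->
  H (a * b * z + a * (T * n%:~R)) + H (a * b * x - b * (T * n%:~R)) = H x + H z.
Proof.
move=> aS bS ox oz.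
case: (boolP sg) => [sgT|sgF]; last first.
  have [c Hc] := H_periodic.
  have one w : sign_allowed sg w -> w = 1 by case=> // -[]; rewrite (negPf sgF).
  rewrite (one a aS) (one b bS) !mul1r -mulrN -intrN !Hc// intrN; ring.
have Hs w u m : sign_allowed sg w -> lattice o u -> H (w * u + T * m%:~R) = H u.
  by case=> [|[_]] -> ou; have [] := H_flip sgT m ou; rewrite ?mul1r ?mulN1r.
have He w u : sign_allowed sg w -> lattice o u -> H (w * u) = H u.
  by move=> wS ou; rewrite -(Hs w u 0) // mulr0 addr0.
rewrite (_ : a * b * z + _ = a * (b * z + T * n%:~R)); last by ring.
rewrite (_ : a * b * x - _ = b * (a * x + T * (- n)%:~R)); last by rewrite intrN; ring.
have oaz := latticeT n (lattice_sign oL bS oz).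
have obx := latticeT (- n) (lattice_sign oL aS ox).
by rewrite !He// !Hs// addrC.
Qed.

(** Moves alter finitely many coordinates; stating the identities for every finite F containing [F0]
    lets the induction enlarge [F0] freely. *)
Lemma reach_sums y v : reach sg sg T l p y v -> exists F0 : seq J,
  forall F, uniq F -> {subset F0 <= F} ->
  v = \sum_(j <- F) ((y j ^+ 2 / 2 - p j * y j) - (l j ^+ 2 / 2 - p j * l j))
  /\ \sum_(j <- F) (H (y j) - H (l j)) = 0.
Proof.
elim=> [|{}y {}v j k a b n yv [F0 IH] jk aS bS|{}y {}v j n yv [F0 IH] sgT].
- by exists [::] => F _ _; split; rewrite big1// => j _; rewrite subrr.
- exists [:: j, k & F0] => F uF sF.
  have jF : j \in F by apply: sF; rewrite inE eqxx.
  have kF : k \in F by apply: sF; rewrite !inE eqxx orbT.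
  have sF0 : {subset F0 <= F} by move=> i iF; apply: sF; rewrite !inE iF !orbT.
  have [-> h] := IH F uF sF0.
  have kj : (k == j) = false by rewrite eq_sym (negPf jk).
  have off i : i != j -> i != k -> pair_move a b j k (T * n%:~R) y i = y i.
    by rewrite /pair_move => /negPf -> /negPf ->.
  have mj : pair_move a b j k (T * n%:~R) y j = a * b * y k + a * (T * n%:~R).
    by rewrite /pair_move eqxx.
  have mk : pair_move a b j k (T * n%:~R) y k = a * b * y j - b * (T * n%:~R).
    by rewrite /pair_move kj eqxx.
  have sq w : sign_allowed sg w -> w ^+ 2 = 1.
    by case=> [->|[_ ->]]; rewrite ?sqrrN expr1n.
  split.
    rewrite [RHS](sum_diff2 uF jF kF jk (h := fun j => ((y j ^+ 2 / 2 - p j * y j) - (l j ^+ 2 /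
        2 - p j * l j)))); last first.
      by move=> i ij ik; rewrite off.
    rewrite -[RHS]addrA; congr (_ + _); rewrite mj mk.
    have := sq a aS; have := sq b bS => b2 a2.
    have -> : (a * b * y k + a * (T * n%:~R)) ^+ 2 = b ^+ 2 * a ^+ 2 * y k ^+ 2 + 2 * a ^+ 2 * b
        * y k * (T * n%:~R) + a ^+ 2 * (T * n%:~R) ^+ 2 by ring.
    have -> : (a * b * y j - b * (T * n%:~R)) ^+ 2 = b ^+ 2 * a ^+ 2 * y j ^+ 2 - 2 * b ^+ 2 * a
        * y j * (T * n%:~R) + b ^+ 2 * (T * n%:~R) ^+ 2 by ring.
    have -> : (a * y j - b * y k - T * n%:~R) * (a * p j - b * p k - T * n%:~R)
      = a ^+ 2 * (y j * p j) + b ^+ 2 * (y k * p k) + (T * n%:~R) ^+ 2 - a * b * (y j * p k + y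
          k * p j) - T * n%:~R * (a * (y j + p j) - b * (y k + p k)) by ring.
    by rewrite a2 b2; field.
  rewrite (sum_diff2 uF jF kF jk (h := fun j => H (y j) - H (l j))); last first.
    by move=> i ij ik; rewrite off.
  rewrite h mj mk; have oy := reach_lattice yv.
  by have := H_pair n aS bS (oy j) (oy k); lra.
exists (j :: F0) => F uF sF.
have jF : j \in F by apply: sF; rewrite inE eqxx.
have sF0 : {subset F0 <= F} by move=> i iF; apply: sF; rewrite inE iF orbT.
have [-> h] := IH F uF sF0.
have off i : i != j -> flip_move j (T * n%:~R) y i = y i.
  by rewrite /flip_move => /negPf ->.
have mj : flip_move j (T * n%:~R) y j = - y j + T * n%:~R.
  by rewrite /flip_move eqxx.
split.
  rewrite [RHS](sum_diff1 uF jF (h := fun j => ((y j ^+ 2 / 2 - p j * y j) - (l j ^+ 2 / 2 - p j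
      * l j)))); last first.
    by move=> i ij; rewrite off.
  by congr (_ + _); rewrite mj; field.
rewrite (sum_diff1 uF jF (h := fun j => H (y j) - H (l j))); last first.
  by move=> i ij; rewrite off.
have oy := reach_lattice yv.
by rewrite h mj (H_flip sgT n (oy j)).2; ring.
Qed.

End Primitive.

Lemma reach_ge y v : (forall j, 0 <= s j) -> sums_bounded s S ->
  in_window theta l p s -> reach sg sg T l p y v -> - (S ^+ 2 / 2 + T * S) <= v.
Proof.
move=> s0 sS win yv; have [G G1] := primitive_exists.
have [F0 /(_ (undup F0) (undup_uniq _))[]] := reach_sums G1 yv.
  by move=> i; rewrite mem_undup.
set F := undup F0; have uF : uniq F := undup_uniq _.
move=> -> h0; pose H x := x ^+ 2 / 2 - G x.
have oy := reach_lattice yv.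
(* Write [y^2 / 2 = G y + H y]: the H part is invariant and cancels, the G part is estimated one
   coordinate at a time. *)
rewrite (eq_bigr (fun j => ((G (y j) - p j * y j) - (G (l j) - p j * l j))
    + (H (y j) - H (l j)))); last by move=> j _; rewrite /H; ring.
rewrite big_split/= h0 addr0.
apply: (le_trans (y := \sum_(j <- F) - (s j ^+ 2 / 2 + T * s j))); last first.
  by apply: ler_sum => j _; apply: primitive_ge.
have S0 : 0 <= S by have := sS [::] isT; rewrite big_nil.
have sjS j : s j <= S by have := sS [:: j] isT; rewrite big_seq1.
rewrite sumrN lerN2 big_split/= -mulr_suml -mulr_sumr lerD//; last first.
  by rewrite ler_pM2l// sS.
(* The squares sum to at most [S^2] because each [s j] is at most [S]. *)
rewrite ler_pM2r ?invr_gt0// expr2.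
apply: (le_trans (y := \sum_(j <- F) S * s j)).
  by apply: ler_sum => j _; rewrite expr2 ler_wpM2r.
by rewrite -mulr_sumr ler_wpM2l// sS.
Qed.

End Lower.
End Reach.

(** * Twisted loops in a Hilbert--Lie algebra *)

Section HilbertLie.
Context (R : realType) (k : hilbertLie R).
Implicit Types (x y z v : k) (a : R).

Lemma ipDl x y z : ip (x + y) z = ip x z + ip y z.
Proof. by have := ip_linearl 1 x y z; rewrite scale1r mul1r. Qed.

Lemma ip0l z : ip 0 z = 0.
Proof. by have := ipDl 0 0 z; rewrite addr0 => h; lra. Qed.

Lemma ipZl a x z : ip (a *: x) z = a * ip x z.
Proof. by have := ip_linearl a x 0 z; rewrite !addr0 ip0l addr0. Qed.

Lemma ipNl x z : ip (- x) z = - ip x z.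
Proof. by rewrite -scaleN1r ipZl mulN1r. Qed.

Lemma ipBl x y z : ip (x - y) z = ip x z - ip y z.
Proof. by rewrite ipDl ipNl. Qed.

Lemma ipDr x y z : ip z (x + y) = ip z x + ip z y.
Proof. by rewrite ipC ipDl !(ipC z). Qed.

Lemma ip0r z : ip z 0 = 0. Proof. by rewrite ipC ip0l. Qed.

Lemma ipZr a x z : ip z (a *: x) = a * ip z x.
Proof. by rewrite ipC ipZl ipC. Qed.

Lemma ipNr x z : ip z (- x) = - ip z x.
Proof. by rewrite ipC ipNl ipC. Qed.

Lemma ipBr x y z : ip z (x - y) = ip z x - ip z y.
Proof. by rewrite ipDr ipNr. Qed.

Lemma ip_sumr (I : Type) (r : seq I) (f : I -> k) z :
  ip z (\sum_(i <- r) f i) = \sum_(i <- r) ip z (f i).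
Proof.
elim: r => [|i r IH]; first by rewrite !big_nil ip0r.
by rewrite !big_cons ipDr IH.
Qed.

Lemma ip_ge0 x : 0 <= ip x x.
Proof. by rewrite ip_norm sqr_ge0. Qed.

Lemma ip_eq0 x : (ip x x == 0) = (x == 0).
Proof. by rewrite ip_norm sqrf_eq0 normr_eq0. Qed.

(** Pairing with an arbitrary vector reduces identities in [k] to scalar ones within reach of
    [ring]. *)
Lemma ip_inj x y : (forall v, ip x v = ip y v) -> x = y.
Proof. by move=> h; apply/eqP; rewrite -subr_eq0 -ip_eq0 ipBl h subrr. Qed.

Lemma ip_le x y : `|ip x y| <= `|x| * `|y|.
Proof.
have [->|y0] := eqVneq y 0; first by rewrite ip0r !normr0 mulr0.
have ny : 0 < `|y| by rewrite normr_gt0.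
rewrite -ler_sqr ?nnegrE ?mulr_ge0//.
rewrite exprMn -!ip_norm -normrX ger0_norm ?sqr_ge0//.
have y1 : 0 < ip y y by rewrite ip_norm exprn_gt0.
have := ip_ge0 (ip y y *: x - ip x y *: y).
rewrite ipBl !ipBr !ipZl !ipZr (ipC y x) => h.
have : 0 <= ip y y * (ip x x * ip y y - ip x y ^+ 2) by lra.
by rewrite pmulr_rge0// subr_ge0.
Qed.

Lemma ip_continuous v : continuous (fun x => ip x v : R^o).
Proof.
move=> x; apply/cvgrPdist_lt => e e0.
have v1 : 0 < `|v| + 1 by rewrite ltr_wpDl.
near=> y; rewrite -ipBl; apply: le_lt_trans (ip_le _ _) _.
apply: (@le_lt_trans _ _ (`|x - y| * (`|v| + 1))).
  by rewrite ler_wpM2l// lerDl.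
rewrite -ltr_pdivlMr//; near: y.
by apply: cvgr_dist_lt; rewrite ?divr_gt0//.
Unshelve. all: by end_near. Qed.

Lemma brDl x y z : br (x + y) z = br x z + br y z.
Proof. by have := br_linearl 1 x y z; rewrite !scale1r. Qed.

Lemma br0l z : br 0 z = 0.
Proof.
have := brDl 0 0 z; rewrite addr0 => /eqP.
by rewrite eq_sym -subr_eq0 addrK => /eqP.
Qed.

Lemma brZl a x z : br (a *: x) z = a *: br x z.
Proof. by have := br_linearl a x 0 z; rewrite !addr0 br0l addr0. Qed.

Lemma brNl x z : br (- x) z = - br x z.
Proof. by rewrite -scaleN1r brZl scaleN1r. Qed.

(** The structure postulates linearity in the left argument; invariance and nondegeneracy of the
    scalar product carry it to the right. *)
Lemma brDr x y z : br z (x + y) = br z x + br z y.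
Proof.
apply: ip_inj => t; rewrite ipDl.
by rewrite !(ipC _ t) -!ip_invariant ipDr.
Qed.

Lemma brC x y : br x y = - br y x.
Proof.
have := br_alt (x + y); rewrite brDl !brDr !br_alt add0r addr0 => h.
by apply/eqP; rewrite -addr_eq0 h.
Qed.

Lemma br0r z : br z 0 = 0. Proof. by rewrite brC br0l oppr0. Qed.

Lemma brZr a x z : br z (a *: x) = a *: br z x.
Proof. by rewrite brC brZl brC scalerN opprK. Qed.

Lemma brNr x z : br z (- x) = - br z x.
Proof. by rewrite brC brNl opprK brC. Qed.

Lemma ip_br x y z : ip x (br y z) = ip (br x y) z.
Proof. by rewrite ip_invariant. Qed.

Lemma br_leibniz x y z : br x (br y z) = br (br x y) z + br y (br x z).
Proof.
have := br_jacobi x y z; rewrite (brC z (br x y)) (brC z x) brNr => h.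
by apply/eqP; rewrite -subr_eq0 opprD addrA -h addrAC.
Qed.

Definition ipE := (ipDl, ipDr, ipNl, ipNr, ipZl, ipZr, ip0l, ip0r).
Definition brE := (brDl, brDr, brNl, brNr, brZl, brZr, br0l, br0r).

(* Multiplication by exp(i a) on the complexification of k. *)
Definition rot (a : R) (x : k * k) : k * k :=
  (cos a *: x.1 - sin a *: x.2, sin a *: x.1 + cos a *: x.2).

Definition conjp (x : k * k) : k * k := (x.1, - x.2).

Lemma rotD a b (x : k * k) : rot a (rot b x) = rot (a + b) x.
Proof.
apply: injective_projections; apply: ip_inj => t; rewrite /= !ipE cosD sinD; ring.
Qed.

Lemma rot0 (x : k * k) : rot 0 x = x.
Proof. by apply: injective_projections; apply: ip_inj => t; rewrite /= !ipE cos0 sin0; ring. Qed.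

Lemma rot_conj a (x : k * k) : conjp (rot a x) = rot (- a) (conjp x).
Proof.
by apply: injective_projections; apply: ip_inj => t; rewrite /= !ipE cosN sinN; ring.
Qed.

Lemma rot_add a (x y : k * k) : rot a (x + y) = rot a x + rot a y.
Proof. by apply: injective_projections; apply: ip_inj => t; rewrite /= !ipE; ring. Qed.

Lemma rotZ a (c : R) (x : k * k) : rot a (c *: x) = c *: rot a x.
Proof. by apply: injective_projections; apply: ip_inj => t; rewrite /= !ipE; ring. Qed.

Lemma rot_eq0 a (x : k * k) : (rot a x == 0) = (x == 0).
Proof.
have r0 b : rot b 0 = 0 by apply: injective_projections; rewrite /= !scaler0 ?subr0 ?addr0.
apply/eqP/eqP => [h|->]; last exact: r0.
by rewrite -(rot0 x) -(addNr a) -rotD h r0.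
Qed.

Lemma cbr_rot a b (x y : k * k) :
  cbr (@br R k) (rot a x) (rot b y) = rot (a + b) (cbr (@br R k) x y).
Proof.
apply: injective_projections; apply: ip_inj => t; rewrite /= !(brE, ipE) cosD sinD; ring.
Qed.

End HilbertLie.

(** * Differentiation of loops *)

Section Derivatives.
Context (R : realType).

Lemma is_derive_linear (V W : normedModType R) (f : V -> W) (xi : R -> V) (t : R) :
  linear f -> continuous f -> derivable (xi : R^o -> V) t 1 ->
  is_derive (t : R^o) 1 (fun s => f (xi s)) (f ('D_1 (xi : R^o -> V) t)).
Proof.
move=> lf cf dxi.
have fB x y : f (x - y) = f x - f y.
  by rewrite -scaleN1r addrC lf scaleN1r addrC.
have f0 : f 0 = 0 by rewrite -(subrr 0) fB subrr.
have fZ a x : f (a *: x) = a *: f x by rewrite -[a *: x]addr0 lf f0 addr0.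
have cv : h^-1 *: (f (xi (h *: 1 + t)) - f (xi t)) @[h --> (0 : R^o)^'] -->
    f ('D_1 (xi : R^o -> V) t).
  under eq_cvg do rewrite -fB -fZ.
  have h1 : (fun h : R => h^-1 *: (xi (h *: 1 + t) - xi t)) @ (0 : R^o)^' -->
    'D_1 (xi : R^o -> V) t by exact: dxi.
  exact: (cvg_comp _ _ h1 (cf _)).
by apply: DeriveDef; [apply/cvg_ex; exists (f ('D_1 xi t)) | apply/cvg_lim].
Qed.

Lemma is_derive_cos_mul (w t : R) :
  is_derive (t : R^o) 1 (fun s => cos (w * s) : R^o) (- (w * sin (w * t))).
Proof.
have h : is_derive (t : R) 1 (fun s => w * s) w.
  by apply: is_derive_eq; rewrite ?mulr1// /GRing.scale /= mulr1.
have := is_derive1_comp (is_derive_cos (w * t)) h.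
by rewrite mulNr mulrC.
Qed.

Lemma is_derive_sin_mul (w t : R) :
  is_derive (t : R^o) 1 (fun s => sin (w * s) : R^o) (w * cos (w * t)).
Proof.
have h : is_derive (t : R) 1 (fun s => w * s) w.
  by apply: is_derive_eq; rewrite ?mulr1// /GRing.scale /= mulr1.
have := is_derive1_comp (is_derive_sin (w * t)) h.
by rewrite mulrC.
Qed.

(** The conserved quantity is the real part of [exp(- i w t) (f + i g)]. *)
Lemma rotation_first_integral (w : R) (f g : R -> R) :
  (forall s, is_derive (s : R) 1 f (- w * g s)) ->
  (forall s, is_derive (s : R) 1 g (w * f s)) ->
  forall t, cos (w * t) * f t + sin (w * t) * g t = f 0.
Proof.
move=> df dg t; pose c s := cos (w * s); pose z s := sin (w * s).
have dc s : is_derive (s : R) 1 c (- (w * z s)) by exact: is_derive_cos_mul.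
have dz s : is_derive (s : R) 1 z (w * c s) by exact: is_derive_sin_mul.
have dF s : is_derive (s : R) 1 (fun s => c s * f s + z s * g s) 0.
  apply: (is_derive_eq (is_deriveD (is_deriveM (dc s) (df s))
    (is_deriveM (dz s) (dg s)))).
  by rewrite /GRing.scale /=; ring.
have := is_derive_0_is_cst t 0 dF.
by rewrite /c /z mulr0 cos0 sin0 mul1r mul0r addr0.
Qed.

Context (k : hilbertLie R).

Lemma is_derive_ip (xi : R -> k) t v : derivable (xi : R^o -> k) t 1 ->
  is_derive (t : R^o) 1 (fun s => ip (xi s) v : R^o) (ip (derive1 (xi : R^o -> k) t) v).
Proof.
move=> d; rewrite derive1E; apply: (is_derive_linear (f := fun x : k => ip x v : R^o)) => //.
  by move=> a x y; rewrite ip_linearl.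
exact: ip_continuous.
Qed.

(* The solution of xi' = i w xi, with xi = xi1 + i xi2. *)
Lemma rotation_ode (w : R) (xi1 xi2 : R -> k) :
  (forall t, derivable (xi1 : R^o -> k) t 1) ->
  (forall t, derivable (xi2 : R^o -> k) t 1) ->
  (forall t, derive1 (xi1 : R^o -> k) t = - w *: xi2 t) ->
  (forall t, derive1 (xi2 : R^o -> k) t = w *: xi1 t) ->
  forall t, (xi1 t, xi2 t) = rot (w * t) (xi1 0, xi2 0).
Proof.
move=> d1 d2 e1 e2 t.
have key v : let f s := ip (xi1 s) v in let g s := ip (xi2 s) v in
    cos (w * t) * f t + sin (w * t) * g t = f 0 /\
    cos (w * t) * g t - sin (w * t) * f t = g 0.
  move=> f g.
  have df s : is_derive (s : R) 1 f (- w * g s).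
    by have := is_derive_ip v (d1 s); rewrite e1 ipZl.
  have dg s : is_derive (s : R) 1 g (w * f s).
    by have := is_derive_ip v (d2 s); rewrite e2 ipZl.
  have dNf s : is_derive (s : R) 1 (- f) (w * g s).
    by apply: is_derive_eq; rewrite mulNr opprK.
  split; first exact: rotation_first_integral.
  rewrite -(@rotation_first_integral w g (- f) _ _ t) ?mulrN// => s.
  by apply: is_derive_eq; rewrite [(- f) s]/(- f s) mulrN mulNr opprK.
have c2s2 := cos2Dsin2 (w * t).
apply: injective_projections; apply: ip_inj => v; have [] := key v; rewrite /= !ipE => <- <-.
  by transitivity ((cos (w * t) ^+ 2 + sin (w * t) ^+ 2) * ip (xi1 t) v);
    [rewrite c2s2 mul1r | ring].
by transitivity ((cos (w * t) ^+ 2 + sin (w * t) ^+ 2) * ip (xi2 t) v);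
  [rewrite c2s2 mul1r | ring].
Qed.

Definition trig_loop (w : R) (u v : k) (t : R) : k := cos (w * t) *: u + sin (w * t) *: v.

Lemma is_derive_trig_loop w u v t :
  is_derive (t : R^o) 1 (trig_loop w u v : R^o -> k)
    (trig_loop w (w *: v) (- w *: u) t).
Proof.
have lin (x : k) : linear (fun r : R^o => r *: x).
  by move=> a r s; rewrite scalerDl -scalerA.
have cont (x : k) : continuous (fun r : R^o => r *: x).
  by move=> r; apply: scalel_continuous.
have dc := is_derive_cos_mul w t; have ds := is_derive_sin_mul w t.
have h1 := is_derive_linear (lin u) (cont u) (@ex_derive _ _ _ _ _ _ _ dc).
have h2 := is_derive_linear (lin v) (cont v) (@ex_derive _ _ _ _ _ _ _ ds).
rewrite /trig_loop; apply: is_derive_eq; rewrite !derive_val.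
rewrite !scalerA addrC; congr (_ *: _ + _ *: _); ring.
Qed.

Lemma derive1_trig_loop w u v :
  derive1 (trig_loop w u v : R^o -> k) = trig_loop w (w *: v) (- w *: u).
Proof.
apply/funext => t; rewrite derive1E.
exact: (@derive_val _ _ _ _ _ _ _ (is_derive_trig_loop w u v t)).
Qed.

Lemma smooth_trig_loop w u v : smooth (trig_loop w u v).
Proof.
move=> n; elim: n u v => [|n IH] u v t.
  exact: (@ex_derive _ _ _ _ _ _ _ (is_derive_trig_loop w u v t)).
by rewrite /derive1n iterSr derive1_trig_loop; apply: IH.
Qed.

End Derivatives.

Section AlgDual.
Context (R : realType) (V : lmodType R).
Implicit Types (f g : alg_dual V) (h : V).

Lemma alg_dual_linear f : linear f.
Proof. by case: f => f /= /asboolP. Qed.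

Lemma alg_dualP f g : (forall h, f h = g h) -> f = g.
Proof. by move=> fg; apply: val_inj; apply/funext. Qed.

Lemma alg_dual_neq0 f : f != 0 -> exists h, f h != 0.
Proof.
move=> f0; apply: contrapT => h; case/eqP: f0; apply: alg_dualP => x.
by apply: contrapT => /eqP fx; apply: h; exists x.
Qed.

Lemma alg_dual_rD f h h' : f (h + h') = f h + f h'.
Proof. by have := alg_dual_linear f 1 h h'; rewrite !scale1r. Qed.

Lemma alg_dual_r0 f : f 0 = 0.
Proof. by have := alg_dual_rD f 0 0; rewrite addr0 => h; apply: (addrI (f 0)); rewrite addr0. Qed.

Lemma alg_dual_rZ (a : R) f h : f (a *: h) = a * f h.
Proof. by have := alg_dual_linear f a h 0; rewrite !addr0 alg_dual_r0 addr0. Qed.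

Lemma alg_dual_rN f h : f (- h) = - f h.
Proof. by rewrite -scaleN1r alg_dual_rZ mulN1r. Qed.

End AlgDual.

(** * Weight spaces and root vectors of the affinisation *)

Section RootSpaces.
Context (R : realType) (k : hilbertLie R) (t0 : submodClosed k).
Implicit Types (alpha nu : alg_dual (it0 t0)) (h : it0 t0).

Lemma weight_spaceP alpha (x : k * k) : weight_space alpha x <->
  forall h, br (val h) x.1 = (alpha h : R) *: x.2 /\
            br (val h) x.2 = - ((alpha h : R) *: x.1).
Proof.
split=> wx h.
  have := wx h; rewrite /cbr /= !br0l sub0r add0r => -[e1 e2].
  by rewrite e2 -e1 opprK.
by have [e1 e2] := wx h; rewrite /cbr /= !br0l sub0r add0r e1 e2 opprK; case: x {wx e1 e2}.
Qed.

Lemma weight_space_scale alpha (x : k * k) (a b : R) : weight_space alpha x ->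
  weight_space alpha (a *: x.1 - b *: x.2, b *: x.1 + a *: x.2).
Proof.
move=> /weight_spaceP wx; apply/weight_spaceP => h /=; have [e1 e2] := wx h.
split; apply: ip_inj => t; rewrite !brE e1 e2 !ipE; ring.
Qed.

Lemma weight_space_rot alpha (x : k * k) (a : R) : weight_space alpha x ->
  weight_space alpha (rot a x).
Proof. exact: weight_space_scale. Qed.

Lemma weight_spaceD alpha (x y : k * k) : weight_space alpha x ->
  weight_space alpha y -> weight_space alpha (x + y).
Proof.
move=> /weight_spaceP wx /weight_spaceP wy; apply/weight_spaceP => h.
have [e1 e2] := wx h; have [e3 e4] := wy h.
by rewrite /= !brE e1 e2 e3 e4 !scalerDr opprD.
Qed.

Lemma weight_spaceZ alpha (x : k * k) (a : R) : weight_space alpha x ->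
  weight_space alpha (a *: x).
Proof.
move=> /weight_spaceP wx; apply/weight_spaceP => h.
have [e1 e2] := wx h.
by rewrite /= !brE e1 e2 scalerN !scalerA mulrC.
Qed.

Lemma weight_space_conj alpha (x : k * k) : weight_space alpha x ->
  weight_space (- alpha) (conjp x).
Proof.
move=> /weight_spaceP wx; apply/weight_spaceP => h; have [e1 e2] := wx h.
rewrite /= !brE e1 e2.
rewrite -[X in X /\ _]/(_ = - (alpha h : R) *: - x.2).
rewrite -[X in _ /\ X]/(_ = - (- (alpha h : R) *: x.1)).
by rewrite !scaleNr scalerN !opprK.
Qed.

Lemma weight_space_sum alpha (I : Type) (s : seq I) (f : I -> k * k) :
  (forall i, weight_space alpha (f i)) -> weight_space alpha (\sum_(i <- s) f i).
Proof.
move=> wf; elim: s => [|i s IH].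
  by rewrite big_nil; apply/weight_spaceP => h; rewrite !br0r !scaler0 oppr0.
by rewrite big_cons; apply: weight_spaceD.
Qed.

Context (phi : k -> k) (N : nat) (nu : alg_dual (it0 t0)).
Hypothesis nu_slant : slant nu.
Hypothesis t0_fixed : fixed_abelian phi t0.

Lemma t0_val h : val h \in t0. Proof. exact: valP h. Qed.

Lemma DbarP : is_Dbar nu (Dbar nu).
Proof. by have [D hD] := nu_slant; exact: (xgetPex (fun=> 0) (ex_intro _ D hD)). Qed.

Lemma Dbar0 : Dbar nu 0 = 0.
Proof.
have [lD _ _ _] := DbarP.
by have := lD (-1) 0 0; rewrite !scaleN1r oppr0 addr0 addNr.
Qed.

Lemma Dbar_t0 h : Dbar nu (val h) = 0.
Proof.
have [_ _ _ D0] := DbarP.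
have D0h := D0 (val h, 0); apply: (congr1 fst (D0h _)) => {D0h}.
apply/weight_spaceP => h'; rewrite /= br0r !scale0r oppr0; split=> //.
exact: t0_fixed.2 (t0_val h') (t0_val h).
Qed.

Lemma Dbar_weight alpha (x : k * k) : alpha != 0 -> weight_space alpha x ->
  (Dbar nu x.1, Dbar nu x.2) = (nu (sharp alpha) : R) *: imul x.
Proof.
move=> a0 wx; have [->|x0] := eqVneq x 0; last first.
  by have [_ _ DD _] := DbarP; apply: DD => //; split=> //; exists x.
by rewrite /imul /= Dbar0 oppr0 scaler0.
Qed.

Lemma Dnu_const h : Dnu nu (fun=> val h) = fun=> 0.
Proof. by apply/funext => t; rewrite /Dnu derive1_cst Dbar_t0 addr0. Qed.

Lemma loop_ip0 (xi : R -> k) : loop_ip (fun=> 0) xi = 0.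
Proof.
rewrite /loop_ip (_ : (fun t => _) = fun=> 0); first by rewrite Rintegral_cst// !mul0r mulr0.
by apply/funext => t; rewrite ip0l.
Qed.

Lemma aff_br_const (z : R) h (t : R) (x : aff_space k) :
  aff_br nu (z, (fun=> val h), t) x =
  (0, (fun s => br (val h) (x.1.2 s) + t *: Dnu nu x.1.2 s), 0).
Proof.
rewrite /aff_br /= Dnu_const loop_ip0; congr (_, _, _).
by apply/funext => s; rewrite scaler0 subr0.
Qed.

Lemma aff_br0 (x : aff_space k) : aff_br nu 0 x = 0.
Proof.
have -> : (0 : aff_space k) = (0, (fun=> val (0 : it0 t0)), 0) by [].
rewrite aff_br_const; congr (_, _, _); apply/funext => s.
by rewrite br0l scale0r addr0.
Qed.

(* xi1 + i xi2 is the loop component of a root vector for (0, alpha, r). *)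
Definition root_loop alpha (r : R) (xi1 xi2 : R -> k) : Prop :=
  [/\ loop_algebra phi N xi1, loop_algebra phi N xi2,
      forall s, weight_space alpha (xi1 s, xi2 s)
    & forall s, (Dnu nu xi1 s, Dnu nu xi2 s) = r *: imul (xi1 s, xi2 s)].

Definition loop_vec (xi1 xi2 : R -> k) : aff_space k * aff_space k :=
  ((0, xi1, 0), (0, xi2, 0)).

Lemma cbr_emb (p : ite t0) (x : aff_space k * aff_space k) :
  cbr (aff_br nu) (ite_emb p) x =
  loop_vec (fun s => - (br (val p.1.2) (x.2.1.2 s) - (p.2 : R) *: Dnu nu x.2.1.2 s))
           (fun s => br (val p.1.2) (x.1.1.2 s) - (p.2 : R) *: Dnu nu x.1.1.2 s).
Proof.
rewrite /cbr /ite_emb /= !aff_br0 !aff_br_const sub0r add0r /loop_vec.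
congr (_, _); first rewrite -[LHS]/(- 0, _, - 0) oppr0.
  congr (_, _, _); apply/funext => s.
  rewrite -[LHS]/(- (br (val p.1.2) (x.2.1.2 s) + (- p.2) *: Dnu nu x.2.1.2 s)).
  by rewrite scaleNr.
by congr (_, _, _); apply/funext => s; rewrite scaleNr.
Qed.

(** Bracketing with the Cartan subalgebra kills the central and derivation coordinates; an [h0] with
    [alpha h0 != 0] therefore forces them to vanish in a root vector. The other elements of [i t0]
    give the weight condition, and the derivation gives the eigenvalue of [Dnu]. *)
Lemma root_spaceP alpha (r : R) (x : aff_space k * aff_space k) : alpha != 0 ->
  root_space phi N nu (0, alpha, r) x <->
  exists xi1 xi2, x = loop_vec xi1 xi2 /\ root_loop alpha r xi1 xi2.
Proof.
move=> a0; have [h0 ah0] := alg_dual_neq0 a0; split.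
  case: x => -[[z1 xi1] t1] [[z2 xi2] t2] [/= L1 L2 rx].
  have e0 := rx (0, h0, 0); rewrite cbr_emb /= in e0.
  have evE : ev (0, alpha, r) (0, h0, 0) = alpha h0 by rewrite /ev /= !mulr0 add0r addr0.
  rewrite evE in e0; move: e0 => -[z1E _ t1E z2E _ t2E].
  have zero (a : R) : 0 = alpha h0 * a -> a = 0.
    by move=> /esym/eqP; rewrite mulf_eq0 (negPf ah0) => /eqP.
  rewrite (zero _ z1E) (zero _ z2E) (zero _ t1E) (zero _ t2E) in rx *.
  exists xi1, xi2; split=> //; split=> // s.
    apply/weight_spaceP => h; have := rx (0, h, 0); rewrite cbr_emb /= /ev /= !mulr0 add0r addr0.
    move=> -[_ e1 _ _ e2 _]; have := congr1 (fun f => f s) e1; have := congr1 (fun f => f s) e2.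
    rewrite /= !scale0r !subr0 => -> h1; split=> //.
    by rewrite -[LHS]opprK h1.
  have := rx (0, 0, 1); rewrite cbr_emb /= /ev /= !mul0r mulr1 alg_dual_r0 !add0r.
  move=> -[_ e1 _ _ e2 _]; have := congr1 (fun f => f s) e1; have := congr1 (fun f => f s) e2.
  rewrite /= !br0l !sub0r !opprK !scale1r => h2 h1.
  apply: injective_projections => /=; last exact: h1.
  by rewrite -[LHS]opprK h2 -[RHS]/(r *: - xi2 s) scalerN.
move=> [xi1 [xi2 [-> [L1 L2 w D]]]]; split=> // p.
rewrite cbr_emb /loop_vec /=; congr (_, _); rewrite -[RHS]/(_ * 0, _, _ * 0) mulr0;
  congr (_, _, _); apply/funext => s; have /weight_spaceP/(_ p.1.2)[/= w1 w2] := w s;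
  have [d1 d2] := D s; rewrite ?w1 ?w2 ?d1 ?d2 -[RHS]/(ev _ p *: _ s) /ev /= mul0r add0r
      scalerDl scalerA.
  by rewrite opprB opprK addrC mulrC.
by rewrite scalerN opprK mulrC.
Qed.

End RootSpaces.

(** * Maximality of [t0] *)

Section Adjoin.
Context (R : realType) (V : lmodType R) (S : submodClosed V) (v : V).

Definition adjoin : {pred V} := [pred x | `[< exists r : R, x - r *: v \in S >]].

Let adjoin_submod : submod_closed adjoin.
Proof.
split; first by apply/asboolP; exists 0; rewrite scale0r subr0 rpred0.
move=> c x y /asboolP[r xr] /asboolP[s ys]; apply/asboolP; exists (c * r + s).
rewrite (_ : _ - _ = c *: (x - r *: v) + (y - s *: v)); first by rewrite rpredD ?rpredZ.
by rewrite scalerDl opprD scalerBr scalerA addrACA.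
Qed.

HB.instance Definition _ := GRing.isSubmodClosed.Build R V adjoin adjoin_submod.

End Adjoin.

Section MaximalAbelian.
Context (R : realType) (k : hilbertLie R) (t0 : submodClosed k).
Context (phi : k -> k).
Hypothesis phi_linear : linear phi.
Hypothesis t0_max : maximal_abelian phi t0.

Lemma phiD x y : phi (x + y) = phi x + phi y.
Proof. by have := phi_linear 1 x y; rewrite !scale1r. Qed.

Lemma phi0 : phi 0 = 0.
Proof. by apply: (addrI (phi 0)); rewrite -phiD !addr0. Qed.

Lemma phiZ (a : R) x : phi (a *: x) = a *: phi x.
Proof. by have := phi_linear a x 0; rewrite !addr0 phi0 addr0. Qed.

Lemma phiN x : phi (- x) = - phi x.
Proof. by rewrite -scaleN1r phiZ scaleN1r. Qed.

(** Adjoining [v] to [t0] gives a fixed abelian subspace again. *)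
Lemma mem_maximal_abelian v : phi v = v -> (forall h, h \in t0 -> br h v = 0) ->
  v \in t0.
Proof.
move=> pv cv; have [[fx ab] mx] := t0_max.
apply: (mx (adjoin t0 v)); last by apply/asboolP; exists 1; rewrite scale1r subrr rpred0.
  have decomp x : x \in adjoin t0 v -> exists r h, h \in t0 /\ x = h + r *: v.
    by move=> /asboolP[r xr]; exists r, (x - r *: v); rewrite subrK.
  split=> [x /decomp[r [h [ht ->]]]|x y /decomp[r [h [ht ->]]] /decomp[s [g [gt ->]]]].
    by rewrite phiD phiZ pv fx.
  by rewrite !brE (ab h g)// (cv h)// br_alt (brC v g) (cv g)// oppr0 !scaler0 !addr0.
by move=> x xt; apply/asboolP; exists 0; rewrite scale0r subr0.
Qed.

End MaximalAbelian.

(** * Root vectors as exponential loops *)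

Section RootLoops.
Context (R : realType) (k : hilbertLie R) (t0 : submodClosed k).
Context (phi : k -> k) (N : nat).
Hypothesis t0_fixed : fixed_abelian phi t0.
Hypothesis phi_linear : linear phi.
Implicit Types (alpha nu : alg_dual (it0 t0)).

Lemma loop_derivable (xi : R -> k) : loop_algebra phi N xi ->
  forall t, derivable (xi : R^o -> k) t 1.
Proof. by move=> [s _] t; exact: (s 0%N t). Qed.

Lemma root_center nu alpha (c r : R) (x : aff_space k * aff_space k) :
  slant nu -> root_space phi N nu (c, alpha, r) x -> x != 0 -> c = 0.
Proof.
move=> nus [_ _ /(_ (1, 0, 0))]; rewrite (cbr_emb nus t0_fixed).
have -> : ev (c, alpha, r) (1, 0, 0) = c.
  by rewrite /ev /= mulr1 mulr0 alg_dual_r0 !addr0.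
move=> e x0; apply/eqP; have : c *: x = 0.
  rewrite -e /loop_vec /=; congr (_, _); congr (_, _, _); apply/funext => s;
  by rewrite br0l scale0r subr0 ?oppr0.
by move=> /eqP; rewrite scaler_eq0 (negPf x0) orbF.
Qed.

(** On the weight space the slant acts as [i nu(alpha^sharp)], which leaves the frequency
    [r - nu(alpha^sharp)] for the derivative. *)
Lemma root_loop_ode nu alpha r xi1 xi2 : slant nu -> alpha != 0 ->
  root_loop phi N nu alpha r xi1 xi2 ->
  let w := r - nu (sharp alpha) in forall t,
  derive1 (xi1 : R^o -> k) t = - w *: xi2 t /\ derive1 (xi2 : R^o -> k) t = w *: xi1 t.
Proof.
move=> nus a0 [L1 L2 wt D] w t; have := Dbar_weight nus a0 (wt t).
have := D t; rewrite /Dnu.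
move=> /pair_equal_spec[/= d1 d2] /pair_equal_spec[/= b1 b2].
move: d1 d2; rewrite b1 b2 => d1 d2; split.
  by rewrite -[LHS](addrK (nu (sharp alpha) *: - xi2 t)) d1 -scalerBl -/w scalerN scaleNr.
by rewrite -[LHS](addrK (nu (sharp alpha) *: xi1 t)) d2 -scalerBl.
Qed.

Lemma root_loop_rot nu alpha r xi1 xi2 : slant nu -> alpha != 0 ->
  root_loop phi N nu alpha r xi1 xi2 -> forall t,
  (xi1 t, xi2 t) = rot ((r - nu (sharp alpha)) * t) (xi1 0, xi2 0).
Proof.
move=> nus a0 rl; have [L1 L2 _ _] := rl; have ode := root_loop_ode nus a0 rl.
apply: rotation_ode; try exact: loop_derivable.
  by move=> t; have [] := ode t.
by move=> t; have [] := ode t.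
Qed.

Definition phip (x : k * k) : k * k := (phi x.1, phi x.2).

Lemma phip_rot a x : phip (rot a x) = rot a (phip x).
Proof.
by apply: injective_projections; rewrite /= !(phiD phi_linear, phiN phi_linear, phiZ phi_linear).
Qed.

(* v is a weight vector on which phi acts as exp(- 2 pi i w / N), so that
   t |-> exp(i w t) v is a twisted loop. *)
Definition twisted_weight alpha (w : R) (v : k * k) : Prop :=
  weight_space alpha v /\ phip v = rot (- (w * (2 * pi / N%:R))) v.

Definition twisted_loop (w : R) (v : k * k) : (R -> k) * (R -> k) :=
  (trig_loop w v.1 (- v.2), trig_loop w v.2 v.1).

Lemma twisted_loopE w v t : ((twisted_loop w v).1 t, (twisted_loop w v).2 t) = rot (w * t) v.
Proof. by apply: injective_projections; rewrite /= /trig_loop ?scalerN// addrC. Qed.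

Lemma twisted_root_loop nu alpha (w : R) (v : k * k) : slant nu -> alpha != 0 ->
  twisted_weight alpha w v -> root_loop phi N nu alpha (w + nu (sharp alpha))
    (twisted_loop w v).1 (twisted_loop w v).2.
Proof.
move=> nus a0 [wv pv]; have xiE := twisted_loopE w v.
set xi1 := (twisted_loop w v).1 in xiE *; set xi2 := (twisted_loop w v).2 in xiE *.
have per t : phip (xi1 (t + 2 * pi / N%:R), xi2 (t + 2 * pi / N%:R)) = (xi1 t, xi2 t).
  by rewrite !xiE phip_rot pv rotD mulrDr addrK.
split.
- by split=> [|t]; [exact: smooth_trig_loop | have [] := per t].
- by split=> [|t]; [exact: smooth_trig_loop | have [] := per t].
- by move=> s; rewrite xiE; exact: weight_space_rot.
move=> s; have wxi : weight_space alpha (xi1 s, xi2 s).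
  by rewrite xiE; exact: weight_space_rot.
have /pair_equal_spec[/= b1 b2] := Dbar_weight nus a0 wxi.
rewrite /Dnu b1 b2 !derive1_trig_loop; apply: injective_projections => /=.
  rewrite -[RHS]/(_ *: - xi2 s) scalerDl; congr (_ + _).
  by rewrite /xi2 /= /trig_loop; apply: ip_inj => u; rewrite !ipE; ring.
rewrite -[RHS]/(_ *: xi1 s) scalerDl; congr (_ + _).
by rewrite /xi1 /= /trig_loop; apply: ip_inj => u; rewrite !ipE; ring.
Qed.

Lemma twisted_weight_root nu alpha (w : R) (v : k * k) : slant nu -> alpha != 0 ->
  twisted_weight alpha w v -> v != 0 ->
  compact_root phi N nu (0, alpha, w + nu (sharp alpha)).
Proof.
move=> nus a0 tv v0; split=> //.
exists (loop_vec (twisted_loop w v).1 (twisted_loop w v).2).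
  apply/(root_spaceP N nus t0_fixed) => //.
  by exists (twisted_loop w v).1, (twisted_loop w v).2; split=> //; exact: twisted_root_loop.
apply: contra v0 => /eqP [x1 x2].
rewrite -[v]rot0 -(mulr0 w) -twisted_loopE /=.
by rewrite (congr1 (fun f => f 0) x1) (congr1 (fun f => f 0) x2).
Qed.

(** The weight vector is the value of the loop at 0; the twist condition of the loop becomes the
    eigenvalue of [phi]. *)
Lemma root_twisted_weight nu alpha (r : R) : slant nu ->
  compact_root phi N nu (0, alpha, r) ->
  alpha != 0 /\ exists2 v, twisted_weight alpha (r - nu (sharp alpha)) v & v != 0.
Proof.
move=> nus [a0 [x rx x0]]; split=> //.
have [xi1 [xi2 [xE rl]]] := (root_spaceP N nus t0_fixed r x a0).1 rx.
have xiE := root_loop_rot nus a0 rl; have [L1 L2 wt _] := rl.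
exists (xi1 0, xi2 0).
  split; first exact: wt.
  have [_ p1] := L1; have [_ p2] := L2.
  have : phip (xi1 (0 + 2 * pi / N%:R), xi2 (0 + 2 * pi / N%:R)) = (xi1 0, xi2 0).
    by rewrite /phip /= p1 p2.
  rewrite add0r xiE phip_rot => /(congr1 (rot (- ((r - nu (sharp alpha)) * (2 * pi / N%:R))))).
  by rewrite rotD addNr rot0.
apply: contra x0 => /eqP v0; rewrite xE; apply/eqP.
have xi0 t : (xi1 t, xi2 t) = 0 by rewrite xiE v0; apply/eqP; rewrite rot_eq0.
by rewrite /loop_vec; congr (_, _); congr (_, _, _); apply/funext => t; have [] := xi0 t.
Qed.

End RootLoops.

(** * The integrated scalar product of loops *)

Section LoopPairing.
Context (R : realType) (k : hilbertLie R).

Lemma ip_continuous2 (f g : R -> k) : continuous (f : R^o -> k) ->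
  continuous (g : R^o -> k) -> continuous (fun s => ip (f s) (g s) : R^o).
Proof.
move=> cf cg s.
have polar (x y : k) : ip x y = (`|x + y| ^+ 2 - `|x - y| ^+ 2) / 4.
  by rewrite -!ip_norm !ipE (ipC y x); field.
have -> : (fun s => ip (f s) (g s) : R^o) = (fun s =>
    (`|f s + g s| * `|f s + g s| - `|f s - g s| * `|f s - g s|) / 4 : R^o).
  by apply/funext => r; rewrite polar !expr2.
apply: cvgM; last exact: cvg_cst.
apply: cvgB.
  by apply: cvgM; apply: cvg_norm; apply: cvgD; [exact: cf|exact: cg|exact: cf|exact: cg].
by apply: cvgM; apply: cvg_norm; apply: cvgB; [exact: cf|exact: cg|exact: cf|exact: cg].
Qed.

(** For root loops of opposite frequency the combined integrand is constant, so no trigonometric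
    integral has to be evaluated. *)
Lemma loop_ip_comb (f1 g1 f2 g2 : R -> k) (c K : R) :
  continuous (f1 : R^o -> k) -> continuous (g1 : R^o -> k) ->
  continuous (f2 : R^o -> k) -> continuous (g2 : R^o -> k) ->
  (forall s, ip (f1 s) (g1 s) + c * ip (f2 s) (g2 s) = K) ->
  loop_ip f1 g1 + c * loop_ip f2 g2 = K.
Proof.
move=> cf1 cg1 cf2 cg2 hK; rewrite /loop_ip.
have itg (f g : R -> k) : continuous (f : R^o -> k) -> continuous (g : R^o -> k) ->
    (@lebesgue_measure R).-integrable `[0, 2 * pi] (EFin \o (fun s => ip (f s) (g s))).
  move=> cf cg; apply: continuous_compact_integrable; first exact: segment_compact.
  by apply: continuous_subspaceT; exact: ip_continuous2.
have pi2 : 0 < 2 * pi :> R by rewrite mulr_gt0// pi_gt0.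
rewrite mulrCA -mulrDr -RintegralZl//; last exact: itg.
rewrite -RintegralD//; [|exact: itg|]; last first.
  by have := integrableZl _ c (itg _ _ cf2 cg2); apply.
rewrite (_ : (fun x => _) = fun=> K); last by apply/funext => s; exact: hK.
rewrite Rintegral_cst//= lebesgue_measure_itv/= lte_fin pi2 /= subr0.
by rewrite mulrC mulfK// gt_eqF.
Qed.

End LoopPairing.

(** * Coroots of compact roots *)

Section Coroots.
Context (R : realType) (k : hilbertLie R) (t0 : submodClosed k).
Context (phi : k -> k) (N : nat) (nu : alg_dual (it0 t0)).
Hypothesis phi_aut : lie_automorphism phi.
Hypothesis t0_max : maximal_abelian phi t0.
Hypothesis nu_slant : slant nu.
Implicit Types (alpha : alg_dual (it0 t0)).

Let phi_linear : linear phi. Proof. by case: phi_aut. Qed.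
Let t0_fixed : fixed_abelian phi t0. Proof. by case: t0_max. Qed.

Definition represents (s : it0 t0) alpha : Prop :=
  forall h : it0 t0, alpha h = ip (val h) (val s).

Lemma represents_inj alpha s s' : represents s alpha -> represents s' alpha -> s = s'.
Proof.
move=> hs hs'; apply: val_inj; apply/eqP; rewrite -subr_eq0 -ip_eq0.
rewrite -[val s - val s']/(val (s - s')) {2}[val (s - s')]/= ipBr.
by rewrite -hs -hs' subrr.
Qed.

Lemma represents_sharp alpha s : represents s alpha -> sharp alpha = s.
Proof.
move=> hs; suff h : represents (sharp alpha) alpha by exact: represents_inj h hs.
exact: (xgetPex 0 (ex_intro (represents^~ alpha) s hs)).
Qed.

Lemma representsN alpha s : represents s alpha -> represents (- s) (- alpha).
Proof. by move=> hs h; rewrite -[LHS]/(- (alpha h : R)) hs -ipNr. Qed.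

(** A functional represented by no vector has [sharp] equal to the default 0, and so has its
    negative. *)
Lemma sharpN alpha : sharp (- alpha) = - sharp alpha.
Proof.
have [[s hs]|no] := pselect (exists s, represents s alpha).
  by rewrite (represents_sharp hs); apply: represents_sharp; exact: representsN.
have none (b : alg_dual (it0 t0)) : ~ (exists s, represents s b) -> sharp b = 0.
  by move=> nb; apply: xgetPN => s hs; apply: nb; exists s.
rewrite !none ?oppr0// => -[s hs]; apply: no; exists (- s).
by rewrite -[alpha]opprK; exact: representsN.
Qed.

Lemma root_spaceE alpha r x : alpha != 0 -> root_space phi N nu (0, alpha, r) x ->
  x = loop_vec x.1.1.2 x.2.1.2 /\ root_loop phi N nu alpha r x.1.1.2 x.2.1.2.
Proof.
by move=> a0 /(root_spaceP N nu_slant t0_fixed r x a0)[xi1 [xi2 [-> rl]]].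
Qed.

Lemma cbr_loop_vec (xi1 xi2 eta1 eta2 : R -> k) :
  cbr (aff_br nu) (loop_vec xi1 xi2) (loop_vec eta1 eta2) =
  ((loop_ip (Dnu nu xi1) eta1 - loop_ip (Dnu nu xi2) eta2,
    (fun s => br (xi1 s) (eta1 s) - br (xi2 s) (eta2 s)), 0),
   (loop_ip (Dnu nu xi1) eta2 + loop_ip (Dnu nu xi2) eta1,
    (fun s => br (xi1 s) (eta2 s) + br (xi2 s) (eta1 s)), 0)).
Proof.
have loops (f g : R -> k) : aff_br nu (0, f, 0) (0, g, 0) =
    (loop_ip (Dnu nu f) g, (fun s => br (f s) (g s)), 0).
  rewrite /aff_br /=; congr (_, _, _); apply/funext => s.
  by rewrite !scale0r addr0 subr0.
rewrite /cbr /= !loops; congr (_, _).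
  by rewrite -[LHS]/(_ - _, _, 0 - 0) subr0.
by rewrite -[LHS]/(_ + _, _, 0 + 0) addr0.
Qed.

Lemma root_loop_continuous alpha r xi1 xi2 : root_loop phi N nu alpha r xi1 xi2 ->
  continuous (xi1 : R^o -> k) /\ continuous (xi2 : R^o -> k).
Proof.
move=> [L1 L2 _ _]; split=> s; apply: differentiable_continuous; apply/derivable1_diffP.
  exact: (loop_derivable L1).
exact: (loop_derivable L2).
Qed.

Lemma root_loop_D alpha r xi1 xi2 : root_loop phi N nu alpha r xi1 xi2 ->
  Dnu nu xi1 = (fun s => - r *: xi2 s) /\ Dnu nu xi2 = (fun s => r *: xi1 s).
Proof.
move=> [_ _ _ D]; split; apply/funext => s; have /pair_equal_spec[/= d1 d2] := D s.
  by rewrite d1 -[LHS]/(r *: - xi2 s) scalerN scaleNr.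
by rewrite d2.
Qed.

Let pairing (x y : k * k) : R := ip x.1 y.1 - ip x.2 y.2.

(** The opposite rotations cancel in the central part, and invariance computes the part in [t0].
    Both are governed by the same number K, so their ratio is the same for all brackets of opposite
    root vectors. *)
Lemma root_pairing alpha r xi1 xi2 eta1 eta2 : alpha != 0 ->
  root_loop phi N nu alpha r xi1 xi2 ->
  root_loop phi N nu (- alpha) (- r) eta1 eta2 ->
  let K := pairing (xi1 0, xi2 0) (eta1 0, eta2 0) in
  loop_ip (Dnu nu xi1) eta2 + loop_ip (Dnu nu xi2) eta1 = r * K /\
  forall h : it0 t0, ip (val h) (br (xi1 0) (eta2 0) + br (xi2 0) (eta1 0)) =
    - ((alpha h : R) * K).
Proof.
move=> a0 rx ry K; have Na0 : - alpha != 0 by rewrite oppr_eq0.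
have [cx1 cx2] := root_loop_continuous rx; have [cy1 cy2] := root_loop_continuous ry.
have [Dx1 Dx2] := root_loop_D rx.
split.
  rewrite -[X in _ + X]mul1r; apply: loop_ip_comb => //.
  - by rewrite Dx1 => s; apply: cvgZ; [exact: cvg_cst | exact: cx2].
  - by rewrite Dx2 => s; apply: cvgZ; [exact: cvg_cst | exact: cx1].
  move=> s; rewrite Dx1 Dx2 mul1r !ipE.
  have /pair_equal_spec[/= -> ->] := root_loop_rot nu_slant a0 rx s.
  have /pair_equal_spec[/= -> ->] := root_loop_rot nu_slant Na0 ry s.
  have -> : - r - nu (sharp (- alpha)) = - (r - nu (sharp alpha)) :> R.
    by rewrite sharpN (alg_dual_rN nu) opprB opprK addrC.
  rewrite [- _ * s]mulNr cosN sinN !ipE.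
  set c := cos _; set z := sin _; have cz : c ^+ 2 + z ^+ 2 = 1 by exact: cos2Dsin2.
  transitivity (r * ((c ^+ 2 + z ^+ 2) * K)); last by rewrite cz mul1r.
  by rewrite /K /pairing /=; ring.
move=> h; have [_ _ /(_ 0) wx _] := rx; have /weight_spaceP/(_ h)[/= e1 e2] := wx.
by rewrite ipDr !ip_br e1 e2 !ipE /K /pairing /=; ring.
Qed.

Lemma loop_vec_sum (n : nat) (z : 'I_n -> aff_space k * aff_space k) :
  (forall s : R, (\sum_i z i).2.1.2 s = \sum_i (z i).2.1.2 s) /\
  (\sum_i z i).2.1.1 = \sum_i (z i).2.1.1 :> R /\ (\sum_i z i).2.2 = \sum_i (z i).2.2 :> R.
Proof.
split=> [s|].
  exact: (big_morph (fun u : aff_space k * aff_space k => u.2.1.2 s) (fun _ _ => erefl) erefl).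
split.
  exact: (big_morph (fun u : aff_space k * aff_space k => u.2.1.1 : R) (fun _ _ => erefl) erefl).
exact: (big_morph (fun u : aff_space k * aff_space k => u.2.2 : R) (fun _ _ => erefl) erefl).
Qed.

Definition coroot_pred (gamma : ite_dual t0) : set (ite t0) := [set p : ite t0 |
    (exists (n : nat) (x y : 'I_n -> aff_space k * aff_space k),
       [/\ forall i, root_space phi N nu gamma (x i),
           forall i, root_space phi N nu (- gamma) (y i)
         & ite_emb p = \sum_i cbr (aff_br nu) (x i) (y i)]) /\
    ev gamma p = 2].

(** By [root_pairing] the coroot is determined up to the sum of the K, which [alpha h = 2] fixes.
    The vector representing [alpha] is read off the bracket itself, so Riesz's theorem is not
    invoked. *)
Lemma coroot_pred_val alpha r p : alpha != 0 -> coroot_pred (0, alpha, r) p ->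
  exists s, [/\ represents s alpha, 0 < ip (val s) (val s) &
    p = (- (2 * r / ip (val s) (val s)), (2 / ip (val s) (val s)) *: s, 0)].
Proof.
case: p => -[z h] t a0 [[n [x [y [rx ry pE]]]] evp].
have Na0 : - alpha != 0 by rewrite oppr_eq0.
have ry' i : root_space phi N nu (0, - alpha, - r) (y i).
  by have := ry i; rewrite -[- (0, alpha, r)]/(- 0, - alpha, - r) oppr0.
pose K i := pairing ((x i).1.1.2 0, (x i).2.1.2 0) ((y i).1.1.2 0, (y i).2.1.2 0).
have xyE i := root_pairing a0 (root_spaceE a0 (rx i)).2 (root_spaceE Na0 (ry' i)).2.
have brE' i : cbr (aff_br nu) (x i) (y i) = cbr (aff_br nu)
    (loop_vec (x i).1.1.2 (x i).2.1.2) (loop_vec (y i).1.1.2 (y i).2.1.2).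
  by rewrite -(root_spaceE a0 (rx i)).1 -(root_spaceE Na0 (ry' i)).1.
have [sh [sz st]] := loop_vec_sum (fun i => cbr (aff_br nu) (x i) (y i)).
have {}sh : val h = \sum_i (cbr (aff_br nu) (x i) (y i)).2.1.2 0.
  by rewrite -sh -pE.
have {}sz : z = \sum_i (cbr (aff_br nu) (x i) (y i)).2.1.1 by rewrite -sz -pE.
have {}st : - t = \sum_i (cbr (aff_br nu) (x i) (y i)).2.2 by rewrite -st -pE.
have tE : t = 0.
  apply/eqP; rewrite -oppr_eq0 st big1// => i _; by rewrite brE' cbr_loop_vec.
have zE : z = r * \sum_i K i.
  by rewrite sz mulr_sumr; apply: eq_bigr => i _; rewrite brE' cbr_loop_vec /= (xyE i).1.
have hE h' : ip (val h') (val h) = - (alpha h' * \sum_i K i).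
  rewrite sh ip_sumr mulr_sumr -sumrN; apply: eq_bigr => i _.
  by rewrite brE' cbr_loop_vec /= (xyE i).2.
set S := \sum_i K i in zE hE.
have ah : alpha h = 2 by move: evp; rewrite /ev /= mul0r add0r tE mulr0 addr0.
have S0 : S != 0.
  apply/eqP => S0; have := hE h; rewrite S0 mulr0 oppr0 => /eqP.
  rewrite ip_eq0 => /eqP h0; have h00 : h = 0 by apply: val_inj.
  by move: ah; rewrite h00 alg_dual_r0 => /eqP; rewrite eq_sym pnatr_eq0.
pose s := - S^-1 *: h; have rs : represents s alpha.
  by move=> h'; rewrite -[val s]/(- S^-1 *: val h) ipZr hE; field.
have ss : ip (val s) (val s) = - (2 / S).
  rewrite -rs /s (alg_dual_rZ _ alpha) ah; field; exact: S0.
have s0 : 0 < ip (val s) (val s).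
  by rewrite lt_neqAle ip_ge0 andbT eq_sym ss oppr_eq0 mulf_neq0 ?invr_neq0// pnatr_eq0.
exists s; split=> //; rewrite ss tE zE; congr (_, _, _); first by field.
by rewrite /s scalerA (_ : _ * _ = 1) ?scale1r//; field.
Qed.

(** The loop through a twisted weight vector v is bracketed with its conjugate, whose pointwise
    bracket is the constant [- 2 i [v.1, v.2]]. *)
Lemma coroot_pred_exists alpha r : compact_root phi N nu (0, alpha, r) ->
  exists p, coroot_pred (0, alpha, r) p.
Proof.
move=> cr; have [a0 [v tv v0]] := root_twisted_weight t0_fixed phi_linear nu_slant cr.
set w := r - _ in tv; have Na0 : - alpha != 0 by rewrite oppr_eq0.
have wr : w + nu (sharp alpha) = r by rewrite /w subrK.
have tc : twisted_weight phi N (- alpha) (- w) (conjp v).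
  case: tv => wv pv; split; first exact: weight_space_conj.
  rewrite mulNr opprK -[w * _]opprK -rot_conj -pv.
  by rewrite /conjp /phip /= (phiN phi_linear).
have Nwr : - w + nu (sharp (- alpha)) = - r.
  by rewrite sharpN (alg_dual_rN nu) -opprD wr.
have := twisted_root_loop phi_linear nu_slant a0 tv.
have := twisted_root_loop phi_linear nu_slant Na0 tc.
rewrite wr Nwr; have xiE := twisted_loopE w v; have etaE := twisted_loopE (- w) (conjp v).
set xi1 := (twisted_loop w v).1 in xiE *; set xi2 := (twisted_loop w v).2 in xiE *.
set eta1 := (twisted_loop (- w) _).1 in etaE *; set eta2 := (twisted_loop (- w) _).2 in etaE *.
move=> ry rx; have [zK hK] := root_pairing a0 rx ry.
have conj_xi s : (eta1 s, eta2 s) = conjp (xi1 s, xi2 s).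
  by rewrite etaE xiE rot_conj mulNr.
have brs s : cbr (@br R k) (xi1 s, xi2 s) (eta1 s, eta2 s) = cbr (@br R k) v (conjp v).
  by rewrite xiE etaE cbr_rot -mulrDl addrN mul0r rot0.
have brv : cbr (@br R k) v (conjp v) = (0, (-2) *: br v.1 v.2).
  apply: injective_projections; rewrite /= !brNr; first by rewrite !br_alt oppr0 subr0.
  by apply: ip_inj => u; rewrite (brC v.2) !ipE; ring.
have xi0 : (xi1 0, xi2 0) = v by rewrite xiE mulr0 rot0.
pose b := br v.1 v.2.
have [L1 L2 wt _] := rx; have [_ _ phibr] := phi_aut.
have brxi s : br (xi1 s) (xi2 s) = b.
  have : cbr (@br R k) (xi1 s, xi2 s) (conjp (xi1 s, xi2 s)) = cbr (@br R k) v (conjp v).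
    by rewrite -conj_xi brs.
  rewrite brv => /(congr1 snd) /=; rewrite brNr (brC (xi2 s)) => h.
  apply: ip_inj => u; have := congr1 (fun x => ip x u) h; rewrite !ipE /b; lra.
(* Constancy along the twisted loop makes [b] fixed by [phi], and the weights of v and its conjugate
   cancel, so [b] commutes with [t0]. *)
have bt : b \in t0.
  apply: (mem_maximal_abelian phi_linear t0_max).
    rewrite -{1}(brxi (0 + 2 * pi / N%:R)) phibr.
    have [_ ->] := L1; have [_ ->] := L2; exact: brxi.
  move=> h ht; have [/weight_spaceP/(_ (Subspace ht))[/= e1 e2] _] := tv.
  by rewrite /b br_leibniz e1 e2 !brE !br_alt !scaler0 oppr0 addr0.
pose h0 : it0 t0 := Subspace bt.
have KE : pairing (xi1 0, xi2 0) (eta1 0, eta2 0) = ip v.1 v.1 + ip v.2 v.2.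
  by rewrite conj_xi xi0 /pairing /= ipNr opprK.
have hb h : 2 * ip (val h) b = alpha h * (ip v.1 v.1 + ip v.2 v.2).
  have := hK h; rewrite KE => /(congr1 (fun x => - x)); rewrite opprK => <-.
  have -> : br (xi1 0) (eta2 0) + br (xi2 0) (eta1 0) = (-2) *: b.
    by have := congr1 snd (brs 0); rewrite brv.
  by rewrite ipZr; ring.
have K0 : 0 < ip v.1 v.1 + ip v.2 v.2.
  rewrite lt_neqAle addr_ge0 ?ip_ge0// andbT eq_sym paddr_eq0 ?ip_ge0// !ip_eq0.
  by apply: contra v0 => /andP[/eqP e1 /eqP e2]; apply/eqP; apply: injective_projections.
have ah0 : alpha h0 != 0.
  apply/eqP => ah0; have := hb h0; rewrite ah0 mul0r => /eqP.
  rewrite mulf_eq0 pnatr_eq0/= ip_eq0 => /eqP b0.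
  have [h] := alg_dual_neq0 a0; have := hb h; rewrite b0 ip0r mulr0 => /esym/eqP.
  by rewrite mulf_eq0 (gt_eqF K0) orbF => /eqP ->; rewrite eqxx.
(* This factor turns [- 2 b] into the multiple of [b] on which [alpha] takes the value 2. *)
pose c := - (alpha h0)^-1.
have tvc : twisted_weight phi N alpha w (c *: v).
  case: tv => wv pv; split; first exact: weight_spaceZ.
  by rewrite rotZ -pv; apply: injective_projections; rewrite /= (phiZ phi_linear).
have := twisted_root_loop phi_linear nu_slant a0 tvc; rewrite wr.
have xcE s : ((twisted_loop w (c *: v)).1 s, (twisted_loop w (c *: v)).2 s) =
    c *: (xi1 s, xi2 s) by rewrite twisted_loopE rotZ xiE.
set xc1 := (twisted_loop w (c *: v)).1 in xcE *.
set xc2 := (twisted_loop w (c *: v)).2 in xcE *; move=> rxc.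
have [zKc _] := root_pairing a0 rxc ry.
have Lz : loop_ip (Dnu nu xc1) eta1 - loop_ip (Dnu nu xc2) eta2 = 0.
  have [cx1 cx2] := root_loop_continuous rxc; have [cy1 cy2] := root_loop_continuous ry.
  have [-> ->] := root_loop_D rxc.
  rewrite -[X in _ + X]mulN1r; apply: loop_ip_comb => //.
  - by move=> s; apply: cvgZ; [exact: cvg_cst | exact: cx2].
  - by move=> s; apply: cvgZ; [exact: cvg_cst | exact: cx1].
  move=> s; have /pair_equal_spec[/= -> ->] := conj_xi s.
  rewrite (congr1 fst (xcE s) : xc1 s = c *: xi1 s).
  rewrite (congr1 snd (xcE s) : xc2 s = c *: xi2 s).
  by rewrite !ipZl ipNr (ipC (xi2 s)); ring.
exists (r * pairing (xc1 0, xc2 0) (eta1 0, eta2 0), (2 / alpha h0) *: h0, 0); split; last first.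
  by rewrite /ev /= mul0r add0r mulr0 addr0 (alg_dual_rZ _ alpha) divfK.
exists 1%N, (fun=> loop_vec xc1 xc2), (fun=> loop_vec eta1 eta2); split.
- by move=> _; apply/(root_spaceP N nu_slant t0_fixed) => //; exists xc1, xc2.
- move=> _; rewrite -[- (0, alpha, r)]/(- 0, - alpha, - r) oppr0.
  by apply/(root_spaceP N nu_slant t0_fixed) => //; exists eta1, eta2.
have brc s : cbr (@br R k) (xc1 s, xc2 s) (eta1 s, eta2 s) = (0, (2 / alpha h0) *: b).
  have -> : (xc1 s, xc2 s) = c *: (xi1 s, xi2 s) by exact: xcE.
  have -> : cbr (@br R k) (c *: (xi1 s, xi2 s)) (eta1 s, eta2 s) =
            c *: cbr (@br R k) (xi1 s, xi2 s) (eta1 s, eta2 s).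
    by apply: injective_projections; rewrite /= !brZl ?scalerBr ?scalerDr.
  rewrite brs brv; apply: injective_projections; rewrite /= ?scaler0// scalerA /c /b.
  by congr (_ *: _); ring.
rewrite big_ord1 cbr_loop_vec Lz zKc /ite_emb /= oppr0.
congr (_, _); congr (_, _, _); apply/funext => s.
  by have /pair_equal_spec[/= -> _] := brc s.
by have /pair_equal_spec[/= _ ->] := brc s.
Qed.

Lemma coroot_val alpha r : compact_root phi N nu (0, alpha, r) ->
  exists s, [/\ represents s alpha, 0 < ip (val s) (val s) &
    coroot phi N nu (0, alpha, r) =
      (- (2 * r / ip (val s) (val s)), (2 / ip (val s) (val s)) *: s, 0)].
Proof.
move=> cr; have [a0 _] := cr; apply: coroot_pred_val => //.
have [p hp] := coroot_pred_exists cr.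
exact: (xgetPex 0 (ex_intro (coroot_pred (0, alpha, r)) p hp)).
Qed.

End Coroots.

(** * Multiplicity one *)

Section CosineOne.
Context (R : realType).

Lemma cosD_int (x : R) (n : int) : cos (x + n%:~R * (2 * pi)) = cos x.
Proof.
have nat_case (m : nat) y : cos (y + m%:R * (2 * pi)) = cos y :> R.
  by rewrite !mulr_natl; apply: (periodicn (@cosD2pi R)).
case: n => n; first exact: nat_case.
by rewrite NegzE mulrNz mulNr -(nat_case n.+1) subrK.
Qed.

Lemma sinD_int (x : R) (n : int) : sin (x + n%:~R * (2 * pi)) = sin x.
Proof.
have nat_case (m : nat) y : sin (y + m%:R * (2 * pi)) = sin y :> R.
  by rewrite !mulr_natl; apply: (periodicn (@sinD2pi R)).
case: n => n; first exact: nat_case.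
by rewrite NegzE mulrNz mulNr -(nat_case n.+1) subrK.
Qed.

Lemma cos_eq1_int (w : R) : cos (w * (2 * pi)) = 1 -> w \is a Num.int.
Proof.
set f := w - (Num.floor w)%:~R; move=> cw.
have f0 : 0 <= f by rewrite subr_ge0 real_floor_le// num_real.
have f1 : f < 1.
  by have := real_floorD1_gt (num_real w); rewrite intrD /f -[1%:~R]/1; lra.
have cf : cos (f * (2 * pi)) = 1.
  by rewrite -(cosD_int _ (Num.floor w)) -mulrDl subrK.
have [f00|fN0] := eqVneq f 0.
  by rewrite -(subrK (Num.floor w)%:~R w) -/f f00 add0r intr_int.
have pi0 := pi_gt0 R.
have s0 : 0 < sin (f * pi).
  have fp : 0 < f by rewrite lt_neqAle f0 eq_sym fN0.
  by apply: sin_gt0_pi; rewrite mulr_gt0//= gtr_pMl.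
have c2s2 := cos2Dsin2 (f * pi).
move: cf; rewrite (_ : f * (2 * pi) = (f * pi) *+ 2); last by ring.
by rewrite cos_mulr2n => cf; exfalso; nra.
Qed.

Context (k : hilbertLie R).

Lemma rot_int (a : R) (n : int) (x : k * k) : rot (a + n%:~R * (2 * pi)) x = rot a x.
Proof. by rewrite /rot cosD_int sinD_int. Qed.

Lemma rot_fixed (w : R) (x : k * k) : x != 0 -> rot (w * (2 * pi)) x = x ->
  w \is a Num.int.
Proof.
move=> x0 rx; apply: cos_eq1_int.
set c := cos _; set s := sin (w * (2 * pi)).
have cs : c ^+ 2 + s ^+ 2 = 1 by exact: cos2Dsin2.
have e1 : c *: x.1 - s *: x.2 = x.1 by have := congr1 fst rx.
have e2 : s *: x.1 + c *: x.2 = x.2 by have := congr1 snd rx.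
(* The factor is [|exp(2 pi i w) - 1|^2], the determinant of the system. *)
have h (y z : k) : c *: y - s *: z = y -> s *: y + c *: z = z ->
    ((c - 1) ^+ 2 + s ^+ 2) *: y = 0 /\ ((c - 1) ^+ 2 + s ^+ 2) *: z = 0.
  move=> h1 h2; split; apply: ip_inj => u;
    have := congr1 (fun v => ip v u) h1; have := congr1 (fun v => ip v u) h2;
    rewrite !ipE => g2 g1.
    transitivity ((c - 1) * (c * ip y u - s * ip z u - ip y u) + s * (s * ip y u + c * ip z u -
        ip z u)); first by ring.
    by rewrite g1 g2 !subrr !mulr0 addr0.
  transitivity ((c - 1) * (s * ip y u + c * ip z u - ip z u) - s * (c * ip y u - s * ip z u - ip
      y u)); first by ring.
  by rewrite g1 g2 !subrr !mulr0 subr0.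
have [/eqP y0 /eqP z0] := h _ _ e1 e2.
have [D0|D0] := eqVneq ((c - 1) ^+ 2 + s ^+ 2) 0; first by nra.
case/eqP: x0; move: y0 z0; rewrite !scaler_eq0 (negPf D0) /= => /eqP y0 /eqP z0.
exact: injective_projections.
Qed.

End CosineOne.

(** * Eigenspaces of the automorphism inside a weight space *)

Section EigenDecomposition.
Context (R : realType) (k : hilbertLie R) (t0 : submodClosed k).
Context (phi : k -> k) (N : nat).
Hypothesis phi_aut : lie_automorphism phi.
Hypothesis phi_order : has_order phi N.
Hypothesis t0_max : maximal_abelian phi t0.
Implicit Types (alpha : alg_dual (it0 t0)) (x v : k * k).

Let phi_linear : linear phi. Proof. by case: phi_aut. Qed.
Let t0_fixed : fixed_abelian phi t0. Proof. by case: t0_max. Qed.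
Let N_gt0 : (0 < N)%N. Proof. by case: phi_order. Qed.

Local Notation eta := (2 * pi / N%:R : R).

Let N_neq0 : N%:R != 0 :> R. Proof. by rewrite pnatr_eq0 -lt0n. Qed.

Lemma phip_iterN x : iter N (phip phi) x = x.
Proof.
have [_ pN _] := phi_order.
have it n : iter n (phip phi) x = (iter n phi x.1, iter n phi x.2).
  by elim: n => [|n IH]; [case: x|rewrite !iterS IH].
by rewrite it !pN; case: x {it}.
Qed.

(** As [phi^N = id], the eigenvalue [exp(- 2 pi i w / N)] is an N-th root of unity. *)
Lemma twisted_weight_int alpha w v : twisted_weight phi N alpha w v -> v != 0 ->
  w \is a Num.int.
Proof.
move=> [_ pv] v0.
have it n : iter n (phip phi) v = rot (- (w * (n%:R * eta))) v.
  elim: n => [|n IH]; first by rewrite mul0r mulr0 oppr0 rot0.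
  rewrite iterS IH (phip_rot phi_linear) pv rotD; congr rot.
  by rewrite -natr1; ring.
have := phip_iterN v; rewrite it.
rewrite (_ : - _ = (- w) * (2 * pi)); last by field.
by move=> /(rot_fixed v0); rewrite rpredN.
Qed.

Lemma twisted_weight_shift alpha w (j : int) v : twisted_weight phi N alpha w v ->
  twisted_weight phi N alpha (w + N%:R * j%:~R) v.
Proof.
move=> [wv pv]; split=> //; rewrite pv -(rot_int _ (- j)); congr rot.
by rewrite intrN; field.
Qed.

Lemma phip_weight alpha x : weight_space alpha x -> weight_space alpha (phip phi x).
Proof.
have [_ _ pbr] := phi_aut; move=> /weight_spaceP wx; apply/weight_spaceP => h.
have [e1 e2] := wx h; have ph : phi (val h) = val h by exact: t0_fixed.1 (t0_val h).
by rewrite -ph -!pbr e1 e2 (phiN phi_linear) !(phiZ phi_linear).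
Qed.

Lemma phip_sum (I : Type) (s : seq I) (f : I -> k * k) :
  phip phi (\sum_(i <- s) f i) = \sum_(i <- s) phip phi (f i).
Proof.
have D x y : phip phi (x + y) = phip phi x + phip phi y.
  by apply: injective_projections; rewrite /= (phiD phi_linear).
elim: s => [|i s IH]; last by rewrite !big_cons D IH.
by rewrite !big_nil; apply: injective_projections; rewrite /= (phi0 phi_linear).
Qed.

Lemma rot_sum a (I : Type) (s : seq I) (f : I -> k * k) :
  rot a (\sum_(i <- s) f i) = \sum_(i <- s) rot a (f i).
Proof.
elim: s => [|i s IH]; last by rewrite !big_cons rot_add IH.
by rewrite !big_nil; apply/eqP; rewrite rot_eq0.
Qed.

(* N times the projection onto the exp(- 2 pi i m / N)-eigenspace of phi. *)
Definition eigenpart (m : nat) x : k * k :=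
  \sum_(j < N) rot (m%:R * j%:R * eta) (iter j (phip phi) x).

Lemma sum_ord_cyclic (f : nat -> k * k) : f N = f 0%N ->
  \sum_(j < N) f j.+1 = \sum_(j < N) f j.
Proof.
move=> fN; have := big_ord_recl N (fun j : 'I_N.+1 => f j) (op := +%R) (idx := 0 : k * k).
by rewrite big_ord_recr /= fN addrC => /addrI ->.
Qed.

Lemma eigenpart_twisted alpha m x : weight_space alpha x ->
  twisted_weight phi N alpha m%:R (eigenpart m x).
Proof.
move=> wx; split.
  apply: weight_space_sum => j; apply: weight_space_rot.
  by elim: (j : nat) => //= n IH; exact: phip_weight.
rewrite phip_sum /eigenpart.
under eq_bigr do rewrite (phip_rot phi_linear) -iterS.
pose f (j : nat) := rot (m%:R * j%:R * eta) (iter j (phip phi) x).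
rewrite -(sum_ord_cyclic (f := f)); last first.
  rewrite /f phip_iterN !mulr0 !mul0r (_ : _ * _ * _ = 0 + m%:Z%:~R * (2 * pi)); last by field.
  exact: rot_int.
rewrite rot_sum; apply: eq_bigr => j _; rewrite /f rotD; congr rot.
by rewrite -natr1; ring.
Qed.

(** Only [j = 0] survives the exchange of sums: for other j the sum over m is fixed by the rotation
    through [2 pi j / N], which is no full turn. *)
Lemma eigenpart_sum x : \sum_(m < N) eigenpart m x = N%:R *: x.
Proof.
rewrite exchange_big /= (bigD1 (Ordinal N_gt0))//= [X in _ + X]big1 ?addr0.
  under eq_bigr do rewrite mulr0 mul0r rot0.
  by rewrite sumr_const card_ord scaler_nat.
move=> j j0; set y := iter j _ x; pose f m := rot (m%:R * j%:R * eta) y.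
have jp : (0 < j)%N.
  by rewrite lt0n; apply: contra j0 => /eqP jE; apply/eqP/val_inj.
have j1 : 0 < (j : nat)%:R / N%:R :> R by rewrite divr_gt0 ?ltr0n.
have j2 : (j : nat)%:R / N%:R < 1 :> R.
  by rewrite ltr_pdivrMr ?ltr0n// mul1r ltr_nat ltn_ord.
have fix_rot : rot (j%:R / N%:R * (2 * pi)) (\sum_(m < N) f m) = \sum_(m < N) f m.
  rewrite rot_sum -(sum_ord_cyclic (f := f)); last first.
    rewrite /f mul0r mul0r (_ : _ * _ * _ = 0 + j%:Z%:~R * (2 * pi)); last by field.
    exact: rot_int.
  apply: eq_bigr => m _; rewrite /f rotD; congr rot.
  by rewrite -natr1; field.
apply/eqP; apply: contraT => /rot_fixed/(_ fix_rot).
by move=> /int_gt0_ge1/(_ j1); lra.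
Qed.

Lemma twisted_weight_exists alpha x : weight_space alpha x -> x != 0 ->
  exists m v, twisted_weight phi N alpha m v /\ v != 0.
Proof.
move=> wx x0; apply: contrapT => no.
case/eqP: x0; have := eigenpart_sum x; rewrite big1 => [/esym/eqP|m _].
  by rewrite scaler_eq0 (negPf N_neq0) => /eqP.
apply: contrapT => /eqP e0; apply: no; exists m%:R, (eigenpart m x).
by split=> //; exact: eigenpart_twisted.
Qed.

(* If u is orthogonal to v, then [u, conj v] vanishes, so u is a lowest weight
   vector of positive weight for the compact sl2-triple of v, which unitarity
   forbids. *)
Lemma twisted_orthogonal0 alpha w u v : alpha != 0 ->
  twisted_weight phi N alpha w u -> twisted_weight phi N alpha w v -> v != 0 ->
  ip u.1 v.1 + ip u.2 v.2 = 0 -> ip u.2 v.1 - ip u.1 v.2 = 0 -> u = 0.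
Proof.
move=> a0 [wu pu] [wv pv] v0 o1 o2.
have [_ _ pbr] := phi_aut.
have /weight_spaceP wu' := wu; have /weight_spaceP wv' := wv.
have phip_cbr x y : phip phi (cbr (@br R k) x y) = cbr (@br R k) (phip phi x) (phip phi y).
  by apply: injective_projections; rewrite /= !(phiD phi_linear, phiN phi_linear) !pbr.
have mem_t0 x : phip phi x = x -> (forall h : it0 t0, br (val h) x.1 = 0 /\ br (val h) x.2 = 0) ->
    x.1 \in t0 /\ x.2 \in t0.
  move=> px cx; split; apply: (mem_maximal_abelian phi_linear t0_max).
  - by have := congr1 fst px.
  - by move=> h ht; have [] := cx (Subspace ht).
  - by have := congr1 snd px.
  - by move=> h ht; have [] := cx (Subspace ht).
have conj_fix y : twisted_weight phi N alpha w y ->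
    phip phi (cbr (@br R k) y (conjp v)) = cbr (@br R k) y (conjp v).
  move=> [_ py]; have pc : phip phi (conjp v) = rot (w * eta) (conjp v).
    by rewrite -[w * eta]opprK -rot_conj -pv; apply: injective_projections; rewrite /= ?(phiN
        phi_linear).
  by rewrite phip_cbr py pc cbr_rot addNr rot0.
pose W := cbr (@br R k) u (conjp v).
have [W1t W2t] : W.1 \in t0 /\ W.2 \in t0.
  apply: mem_t0; first by apply: conj_fix; split.
  move=> h; have [e1 e2] := wu' h; have [e3 e4] := wv' h.
  split; apply: ip_inj => z; rewrite /W /= !brE !(br_leibniz (val h)) e1 e2 e3 e4 !brE !ipE; ring.
have zero_t0 z : z \in t0 -> (forall h : it0 t0, ip (val h) z = 0) -> z = 0.
  by move=> zt hz; apply/eqP; rewrite -ip_eq0; apply/eqP; exact: (hz (Subspace zt)).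
have W10 : W.1 = 0.
  apply: zero_t0 => // h; have [e1 e2] := wu' h.
  rewrite /W /= !brE !ipE !ip_br e1 e2 !ipE.
  transitivity ((alpha h : R) * (ip u.2 v.1 - ip u.1 v.2)); first by ring.
  by rewrite o2 mulr0.
have W20 : W.2 = 0.
  apply: zero_t0 => // h; have [e1 e2] := wu' h.
  rewrite /W /= !brE !ipE !ip_br e1 e2 !ipE.
  transitivity (- (alpha h : R) * (ip u.1 v.1 + ip u.2 v.2)); first by ring.
  by rewrite o1 mulr0.
pose g := br v.1 v.2.
have gt : g \in t0.
  have [_] : (cbr (@br R k) v (conjp v)).1 \in t0 /\ (cbr (@br R k) v (conjp v)).2 \in t0.
    apply: mem_t0; first by apply: conj_fix; split.
    move=> h; have [e3 e4] := wv' h.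
    split; apply: ip_inj => z; rewrite /= !brE !(br_leibniz (val h)) e3 e4 !brE !ipE; ring.
  have -> : (cbr (@br R k) v (conjp v)).2 = (-2) *: g.
    by apply: ip_inj => z; rewrite /= brNr (brC v.2) !ipE /g; ring.
  move=> /(rpredZ (- 2^-1)); rewrite scalerA (_ : _ * _ = 1) ?scale1r//.
  by field.
have hg (h : it0 t0) : 2 * ip (val h) g = (alpha h : R) * (ip v.1 v.1 + ip v.2 v.2).
  have [e3 e4] := wv' h.
  have g1 : ip (val h) g = (alpha h : R) * ip v.2 v.2 by rewrite /g ip_br e3 ipZl.
  have g2 : ip (val h) g = (alpha h : R) * ip v.1 v.1.
    by rewrite /g brC ipNr ip_br e4 ipNl ipZl opprK.
  by rewrite mulrDr -g1 -g2; ring.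
have v1 : 0 < ip v.1 v.1 + ip v.2 v.2.
  rewrite lt_neqAle addr_ge0 ?ip_ge0// andbT eq_sym paddr_eq0 ?ip_ge0// !ip_eq0.
  by apply: contra v0 => /andP[/eqP e1 /eqP e2]; apply/eqP; apply: injective_projections.
have g0 : 0 < ip g g.
  rewrite lt_neqAle ip_ge0 andbT eq_sym ip_eq0; apply/negP => /eqP g0.
  have [h] := alg_dual_neq0 a0; have := hg h; rewrite g0 ip0r mulr0 => /esym/eqP.
  by rewrite mulf_eq0 (gt_eqF v1) orbF => /eqP ->; rewrite eqxx.
pose h0 : it0 t0 := Subspace gt.
have ag : 0 < alpha h0.
  have : 0 < (alpha h0 : R) * (ip v.1 v.1 + ip v.2 v.2) by rewrite -hg mulr_gt0.
  by rewrite pmulr_lgt0.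
have [gu1 gu2] := wu' h0; rewrite /= in gu1 gu2.
pose X := cbr (@br R k) v u.
have W1E : br u.1 v.1 + br u.2 v.2 = 0 by have := W10; rewrite /W /= brNr opprK.
have W2E : br u.2 v.1 - br u.1 v.2 = 0 by have := W20; rewrite /W /= brNr addrC.
(* The adjoint of [ad v] is [- ad (conjp v)], and since [[u, conj v] = 0] the Jacobi identity gives
   [[conj v, [v, u]] = [[conj v, v], u] = 2 alpha(h0) u]. *)
have XX : ip X.1 X.1 + ip X.2 X.2 = - (2 * alpha h0 * (ip u.1 u.1 + ip u.2 u.2)).
  have mv (a b c : k) : ip (br a b) c = - ip b (br a c) by rewrite brC ipNl ip_invariant.
  have a1 : br v.1 u.1 = - br v.2 u.2.
    by apply/eqP; rewrite -addr_eq0 (brC v.1) (brC v.2) -opprD W1E oppr0.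
  have a2 : br v.1 u.2 = br v.2 u.1.
    by apply/eqP; rewrite (brC v.1) (brC v.2) eqr_opp -subr_eq0 W2E.
  have X1 : X.1 = (-2) *: br v.2 u.2 by apply: ip_inj => z; rewrite /X /= a1 !ipE; ring.
  have X1' : X.1 = 2 *: br v.1 u.1 by rewrite X1 a1 scalerN scaleNr.
  have X2 : X.2 = 2 *: br v.1 u.2 by apply: ip_inj => z; rewrite /X /= -a2 !ipE; ring.
  have X2' : X.2 = 2 *: br v.2 u.1 by rewrite X2 a2.
  have Y1 : br v.1 X.1 + br v.2 X.2 = (2 * alpha h0) *: u.1.
    rewrite X1 X2 !brZr (br_leibniz v.1) gu2.
    by apply: ip_inj => z; rewrite !ipE; ring.
  have Y2 : br v.1 X.2 - br v.2 X.1 = (2 * alpha h0) *: u.2.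
    rewrite X1' X2' !brZr (br_leibniz v.1) gu1.
    by apply: ip_inj => z; rewrite !ipE; ring.
  have -> : ip X.1 X.1 + ip X.2 X.2 = - ip u.1 (br v.1 X.1 + br v.2 X.2) - ip u.2 (br v.1 X.2 -
      br v.2 X.1).
    rewrite {1 3}/X /= !(ipBl, ipDl) !mv !ipE; ring.
  by rewrite Y1 Y2 !ipZr; ring.
have : ip u.1 u.1 + ip u.2 u.2 <= 0.
  have := ip_ge0 X.1; have := ip_ge0 X.2; have := ip_ge0 u.1; have := ip_ge0 u.2; nra.
move=> u0; have := ip_ge0 u.1; have := ip_ge0 u.2 => p2 p1.
apply: injective_projections; apply/eqP; rewrite -ip_eq0; apply/eqP => /=; lra.
Qed.

End EigenDecomposition.

Section Multiplicity.
Context (R : realType) (k : hilbertLie R) (t0 : submodClosed k).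
Context (phi : k -> k) (N : nat).
Hypothesis phi_aut : lie_automorphism phi.
Hypothesis phi_order : has_order phi N.
Hypothesis t0_max : maximal_abelian phi t0.
Implicit Types (alpha : alg_dual (it0 t0)).

Let phi_linear : linear phi. Proof. by case: phi_aut. Qed.
Let N_gt0 : (0 < N)%N. Proof. by case: phi_order. Qed.

(** Subtract from u its Hermitian projection [(c + i d) v]; the remainder is orthogonal to v, hence
    0. *)
Lemma twisted_weight_line alpha w (u v : k * k) : alpha != 0 ->
  twisted_weight phi N alpha w u -> twisted_weight phi N alpha w v -> v != 0 ->
  exists c d : R, u = (c *: v.1 - d *: v.2, d *: v.1 + c *: v.2).
Proof.
move=> a0 tu tv v0.
have K0 : ip v.1 v.1 + ip v.2 v.2 != 0.
  rewrite paddr_eq0 ?ip_ge0// !ip_eq0; apply: contra v0 => /andP[/eqP e1 /eqP e2].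
  by apply/eqP; apply: injective_projections.
set K := ip v.1 v.1 + ip v.2 v.2 in K0.
pose c := (ip u.1 v.1 + ip u.2 v.2) / K; pose d := (ip u.2 v.1 - ip u.1 v.2) / K.
exists c, d; pose z : k * k := (c *: v.1 - d *: v.2, d *: v.1 + c *: v.2).
have tz : twisted_weight phi N alpha w (u - z).
  have [wu pu] := tu; have [wv pv] := tv; split.
    apply: weight_spaceD => //; rewrite -scaleN1r; apply: weight_spaceZ.
    exact: weight_space_scale.
  have p1 : phi v.1 = cos (- (w * (2 * pi / N%:R))) *: v.1 - sin (- (w * (2 * pi / N%:R))) *: v.2.
    by have := congr1 fst pv.
  have p2 : phi v.2 = sin (- (w * (2 * pi / N%:R))) *: v.1 + cos (- (w * (2 * pi / N%:R))) *: v.2.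
    by have := congr1 snd pv.
  have q1 : phi u.1 = cos (- (w * (2 * pi / N%:R))) *: u.1 - sin (- (w * (2 * pi / N%:R))) *: u.2.
    by have := congr1 fst pu.
  have q2 : phi u.2 = sin (- (w * (2 * pi / N%:R))) *: u.1 + cos (- (w * (2 * pi / N%:R))) *: u.2.
    by have := congr1 snd pu.
  by apply: injective_projections; rewrite /= !(phiD phi_linear, phiN phi_linear, phiZ
      phi_linear) p1 p2 ?q1 ?q2;
    apply: ip_inj => t; rewrite !ipE; ring.
have o1 : ip (u - z).1 v.1 + ip (u - z).2 v.2 = 0.
  transitivity (ip u.1 v.1 + ip u.2 v.2 - c * K); last by rewrite /c divfK// subrr.
  by rewrite /= !ipE (ipC v.2 v.1) /K; ring.
have o2 : ip (u - z).2 v.1 - ip (u - z).1 v.2 = 0.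
  transitivity (ip u.2 v.1 - ip u.1 v.2 - d * K); last by rewrite /d divfK// subrr.
  by rewrite /= !ipE (ipC v.2 v.1) /K; ring.
apply/eqP; rewrite -subr_eq0; apply/eqP.
exact: (twisted_orthogonal0 phi_aut t0_max a0 tz tv v0 o1 o2).
Qed.

(** If all twisted weights over [alpha] are congruent modulo [N], a single eigenpart survives and
    the whole weight space is one eigenspace of [phi]. *)
Lemma weight_space_line alpha : alpha != 0 ->
  (forall w w' v v', twisted_weight phi N alpha w v -> v != 0 ->
     twisted_weight phi N alpha w' v' -> v' != 0 ->
     (w - w') / N%:R \is a Num.int) ->
  forall u v, weight_space alpha u -> weight_space alpha v -> v != 0 ->
  exists c d : R, u = (c *: v.1 - d *: v.2, d *: v.1 + c *: v.2).
Proof.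
move=> a0 one u v wu wv v0.
have N0 : N%:R != 0 :> R by rewrite pnatr_eq0 -lt0n.
have [m em] : exists m : 'I_N, eigenpart phi N m v != 0.
  apply: contrapT => no; case/eqP: v0.
  have := eigenpart_sum phi_order v; rewrite big1 => [/esym/eqP|m _].
    by rewrite scaler_eq0 (negPf N0) => /eqP.
  by apply: contrapT => /eqP e0; apply: no; exists m.
have tw (x : k * k) : weight_space alpha x -> twisted_weight phi N alpha m%:R x.
  move=> wx; have := eigenpart_sum phi_order x.
  rewrite (bigD1 m)//= [X in _ + X]big1 ?addr0 => [e|j jm].
    have -> : x = N%:R^-1 *: eigenpart phi N m x by rewrite e scalerA mulVf// scale1r.
    have [we pe] := eigenpart_twisted phi_aut phi_order t0_max m wx.
    split; first exact: weight_spaceZ.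
    by rewrite rotZ -pe; apply: injective_projections; rewrite /= (phiZ phi_linear).
  apply/eqP; apply: contraT => ej.
  have tj := eigenpart_twisted phi_aut phi_order t0_max j wx.
  have tm := eigenpart_twisted phi_aut phi_order t0_max m wv.
  have /intrP[n nE] := one _ _ _ _ tj ej tm em.
  have jmE : (j : nat)%:R - (m : nat)%:R = n%:~R * N%:R :> R.
    by rewrite -nE divfK.
  have : (j : int) - (m : int) = n * N.
    by apply/eqP; rewrite -(eqr_int R) intrD intrN intrM jmE.
  move=> jmn; have := ltn_ord j; have := ltn_ord m.
  case/negP: jm; apply/eqP/val_inj => /=.
  have nN : n = 0 by have := ltn_ord j; have := ltn_ord m; nia.
  move: jmn; rewrite nN mul0r => /eqP; rewrite subr_eq0 => /eqP[]; exact.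
exact: (twisted_weight_line a0 (tw _ wu) (tw _ wv) v0).
Qed.

End Multiplicity.

(** * Comparison of the root sets *)

Section RootTransport.
Context (R : realType) (k : hilbertLie R) (t0 : submodClosed k).
Implicit Types (alpha nu : alg_dual (it0 t0)).

Lemma slant0 : slant (0 : alg_dual (it0 t0)).
Proof.
exists (fun=> 0); split.
- by move=> a x y; rewrite scaler0 addr0.
- by move=> x; exact: cvg_cst.
- by move=> alpha x _ _; rewrite -[LHS]/(0 : k * k) -[X in X *: _]/(0 : R) scale0r.
- by [].
Qed.

Lemma iso_root (phi psi : k -> k) (Nphi Npsi : nat) nu nu' (Q : R) alpha (r : R) :
  fixed_abelian phi t0 -> fixed_abelian psi t0 -> slant nu -> slant nu' -> Q != 0 ->
  aff_iso phi Nphi nu psi Npsi nu' Q ->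
  compact_root phi Nphi nu (0, alpha, r) -> compact_root psi Npsi nu' (0, alpha, Q * r).
Proof.
move=> fphi fpsi nus nus' Q0 [F [Fbij Flin Fbr Fcar]] [a0 [x [L1 L2 rx] x0]].
have [Ffun Finj _] : [/\ set_fun (affinisation phi Nphi) (affinisation psi Npsi) F,
    set_inj (affinisation phi Nphi) F & True].
  by case: Fbij => ff fi _; split.
have aff_const z (h : it0 t0) t : affinisation phi Nphi (z, (fun=> val h), t).
  split=> [|s] /=; last exact: fphi.1 (t0_val h).
  rewrite (_ : (fun=> _) = trig_loop 0 (val h) 0); first exact: smooth_trig_loop.
  by apply/funext => s; rewrite /trig_loop mul0r cos0 scale1r scaler0 addr0.
have aff0 : affinisation phi Nphi 0 by exact: (aff_const 0 0 0).
have F0 : F 0 = 0.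
  by have := Fcar 0 0 0; rewrite mulr0 mul0r.
have FZ a y : affinisation phi Nphi y -> F (a *: y) = a *: F y.
  by move=> Ly; have := Flin a y 0 Ly aff0; rewrite F0 !addr0.
split=> //; exists (F x.1, F x.2); last first.
  apply: contra x0 => /eqP[e1 e2].
  have x10 : x.1 = 0 by apply: Finj; rewrite ?inE// F0.
  have x20 : x.2 = 0 by apply: Finj; rewrite ?inE// F0.
  by case: (x) x10 x20 => ? ? /= -> ->.
split; [exact: Ffun|exact: Ffun|] => -[[z h] t].
(* This is the preimage of [[z, h, t]] under the isomorphism; its third coordinate turns the height
   [r] into [Q r]. *)
have := rx (z / Q, h, t * Q).
have -> : ev (0, alpha, r) (z / Q, h, t * Q) = ev (0, alpha, Q * r) (z, h, t).
  by rewrite /ev /= !mul0r; ring.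
set E := ev _ _; rewrite /cbr /ite_emb /=.
rewrite !(aff_br0 nus fphi) !(aff_br0 nus' fpsi) !sub0r !add0r => /pair_equal_spec[/= e1 e2].
have FE : (z, (fun=> val h), - t) = F (z / Q, (fun=> val h), - (t * Q)).
  by rewrite Fcar mulrC divfK// mulNr mulfK.
rewrite FE -!Fbr//; try exact: aff_const.
rewrite e2 FZ//; apply: injective_projections => //=.
by rewrite -[aff_br _ _ x.2]opprK e1 -scaleNr FZ// scaleNr opprK.
Qed.

End RootTransport.

Section RootSet.
Context (R : realType) (k : hilbertLie R) (t0 : submodClosed k).
Context (phi psi : k -> k) (Nphi Npsi : nat) (nu nu' : alg_dual (it0 t0)).
Hypothesis phi_aut : lie_automorphism phi.
Hypothesis psi_aut : lie_automorphism psi.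
Hypothesis phi_order : has_order phi Nphi.
Hypothesis psi_order : has_order psi Npsi.
Hypothesis phi_max : maximal_abelian phi t0.
Hypothesis psi_max : maximal_abelian psi t0.
Hypothesis nu_slant : slant nu.
Hypothesis nu'_slant : slant nu'.
Hypothesis Npsi12 : Npsi = 1%N \/ Npsi = 2%N.
Hypothesis iso : aff_iso phi Nphi nu psi Npsi nu' (Npsi%:R / Nphi%:R).
Implicit Types (alpha : alg_dual (it0 t0)).

Local Notation Q := (Npsi%:R / Nphi%:R : R).

Let phi_linear : linear phi. Proof. by case: phi_aut. Qed.
Let psi_linear : linear psi. Proof. by case: psi_aut. Qed.
Let phi_fixed : fixed_abelian phi t0. Proof. by case: phi_max. Qed.
Let psi_fixed : fixed_abelian psi t0. Proof. by case: psi_max. Qed.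
Let Nphi0 : Nphi%:R != 0 :> R.
Proof. by rewrite pnatr_eq0 -lt0n; case: phi_order. Qed.
Let Npsi0 : Npsi%:R != 0 :> R.
Proof. by rewrite pnatr_eq0 -lt0n; case: psi_order. Qed.
Let Q0 : Q != 0. Proof. by rewrite mulf_neq0 ?invr_neq0. Qed.

Lemma index_pairs_twisted alpha (n : int) : index_pairs psi Npsi (alpha, n) ->
  alpha != 0 /\ exists2 v, twisted_weight psi Npsi alpha n%:~R v & v != 0.
Proof.
move=> /(root_twisted_weight psi_fixed psi_linear (slant0 t0))[a0 [v tv v0]].
split=> //; exists v => //; move: tv.
by rewrite (_ : _ - _ = n%:~R)// -[X in _ - X]/(0 : R) subr0.
Qed.

(** A slant only moves the heights: the twisted weights of [psi] are the same as for slant 0, and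
    subtracting [nu' (sharp alpha)] recovers an index. *)
Lemma compact_root_index alpha (r : R) : compact_root phi Nphi nu (0, alpha, r) ->
  exists n : int, index_pairs psi Npsi (alpha, n) /\ Q * r = n%:~R + nu' (sharp alpha).
Proof.
move=> /(iso_root phi_fixed psi_fixed nu_slant nu'_slant Q0 iso) cr.
have [a0 [v tv v0]] := root_twisted_weight psi_fixed psi_linear nu'_slant cr.
have /intrP[n nE] := twisted_weight_int psi_aut psi_order tv v0.
exists n; split; last by rewrite -nE subrK.
have := twisted_weight_root psi_fixed psi_linear (slant0 t0) a0 tv v0.
rewrite /index_pairs /= -nE (_ : _ + _ = Q * r - nu' (sharp alpha))//.
by rewrite -[X in _ + X]/(0 : R) addr0.
Qed.

(* Both sets of indices over alpha are unions of classes, modulo Nphi and Npsi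
   respectively.  One class maps onto one class, so only Npsi = 2 with both
   classes present is in question; then the weight space is not a complex line,
   and there are two classes for phi as well. *)
Lemma index_compact_root alpha (r : R) (n : int) :
  index_pairs psi Npsi (alpha, n) -> Q * r = n%:~R + nu' (sharp alpha) ->
  compact_root phi Nphi nu (0, alpha, r).
Proof.
move=> ipn rE; have [a0 [x tx x0]] := index_pairs_twisted ipn; have [wx px] := tx.
have image w v : twisted_weight phi Nphi alpha w v -> v != 0 ->
    exists m : int, index_pairs psi Npsi (alpha, m) /\
      Q * (w + nu (sharp alpha)) = m%:~R + nu' (sharp alpha).
  move=> tv v0; apply: compact_root_index.
  exact: (twisted_weight_root phi_fixed phi_linear nu_slant a0 tv v0).
(* It suffices to hit the class of n modulo [Npsi], since moving w by multiples of [Nphi] moves the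
   index by multiples of [Npsi]. *)
suff [w [v [m [tv v0 wm mn]]]] : exists w v (m : int),
    [/\ twisted_weight phi Nphi alpha w v, v != 0,
        Q * (w + nu (sharp alpha)) = m%:~R + nu' (sharp alpha)
      & (n%:~R - m%:~R) / Npsi%:R \is a @Num.int R].
  have /intrP[j jE] := mn.
  have tv' := twisted_weight_shift phi_order j tv.
  have -> : r = w + Nphi%:R * j%:~R + nu (sharp alpha).
    apply: (mulfI Q0); rewrite rE addrAC mulrDr wm -jE.
    by field; rewrite Nphi0 Npsi0.
  exact: (twisted_weight_root phi_fixed phi_linear nu_slant a0 tv' v0).
apply: contrapT => none.
have odd_image w v (m : int) : twisted_weight phi Nphi alpha w v -> v != 0 ->
    Q * (w + nu (sharp alpha)) = m%:~R + nu' (sharp alpha) ->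
    (n%:~R - m%:~R) / Npsi%:R \isn't a @Num.int R.
  by move=> tv v0 wm; apply/negP => h; apply: none; exists w, v, m; split.
have [w [v [tv v0]]] := twisted_weight_exists phi_aut phi_order phi_max wx x0.
have [m [ipm wm]] := image w v tv v0.
have := odd_image w v m tv v0 wm.
case: Npsi12 => N12; first by rewrite N12 divr1 rpredB ?intr_int.
move=> nm.
have half_int (a b : int) : (a%:~R - b%:~R) / Npsi%:R \is a @Num.int R = ((a - b) %% 2 == 0)%Z.
  have N2 : Npsi%:R = (2 : int)%:~R :> R by rewrite N12.
  apply/idP/idP => [/intrP[j jE]|/eqP e].
    have : a - b = j * 2.
      by apply/eqP; rewrite -(eqr_int R) intrM intrD intrN -jE N2 divfK.
    by move=> ->; rewrite modzMl.
  have -> : a%:~R - b%:~R = ((a - b) %/ 2)%Z%:~R * Npsi%:R :> R.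
    rewrite N2 -intrM -intrN -intrD; congr (_%:~R).
    by rewrite {1}(divz_eq (a - b) 2) e addr0.
  by rewrite mulfK ?intr_int.
(* Every image avoids the parity of n, so all images share the other parity and all [phi]-weights
   over [alpha] are congruent modulo [Nphi]. *)
have one (w1 w2 : R) v1 v2 : twisted_weight phi Nphi alpha w1 v1 -> v1 != 0 ->
    twisted_weight phi Nphi alpha w2 v2 -> v2 != 0 -> (w1 - w2) / Nphi%:R \is a Num.int.
  move=> t1 n1 t2 n2; have [m1 [_ e1]] := image _ _ t1 n1; have [m2 [_ e2]] := image _ _ t2 n2.
  have := odd_image _ _ _ t1 n1 e1; have := odd_image _ _ _ t2 n2 e2.
  have -> : (w1 - w2) / Nphi%:R = (m1%:~R - m2%:~R) / Npsi%:R.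
    have -> : m1%:~R - m2%:~R = Q * (w1 - w2).
      have := e1; have := e2; rewrite !mulrDr mulrN; lra.
    by field; rewrite Nphi0 Npsi0.
  rewrite !half_int; lia.
have [_ [x' tx' x'0]] := index_pairs_twisted ipm; have [wx' px'] := tx'.
have [c [d xE]] := weight_space_line phi_aut phi_order phi_max a0 one wx' wx x0.
(* Being a complex multiple of x, the vector [x'] has the [psi]-eigenvalue of index n besides that
   of index m, so n and m are congruent after all. *)
case/negP: nm; apply: (rot_fixed x'0).
have px'' : phip psi x' = rot (- (n%:~R * (2 * pi / Npsi%:R))) x'.
  have p1 : psi x.1 = cos (- (n%:~R * (2 * pi / Npsi%:R))) *: x.1 - sin (- (n%:~R * (2 * pi /
      Npsi%:R))) *: x.2.
    by have := congr1 fst px.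
  have p2 : psi x.2 = sin (- (n%:~R * (2 * pi / Npsi%:R))) *: x.1 + cos (- (n%:~R * (2 * pi /
      Npsi%:R))) *: x.2.
    by have := congr1 snd px.
  rewrite xE; apply: injective_projections;
    rewrite /= !(phiD psi_linear, phiN psi_linear, phiZ psi_linear) p1 p2;
    apply: ip_inj => t; rewrite !ipE; ring.
rewrite (_ : _ * _ = n%:~R * (2 * pi / Npsi%:R) + - (m%:~R * (2 * pi / Npsi%:R))); last by field.
by rewrite -rotD -px' px'' rotD addrN rot0.
Qed.

End RootSet.

(** * Linear functionals with prescribed values *)

Section LinearExtension.
Context (R : realType) (V : lmodType R).

Lemma linear_bundle (f : V -> R^o) : linear f ->
  exists L : {linear V -> R^o}, forall v, L v = f v.
Proof.
move=> lf; pose L : {linear V -> R^o} := HB.pack f (GRing.isLinear.Build R V R^o *:%R f lf).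
by exists L.
Qed.

Definition linear_graph (X : set (V * R^o)) : Prop :=
  (forall (a : R) u v, X u -> X v -> X (a *: u + v)) /\ (forall r, X (0, r) -> r = 0).

(** A maximal linear graph above K is total, since it could otherwise be extended by the value 0 at
    a new vector. *)
Lemma linear_graph_extension (K : set (V * R^o)) : K (0, 0) -> linear_graph K ->
  exists L : {linear V -> R^o}, forall u, K u -> L u.1 = u.2.
Proof.
move=> K0 gK; pose P X := X = set0 \/ (K `<=` X /\ linear_graph X).
have [F FP tot|A [PA Amax]] := @Zorn_bigcup _ P _.
  have [[X [FX KX]]|no] := pselect (exists X, F X /\ K `<=` X); last first.
    left; rewrite -subset0 => u [X FX Xu].
    by have [X0|[KX _]] := FP X FX; [rewrite X0 in Xu | apply: no; exists X].
  right; split; first by move=> u /KX Xu; exists X.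
  have good Y u : F Y -> Y u -> linear_graph Y.
    by move=> FY Yu; have [Y0|[]] := FP Y FY => //; rewrite Y0 in Yu.
  split=> [a u v [Y FY Yu] [Z FZ Zv]|r [Y FY Yr]].
    have [YZ|ZY] := tot Y Z FY FZ.
      exists Z => //; exact: ((good Z v FZ Zv).1 a u v (YZ _ Yu) Zv).
    exists Y => //; exact: ((good Y u FY Yu).1 a u v Yu (ZY _ Zv)).
  exact: (good Y _ FY Yr).2.
have {PA} [KA [lA fA]] : K `<=` A /\ linear_graph A.
  case: PA => // A0; exfalso; apply: (Amax K); last by right; split.
  by rewrite A0; split; [exact: sub0set | move=> /(_ _ K0)].
have A00 : A (0, 0) by apply: KA.
have AZ a u : A u -> A (a *: u) by move=> Au; rewrite -[_ *: _]addr0; apply: lA.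
have tot v : exists r, A (v, r).
  apply: contrapT => no.
  pose A' : set (V * R^o) := fun w => exists t : R, A (w.1 - t *: v, w.2).
  have AA' : A `<=` A' by move=> [u r] Au; exists 0; rewrite scale0r subr0.
  apply: (Amax A'); last first.
    right; split; first exact: subset_trans AA'.
    split=> [a [u1 r1] [u2 r2] [t1 A1] [t2 A2]|r [t At]].
      exists (a * t1 + t2); have := lA a _ _ A1 A2; congr A.
      apply: injective_projections => //=.
      by rewrite scalerBr scalerA scalerDl opprD addrACA.
    have [t0|t0] := eqVneq t 0.
      by apply: fA; move: At; rewrite /= t0 scale0r subr0.
    exfalso; apply: no; exists (- t^-1 * r).
    have := AZ (- t^-1) _ At; congr A; apply: injective_projections => //=.
    by rewrite sub0r scalerN scaleNr opprK scalerA mulVf// scale1r.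
  split=> // A'A; apply: no; exists 0; apply: A'A; exists 1.
  by rewrite /= scale1r subrr.
have [f fP] := choice tot.
have Auniq v r s : A (v, r) -> A (v, s) -> r = s.
  move=> Ar As; apply/eqP; rewrite -subr_eq0; apply/eqP; apply: fA.
  have := lA (-1) _ _ As Ar; congr A; apply: injective_projections => /=.
    by rewrite scaleN1r addNr.
  by rewrite scaleN1r addrC.
have [L LE] : exists L : {linear V -> R^o}, forall v, L v = f v.
  apply: linear_bundle => a u v; apply: (Auniq (a *: u + v)) => //.
  exact: (lA a (u, f u) (v, f v)).
by exists L => -[u r] Ku /=; rewrite LE; apply: (Auniq u) => //; apply: KA.
Qed.

(** The [b i] are independent but need not span. Dual coordinates make the prescription consistent
    on their span; asking for the expansion over all large finite F makes closure under sums
    immediate. *)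
Lemma linear_extension (I : choiceType) (b : I -> V) (coord : I -> V -> R) (s : I -> R) :
  (forall i (a : R) u v, coord i (a *: u + v) = a * coord i u + coord i v) ->
  (forall i j, coord i (b j) = (i == j)%:R) ->
  exists L : {linear V -> R^o}, forall i, L (b i) = s i.
Proof.
move=> clin cb.
have c0 i : coord i 0 = 0.
  by have := clin i 1 0 0; rewrite scale1r addr0 mul1r => h; lra.
pose K : set (V * R^o) := fun u => exists F0 : seq I, forall F, uniq F -> {subset F0 <= F} ->
  u.1 = \sum_(i <- F) coord i u.1 *: b i /\ u.2 = \sum_(i <- F) coord i u.1 * s i.
have [||L LK] := @linear_graph_extension K.
- by exists [::] => F _ _; split; rewrite big1// => i _; rewrite c0 ?scale0r ?mul0r.
- split=> [a u v [F1 h1] [F2 h2]|r [F0 h]].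
    exists (F1 ++ F2) => F uF sF.
    have [u1 u2] := h1 F uF (fun i iF => sF i (etrans (mem_cat i F1 F2) (introT orP (or_introl
        iF)))).
    have [v1 v2] := h2 F uF (fun i iF => sF i (etrans (mem_cat i F1 F2) (introT orP (or_intror
        iF)))).
    split=> /=.
      rewrite {1}u1 {1}v1 scaler_sumr -big_split; apply: eq_bigr => i _.
      by rewrite clin scalerDl scalerA.
    rewrite -[LHS]/(a * u.2 + v.2) {1}u2 {1}v2 mulr_sumr -big_split.
    by apply: eq_bigr => i _; rewrite clin mulrDl mulrA.
  have [|_ /= ->] := h (undup F0) (undup_uniq _); first by move=> i; rewrite mem_undup.
  by rewrite big1// => i _; rewrite c0 mul0r.
exists L => i; apply: (LK (b i, s i)); exists [:: i] => F uF sF.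
have iF : i \in F by apply: sF; rewrite inE eqxx.
split; rewrite /= (bigD1_seq i)//= cb eqxx ?scale1r ?mul1r big1 ?addr0// => j ji;
  by rewrite cb (negPf ji) ?scale0r ?mul0r.
Qed.

End LinearExtension.

(** * The seven root systems in a common shape *)

Section RootShape.
Context (R : realType) (k : hilbertLie R) (t0 : submodClosed k).
Context (J : choiceType) (eps : J -> alg_dual (it0 t0)).
Implicit Types (alpha : alg_dual (it0 t0)).

Definition pair_root (a b : R) (j l : J) : alg_dual (it0 t0) := a *: eps j - b *: eps l.

Definition is_pair_root (sg : bool) (sigma : int) (p : alg_dual (it0 t0) * int) : Prop :=
  exists j l a b (n : int), [/\ j != l, sign_allowed sg a, sign_allowed sg b,
    p.1 = pair_root a b j l & p.2 = sigma * n].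

(** The reflection in [a eps_j] at height n sends [y_j] to [- y_j + (2 n / a) level], so [2 n / a]
    is the offset that has to lie in [sigma Z]. *)
Definition is_single_root (sigma : int) (p : alg_dual (it0 t0) * int) : Prop :=
  exists j (a : R) (n : int), [/\ a != 0, p.1 = a *: eps j
    & 2 * p.2%:~R / a = (sigma * n)%:~R].

(* All index sets contain the roots a eps_j - b eps_l with shifts in sigma Z,
   for all signs a, b (positive ones only in type A); the remaining roots are
   multiples of eps_j, and act on the shifted weights by reflections in points
   of (sigma / 2) Z. *)
Definition root_shape (sg : bool) (sigma : int) (X : set (alg_dual (it0 t0) * int)) : Prop :=
  (forall p, is_pair_root sg sigma p -> X p) /\
  (forall p, X p -> is_pair_root sg sigma p \/ sg /\ is_single_root sigma p).

Lemma rs_D_pair alpha : rs_D eps alpha <-> exists j l a b,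
  [/\ j != l, sign_allowed true a, sign_allowed true b & alpha = pair_root a b j l].
Proof.
have P1 : sign_allowed true (1 : R) by left.
have N1 : sign_allowed true (-1 : R) by right.
rewrite /pair_root; split.
  move=> [j [l [jl [] ->]]]; exists j, l.
  - by exists 1, (-1); split; rewrite // scale1r scaleN1r opprK.
  - by exists (-1), 1; split; rewrite // scale1r scaleN1r opprD.
  - by exists 1, 1; split; rewrite // !scale1r.
  - by exists (-1), (-1); split; rewrite // !scaleN1r opprB opprK addrC.
move=> [j [l [a [b [jl aS bS ->]]]]]; exists j, l; split=> //.
case: aS bS => [->|[_ ->]] [->|[_ ->]]; rewrite ?scale1r ?scaleN1r ?opprK.
- exact: Or43.
- exact: Or41.
- by apply: Or42; rewrite opprD.
- by apply: Or44; rewrite opprB addrC.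
Qed.

Lemma rs_D_shape (n : int) alpha (sigma m : int) : rs_D eps alpha -> n = sigma * m ->
  is_pair_root true sigma (alpha, n).
Proof. by move=> /rs_D_pair[j [l [a [b [jl aS bS ->]]]]] ->; exists j, l, a, b, m; split. Qed.

Lemma pair_root_D sigma (p : alg_dual (it0 t0) * int) : is_pair_root true sigma p ->
  rs_D eps p.1 /\ exists m, p.2 = sigma * m.
Proof.
move=> [j [l [a [b [m [jl aS bS -> ->]]]]]]; split; last by exists m.
by apply/rs_D_pair; exists j, l, a, b; split.
Qed.

Lemma rs_short_single alpha (n m sigma : int) : rs_short eps alpha -> 2 * n = sigma * m ->
  is_single_root sigma (alpha, n).
Proof.
move=> [j h] nm; have nmR : 2 * n%:~R = (sigma * m)%:~R :> R by rewrite -nm intrM.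
case: h => ->.
  by exists j, 1, m; split; rewrite /= ?oner_eq0 ?scale1r ?divr1.
exists j, (-1), (- m); split; rewrite /= ?oppr_eq0 ?oner_eq0 ?scaleN1r//.
by rewrite invrN invr1 mulrN1 mulrN intrN nmR.
Qed.

Lemma rs_long_single alpha (n m sigma : int) : rs_long eps alpha -> n = sigma * m ->
  is_single_root sigma (alpha, n).
Proof.
move=> [j h] nm; have nmR : n%:~R = (sigma * m)%:~R :> R by rewrite -nm.
case: h => ->.
  by exists j, 2, m; split; rewrite /= ?pnatr_eq0// nmR; field.
exists j, (-2), (- m); split; rewrite /= ?oppr_eq0 ?pnatr_eq0 ?scaleNr//.
by rewrite mulrN intrN nmR; field.
Qed.

(** Signs are absent only in type A. The step is 2 only for [B_J^(2)], where pair roots have even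
    heights and short roots arbitrary ones; in all other types pair roots occur at every height. *)
Lemma index_pairs_shape (psi : k -> k) (Npsi : nat) :
  (Npsi = 1%N /\ [\/ index_pairs psi Npsi = rs_A eps `*` setT,
                     index_pairs psi Npsi = rs_B eps `*` setT,
                     index_pairs psi Npsi = rs_C eps `*` setT
                   | index_pairs psi Npsi = rs_D eps `*` setT]) \/
  (Npsi = 2%N /\ [\/ index_pairs psi Npsi = rs_B2 eps,
                     index_pairs psi Npsi = rs_C2 eps
                   | index_pairs psi Npsi = rs_BC2 eps]) ->
  exists sg sigma, (sigma = 1 \/ sigma = 2) /\ root_shape sg sigma (index_pairs psi Npsi).
Proof.
have even_dvd (n : int) : evenz n <-> exists m, n = 2 * m.
  split; first by move=> /dvdzP[m nE]; exists m; rewrite nE mulrC.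
  by move=> [m nE]; apply/dvdzP; exists m; rewrite nE mulrC.
have m1 (n : int) : n = 1 * n by rewrite mul1r.
move=> [[_]|[_]] [] ->.
- exists false, 1; split; first by left.
  have one (a : R) : sign_allowed false a -> a = 1 by case=> // -[].
  split=> [[al n] [j [l [a [b [m [jl /one -> /one -> /= -> _]]]]]]|].
    by split=> //; exists j, l; split=> //; rewrite /pair_root !scale1r.
  move=> [al n] [/= [j [l [jl ->]]] _]; left; exists j, l, 1, 1, n; split; rewrite ?mul1r//=.
  + by left.
  + by left.
  by rewrite /pair_root !scale1r.
- exists true, 1; split; first by left.
  split=> [p /pair_root_D[Dp _]|[al n] [/= [Da|sa] _]]; first by split=> //; left.
    by left; exact: rs_D_shape (m1 n).
  by right; split=> //; apply: (rs_short_single (m := 2 * n)) => //; rewrite mul1r.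
- exists true, 1; split; first by left.
  split=> [p /pair_root_D[Dp _]|[al n] [/= [Da|sa] _]]; first by split=> //; left.
    by left; exact: rs_D_shape (m1 n).
  by right; split=> //; exact: rs_long_single (m1 n).
- exists true, 1; split; first by left.
  split=> [p /pair_root_D[Dp _]|[al n] [/= Da _]]; first by split.
  by left; exact: rs_D_shape (m1 n).
- exists true, 2; split; first by right.
  split=> [p /pair_root_D[Dp pm]|[al n]].
    by left; split; [left | apply/even_dvd].
  move=> [[/= [Da|sa] /even_dvd[m nE]]|[/= sa _]].
  + by left; exact: rs_D_shape nE.
  + by right; split=> //; apply: (rs_short_single (m := n)).
  + by right; split=> //; apply: (rs_short_single (m := n)).
- exists true, 1; split; first by left.
  split=> [p /pair_root_D[Dp pm]|[al n]].
    have [ev|od] := boolP (2 %| p.2)%Z; [left|right]; split=> //; by left.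
  move=> [[/= [Da|sa] _]|[/= Da _]].
  + by left; exact: rs_D_shape (m1 n).
  + by right; split=> //; exact: rs_long_single (m1 n).
  + by left; exact: rs_D_shape (m1 n).
- exists true, 1; split; first by left.
  split=> [p /pair_root_D[Dp pm]|[al n]].
    have [ev|od] := boolP (2 %| p.2)%Z; [left|right]; split=> //; first by left.
    by left; left.
  have short : rs_short eps al -> is_single_root 1 (al, n).
    by move=> sa; apply: (rs_short_single (m := 2 * n)) => //; rewrite mul1r.
  have D : rs_D eps al -> is_pair_root true 1 (al, n) by move=> Da; exact: rs_D_shape (m1 n).
  move=> [[/= [Da|sa] _]|[/= [[Da|sa]|[Da|la]] _]].
  + by left; exact: D.
  + by right; split=> //; exact: short.
  + by left; exact: D.
  + by right; split=> //; exact: short.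
  + by left; exact: D.
  + by right; split=> //; exact: rs_long_single (m1 n).
Qed.

End RootShape.

(** * The Weyl orbit in coordinates *)

Section WeylOrbit.
Context (R : realType) (k : hilbertLie R) (t0 : submodClosed k).
Context (phi : k -> k) (N : nat) (nu nu' : alg_dual (it0 t0)) (Q : R).
Hypothesis phi_aut : lie_automorphism phi.
Hypothesis t0_max : maximal_abelian phi t0.
Hypothesis nu_slant : slant nu.
Hypothesis Q_neq0 : Q != 0.
Context (J : choiceType) (e : J -> it0 t0) (eps : J -> alg_dual (it0 t0)) (c : R).
Hypothesis c_gt0 : 0 < c.
Hypothesis e_orth : forall j l, c * ip (val (e j)) (val (e l)) = (j == l)%:R.
Hypothesis eps_e : forall j l, eps j (e l) = (j == l)%:R.
Hypothesis eps_rep : forall j, represents (c *: e j) (eps j).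
Context (X : set (alg_dual (it0 t0) * int)) (sg : bool) (sigma : int).
Hypothesis X_root : forall alpha (r : R), compact_root phi N nu (0, alpha, r) <->
  exists n : int, X (alpha, n) /\ Q * r = n%:~R + nu' (sharp alpha).
Hypothesis X_shape : root_shape eps sg sigma X.
Context (lam : ite_dual t0).
Hypothesis lam_c : (lam.1.1 : R) != 0.

Let c_neq0 : c != 0. Proof. by rewrite gt_eqF. Qed.

(** The subtraction absorbs the slant, so that pairing with a coroot becomes the affine form
    [a y_j - b y_l - level n]. *)
Definition shifted_weight (m : ite_dual t0) (j : J) : R :=
  (m.1.2 (e j) : R) - (lam.1.1 : R) * ((nu' (e j) : R) / Q).

Definition level : R := (lam.1.1 : R) / (Q * c).

Lemma representsD s s' (a b : alg_dual (it0 t0)) : represents s a -> represents s' b ->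
  represents (s + s') (a + b).
Proof. by move=> hs hs' h; rewrite -[LHS]/(a h + b h) hs hs' -ipDr. Qed.

Lemma representsZ s (a : alg_dual (it0 t0)) (x : R) : represents s a ->
  represents (x *: s) (x *: a).
Proof. by move=> hs h; rewrite -[LHS]/(x * a h) hs -ipZr. Qed.

Lemma pair_root_rep a b j l :
  represents ((a * c) *: e j - (b * c) *: e l) (pair_root eps a b j l).
Proof.
rewrite -!scalerA; apply: representsD; first exact: representsZ.
by apply: representsN; apply: representsZ.
Qed.

Lemma coroot_pairing m s alpha (r : R) : represents s alpha ->
  compact_root phi N nu (0, alpha, r) ->
  ev m (coroot phi N nu (0, alpha, r)) =
    (2 : R) / ip (val s) (val s) * ((m.1.2 s : R) - (m.1.1 : R) * r).
Proof.
move=> hs cr; have [s' [hs' s0 ->]] := coroot_val phi_aut t0_max nu_slant cr.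
rewrite (represents_inj hs' hs) in s0 *.
pose q : R := ip (val s) (val s); have q0 : q != 0 by rewrite gt_eqF.
rewrite -[RHS]/((2 : R) / q * ((m.1.2 s : R) - (m.1.1 : R) * r)).
transitivity ((m.1.1 : R) * (- (2 * r / q) : R) + (2 : R) / q * (m.1.2 s : R)).
  by rewrite /ev /= mulr0 addr0 (alg_dual_rZ _ m.1.2).
by field.
Qed.

Lemma pair_norm (a b : R) j l : j != l -> a ^+ 2 = 1 -> b ^+ 2 = 1 ->
  let s := (a * c) *: e j - (b * c) *: e l in ip (val s) (val s) = 2 * c.
Proof.
move=> jl a2 b2 s; have ee i i' : ip (val (e i)) (val (e i')) = (i == i')%:R / c.
  by rewrite -e_orth mulrC mulKf.
rewrite -[val s]/((a * c) *: val (e j) - (b * c) *: val (e l)) !ipE !ee !eqxx.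
rewrite [l == j]eq_sym (negPf jl).
rewrite mulr1n mulr0n.
transitivity ((a ^+ 2 + b ^+ 2) * c); first by field.
by rewrite a2 b2; ring.
Qed.

Lemma single_norm (a : R) j :
  let s := (a * c) *: e j in ip (val s) (val s) = a ^+ 2 * c.
Proof.
move=> s; rewrite -[val s]/((a * c) *: val (e j)) !ipE.
have := e_orth j j; rewrite eqxx => h.
transitivity (a ^+ 2 * c * (c * ip (val (e j)) (val (e j)))); first by ring.
by rewrite h mulr1.
Qed.

Lemma sign_sqr (a : R) : sign_allowed sg a -> a ^+ 2 = 1.
Proof. by case=> [->|[_ ->]]; rewrite ?sqrrN expr1n. Qed.

Lemma root_height alpha s (n : int) (r : R) : represents s alpha ->
  Q * r = n%:~R + nu' (sharp alpha) -> r = (n%:~R + (nu' s : R)) / Q.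
Proof. by move=> hs; rewrite (represents_sharp hs) => <-; rewrite mulrC mulKf. Qed.

Lemma dual_comb (f : alg_dual (it0 t0)) (x z : R) (h h' : it0 t0) :
  (f (x *: h - z *: h') : R) = x * (f h : R) - z * (f h' : R).
Proof. by rewrite (alg_dual_rD f) (alg_dual_rN f) !(alg_dual_rZ _ f). Qed.

Lemma pairing_pair m a b j l (n : int) (r : R) : (m.1.1 : R) = lam.1.1 -> j != l ->
  sign_allowed sg a -> sign_allowed sg b ->
  compact_root phi N nu (0, pair_root eps a b j l, r) ->
  Q * r = n%:~R + nu' (sharp (pair_root eps a b j l)) ->
  ev m (coroot phi N nu (0, pair_root eps a b j l, r)) =
    a * shifted_weight m j - b * shifted_weight m l - level * n%:~R.
Proof.
move=> mc jl aS bS cr rE; have rep := pair_root_rep a b j l.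
rewrite (coroot_pairing _ rep cr) (root_height rep rE) (pair_norm jl (sign_sqr aS) (sign_sqr bS)).
rewrite mc !dual_comb /shifted_weight /level.
by field; rewrite c_neq0 Q_neq0.
Qed.

Lemma pairing_single m a j (n : int) (r : R) : (m.1.1 : R) = lam.1.1 -> a != 0 ->
  compact_root phi N nu (0, a *: eps j, r) ->
  Q * r = n%:~R + nu' (sharp (a *: eps j)) ->
  ev m (coroot phi N nu (0, a *: eps j, r)) =
    (2 * shifted_weight m j - level * (2 * n%:~R / a)) / a.
Proof.
move=> mc a0 cr rE; have rep : represents ((a * c) *: e j) (a *: eps j).
  by rewrite -scalerA; exact: representsZ.
rewrite (coroot_pairing _ rep cr) (root_height rep rE) single_norm mc.
rewrite !(alg_dual_rZ (a * c)) /shifted_weight /level.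
by field; rewrite c_neq0 Q_neq0 a0.
Qed.

Lemma pair_root_compact a b j l (n : int) : j != l -> sign_allowed sg a -> sign_allowed sg b ->
  exists r : R, compact_root phi N nu (0, pair_root eps a b j l, r) /\
    Q * r = (sigma * n)%:~R + nu' (sharp (pair_root eps a b j l)).
Proof.
move=> jl aS bS; set al := pair_root eps a b j l.
have [Xin _] := X_shape; have Xal : X (al, sigma * n).
  by apply: Xin; exists j, l, a, b, n; split.
have rE : Q * (((sigma * n)%:~R + nu' (sharp al)) / Q) = (sigma * n)%:~R + nu' (sharp al).
  by rewrite mulrC divfK.
exists (((sigma * n)%:~R + nu' (sharp al)) / Q); split=> //.
by apply/X_root; exists (sigma * n).
Qed.

Section Character.
Context (chi : {linear ite_dual t0 -> R^o}).
Hypothesis lam_chi : 0 < (lam.1.1 : R) * chi (0, 0, 1).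

(* On the orbit of lam, chi is scale times the squared distance of the shifted
   weight to the centre, up to an additive constant. *)
Definition scale : R := c * chi (0, 0, 1) / (lam.1.1 : R).

(** Solved so that [chi] of a root is [- scale] times the affine form of the root at the centre. A
    reflection then changes [chi] by [scale] times the product of the forms at y and at the centre,
    as in [reach]. *)
Definition centre (j : J) : R :=
  - ((chi (0, eps j, 0) : R) + chi (0, 0, 1) * c * (nu' (e j) / Q)) / scale.

Lemma scale_gt0 : 0 < scale.
Proof.
rewrite /scale; move: (lam.1.1 : R) (chi (0, 0, 1) : R) lam_c lam_chi => x z x0 xz.
have -> : c * z / x = c * (x * z) / x ^+ 2 by field.
by apply: divr_gt0; [exact: mulr_gt0 | rewrite lt0r sqrf_eq0 x0 sqr_ge0].
Qed.

Let chi_d_neq0 : (chi (0, 0, 1) : R) != 0.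
Proof. by apply: contraTneq lam_chi => ->; rewrite mulr0 ltxx. Qed.

Lemma chi_root alpha (r : R) : chi (0, alpha, r) = (chi (0, alpha, 0) : R) + r * chi (0, 0, 1).
Proof.
have -> : (0, alpha, r) = (0, alpha, 0) + r *: (0, 0, 1) :> ite_dual t0.
  apply: injective_projections; [apply: injective_projections|] => /=.
  - by rewrite -[RHS]/(0 + r * 0) mulr0 addr0.
  - by rewrite -[RHS]/(alpha + r *: 0) scaler0 addr0.
  - by rewrite -[RHS]/(0 + r * 1) mulr1 add0r.
by rewrite linearD linearZ.
Qed.

Lemma chi_middle (a b : R) alpha beta :
  chi (0, a *: alpha + b *: beta, 0) = a * (chi (0, alpha, 0) : R) + b * chi (0, beta, 0).
Proof.
have -> : (0, a *: alpha + b *: beta, 0) = a *: (0, alpha, 0) + b *: (0, beta, 0) :> ite_dual t0.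
  apply: injective_projections; [apply: injective_projections|] => //=.
  - by rewrite -[RHS]/(a * 0 + b * 0) !mulr0 addr0.
  - by rewrite -[RHS]/(a * 0 + b * 0) !mulr0 addr0.
by rewrite linearD !linearZ.
Qed.

Lemma chi_pair a b j l (n : int) (r : R) :
  Q * r = n%:~R + nu' (sharp (pair_root eps a b j l)) ->
  chi (0, pair_root eps a b j l, r) =
    - scale * (a * centre j - b * centre l - level * n%:~R) :> R.
Proof.
move=> rE; rewrite chi_root (root_height (pair_root_rep a b j l) rE) dual_comb.
rewrite /pair_root -scaleNr chi_middle /centre /level /scale.
by field; rewrite c_neq0 Q_neq0 lam_c chi_d_neq0.
Qed.

Lemma chi_single a j (n : int) (r : R) : Q * r = n%:~R + nu' (sharp (a *: eps j)) ->
  chi (0, a *: eps j, r) = - scale * (a * centre j - level * n%:~R) :> R.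
Proof.
move=> rE; have rep : represents ((a * c) *: e j) (a *: eps j).
  by rewrite -scalerA; exact: representsZ.
have := chi_middle a 0 (eps j) (eps j); rewrite scale0r addr0 mul0r addr0 => chiE.
rewrite chi_root (root_height rep rE) (alg_dual_rZ _ nu') chiE /centre /level /scale.
by field; rewrite c_neq0 Q_neq0 lam_c chi_d_neq0.
Qed.

Context (tau : nat) (u : int).
(** The sign [u] of the level is absorbed into the integer offsets, leaving a natural number [tau]
    as lattice step. *)
Hypothesis u_unit : u * u = 1.
Hypothesis tauE : level * sigma%:~R = tau%:R * u%:~R.

Local Notation T := (tau%:R : R).

Lemma levelE (n : int) : level * (sigma * n)%:~R = T * (u * n)%:~R.
Proof. by rewrite !intrM mulrA tauE mulrA. Qed.

Lemma shifted_reflection gamma m i :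
  shifted_weight (reflection phi N nu gamma m) i =
  shifted_weight m i - ev m (coroot phi N nu gamma) * gamma.1.2 (e i).
Proof.
rewrite /shifted_weight /reflection; move: (ev m _) => z.
have -> : (m - z *: gamma).1.2 = m.1.2 - z *: gamma.1.2 by exact: erefl.
move: (m.1.2) (gamma.1.2) => f g.
rewrite (_ : (f - z *: g) (e i) = (f (e i) : R) - z * (g (e i) : R)); last by exact: erefl.
by rewrite addrAC.
Qed.

Lemma chi_reflection gamma m :
  chi (reflection phi N nu gamma m) =
  (chi m : R) - ev m (coroot phi N nu gamma) * chi gamma :> R.
Proof. by rewrite /reflection linearB linearZ. Qed.

Lemma centre_reflection alpha (r : R) m :
  (reflection phi N nu (0, alpha, r) m).1.1 = m.1.1 :> R.
Proof.
rewrite /reflection; move: (ev m _) => z.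
by rewrite -[LHS]/((m.1.1 : R) - z * 0) mulr0 subr0.
Qed.

Let state (m : ite_dual t0) (y : J -> R) (v : R) : Prop :=
  [/\ (m.1.1 : R) = lam.1.1, shifted_weight m = y
    & (chi m : R) - chi lam = scale * v].

Lemma reflection_pair m y v a b j l (n : int) (r : R) : state m y v -> j != l ->
  sign_allowed sg a -> sign_allowed sg b ->
  compact_root phi N nu (0, pair_root eps a b j l, r) ->
  Q * r = (sigma * n)%:~R + nu' (sharp (pair_root eps a b j l)) ->
  state (reflection phi N nu (0, pair_root eps a b j l, r) m)
    (pair_move a b j l (T * (u * n)%:~R) y)
    (v + (a * y j - b * y l - T * (u * n)%:~R)
         * (a * centre j - b * centre l - T * (u * n)%:~R)).
Proof.
move=> [mc my mv] jl aS bS cr rE; have evE := pairing_pair mc jl aS bS cr rE.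
have a2 := sign_sqr aS; have b2 := sign_sqr bS.
split; first by rewrite centre_reflection.
  apply/funext => i; rewrite shifted_reflection evE levelE my.
  rewrite -[X in _ - _ * X]/(a * (eps j (e i) : R) - b * (eps l (e i) : R)) !eps_e /pair_move.
  have [->|ij] := eqVneq i j.
    rewrite ?eqxx [l == j]eq_sym (negPf jl) mulr0 subr0 mulr1.
    transitivity (y j - a ^+ 2 * y j + a * b * y l + a * (T * (u * n)%:~R)); first by ring.
    by rewrite a2; ring.
  have [->|il] := eqVneq i l.
    rewrite ?(negPf jl) ?eqxx mulr0 sub0r mulr1.
    transitivity (y l - b ^+ 2 * y l + a * b * y j - b * (T * (u * n)%:~R)); first by ring.
    by rewrite b2; ring.
  by rewrite ?[j == i]eq_sym ?[l == i]eq_sym ?(negPf ij) ?(negPf il) !mulr0 subrr mulr0 subr0.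
rewrite chi_reflection evE (chi_pair rE) levelE my addrAC mv; ring.
Qed.

Lemma reflection_single m y v a j (n n' : int) (r : R) : state m y v -> a != 0 ->
  compact_root phi N nu (0, a *: eps j, r) ->
  Q * r = n%:~R + nu' (sharp (a *: eps j)) -> 2 * n%:~R / a = (sigma * n')%:~R ->
  state (reflection phi N nu (0, a *: eps j, r) m)
    (flip_move j (T * (u * n')%:~R) y)
    (v + (2 * y j - T * (u * n')%:~R) * (2 * centre j - T * (u * n')%:~R) / 2).
Proof.
move=> [mc my mv] a0 cr rE nE; have evE := pairing_single mc a0 cr rE.
have nE' : level * n%:~R = a / 2 * (T * (u * n')%:~R) by rewrite -levelE -nE; field.
split; first by rewrite centre_reflection.
  apply/funext => i; rewrite shifted_reflection evE nE levelE my.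
  rewrite -[X in _ - _ * X]/(a * (eps j (e i) : R)) eps_e /flip_move.
  have [->|ij] := eqVneq i j; first by rewrite ?eqxx /= mulr1; field.
  by rewrite ?[j == i]eq_sym ?(negPf ij) !mulr0 subr0.
rewrite chi_reflection evE nE levelE (chi_single rE) nE' my addrAC mv.
by field.
Qed.

Lemma state_id : state lam (shifted_weight lam) 0.
Proof. by split=> //; rewrite subrr mulr0. Qed.

Lemma weyl_reach w : weyl_group phi N nu w -> exists y v,
  state (w lam) y v /\ reach sg sg T (shifted_weight lam) centre y v.
Proof.
elim=> [|gamma {}w cr _ [y [v [st rch]]]].
  by exists (shifted_weight lam), 0; split; [exact: state_id | exact: reach_id].
move: gamma cr => [[gc al] r] cr.
have gc0 : gc = 0.
  have [_ [x rx x0]] := cr; exact: (root_center t0_max.1 nu_slant rx x0).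
move: cr; rewrite gc0 => cr.
have [n [Xn rE]] := (X_root al r).1 cr.
have [_ /(_ _ Xn)[]] := X_shape.
  move=> [j [l [a [b [n' [jl aS bS /= alE nE]]]]]]; rewrite alE nE in cr rE *.
  have st' := reflection_pair st jl aS bS cr rE.
  by do 2 eexists; split; [exact: st' | exact: reach_pair].
move=> [sgT [j [a [n' [a0 /= alE nE]]]]]; rewrite alE in cr rE *.
have st' := reflection_single st a0 cr rE nE.
by do 2 eexists; split; [exact: st' | exact: reach_flip].
Qed.

(** Pair roots occur at every multiple of [sigma] in all types, so every pair move is realised; no
    such uniform statement holds for flips. *)
Lemma reach_weyl y v : reach sg false T (shifted_weight lam) centre y v ->
  exists2 w, weyl_group phi N nu w & state (w lam) y v.
Proof.
elim=> [|{}y {}v j l a b n _ [w Ww st] jl aS bS|//].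
  by exists id; [exact: weyl_id | exact: state_id].
have [r [cr rE]] := pair_root_compact (u * n) jl aS bS.
exists (reflection phi N nu (0, pair_root eps a b j l, r) \o w).
  exact: weyl_refl.
have := reflection_pair st jl aS bS cr rE.
by rewrite mulrA u_unit mul1r.
Qed.

Lemma orbit_inf_gt C : (forall w, weyl_group phi N nu w -> C <= (chi (w lam - lam) : R)) ->
  (C%:E <= orbit_inf phi N nu chi lam)%E.
Proof.
by move=> h; apply: le_ereal_inf_tmp => _ [w Ww <-]; rewrite lee_fin; exact: h.
Qed.

Lemma orbit_inf_le w : weyl_group phi N nu w ->
  (orbit_inf phi N nu chi lam <= (chi (w lam - lam) : R)%:E)%E.
Proof. by move=> Ww; apply: ereal_inf_lbound; exists w. Qed.

Lemma orbit_inf_reach (C : R) :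
  (forall y v, reach sg sg T (shifted_weight lam) centre y v -> C <= v) ->
  ((scale * C)%:E <= orbit_inf phi N nu chi lam)%E.
Proof.
move=> h; apply: orbit_inf_gt => w /weyl_reach[y [v [[_ _ mv] rch]]].
by rewrite linearB [X in _ <= X]mv ler_pM2l ?scale_gt0// (h _ _ rch).
Qed.

Lemma reach_bounded (C : R) : (C%:E <= orbit_inf phi N nu chi lam)%E ->
  forall y v, reach sg false T (shifted_weight lam) centre y v -> C / scale <= v.
Proof.
move=> hC y v /reach_weyl[w Ww [_ _ mv]]; rewrite ler_pdivrMr ?scale_gt0// mulrC -mv.
rewrite -lee_fin; apply: le_trans hC _; apply: le_trans (orbit_inf_le Ww) _.
by rewrite linearB.
Qed.

End Character.
End WeylOrbit.

(** * Summability, and functionals dual to an orthonormal basis *)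

Section Summable.
Context (R : realType) (J : choiceType).

Lemma summable_sums (s : J -> R) :
  summable [set: J] (fun j => (s j)%:E) <-> exists S : R, sums_bounded (fun j => `|s j|) S.
Proof.
have sumE (F : seq J) : uniq F ->
    (\sum_(j \in [set` F]) `|(s j)%:E|)%E = (\sum_(j <- F) `|s j|)%:E.
  by move=> uF; rewrite -fsbig_seq// -sumEFin; apply: eq_bigr.
rewrite /summable; split=> [sfin|[S hS]].
  have s0 : (0 <= \esum_(x in [set: J]) `|(s x)%:E|)%E by apply: esum_ge0.
  exists (fine (\esum_(x in [set: J]) `|(s x)%:E|)%E) => F uF.
  rewrite -lee_fin fineK; last by rewrite ge0_fin_numE.
  by apply: esum_ge; exists [set` F]; rewrite ?sumE//; split=> //; exact: finite_seq.
apply: (@le_lt_trans _ _ S%:E); last exact: ltry.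
apply: ge_ereal_sup => _ [A [/finite_seqP[F AF] _] <-].
have -> : A = [set` undup F] by rewrite AF; apply/seteqP; split=> j; rewrite /= mem_undup.
by rewrite sumE ?undup_uniq// lee_fin hS// undup_uniq.
Qed.

End Summable.

(** Both functionals are bounded and agree on the span of the [e j], which is dense. *)
Lemma dual_system_rep (R : realType) (k : hilbertLie R) (t0 : submodClosed k)
  (J : choiceType) (e : J -> it0 t0) (eps : J -> alg_dual (it0 t0)) (c : R) :
  (forall j l, c * ip (val (e j)) (val (e l)) = (j == l)%:R) ->
  (forall (h : it0 t0) (r : R), 0 < r -> exists (s : seq J) (a : J -> R),
     `|val (h - \sum_(j <- s) a j *: e j)| < r) ->
  dual_system e eps -> forall j, represents (c *: e j) (eps j).
Proof.
move=> orth dense [eps_e bd] j h; have [C hC] := bd j.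
have rep_sum (s : seq J) (a : J -> R) : let g := \sum_(l <- s) a l *: e l in
    (eps j g : R) = c * ip (val g) (val (e j)).
  elim: s => [|l s IH] g; rewrite /g ?big_nil ?big_cons.
    by rewrite (alg_dual_r0 (eps j)) ip0l mulr0.
  rewrite (alg_dual_rD (eps j)) (alg_dual_rZ _ (eps j)) eps_e IH.
  rewrite -[val (_ + _)]/(a l *: val (e l) + val (\sum_(l <- s) a l *: e l)) ipDl ipZl mulrDr.
  by rewrite [c * (_ * _)]mulrCA orth [l == j]eq_sym.
rewrite -[val (c *: e j)]/(c *: val (e j)) ipZr.
pose D : R := (eps j h : R) - c * ip (val h) (val (e j)).
suff D0 : D = 0 by apply/eqP; rewrite -subr_eq0; apply/eqP.
pose K := `|C| + `|c| * `|val (e j)| + 1.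
have K0 : 0 < K by rewrite ltr_wpDl// addr_ge0// mulr_ge0.
have bound g : `|(eps j g : R) - c * ip (val g) (val (e j))| <= K * `|val g|.
  apply: (le_trans (ler_normB _ _)); rewrite normrM.
  apply: (le_trans (lerD (hC g) (ler_wpM2l (normr_ge0 c) (ip_le _ _)))).
  have := ler_norm C; have := normr_ge0 (val g); move: `|val g| => x x0 hc.
  rewrite [`|val (e j)|]lock; rewrite /K -lock; nra.
apply/eqP; rewrite -normr_le0; apply/ler_addgt0Pl => r r0; rewrite addr0.
have [s [a hs]] := dense h (r / K) (divr_gt0 r0 K0).
set g := \sum_(l <- s) a l *: e l in hs.
have -> : D = (eps j (h - g) : R) - c * ip (val (h - g)) (val (e j)).
  have := rep_sum s a; rewrite -/g => rg.
  rewrite (alg_dual_rD (eps j)) (alg_dual_rN (eps j)) rg.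
  by rewrite -[val (h - g)]/(val h - val g) ipBl /D; ring.
apply: le_trans (bound _) _; rewrite mulrC -ler_pdivlMr//; exact: ltW.
Qed.

(** * Integrality of the weight in coordinates *)

Section Integrality.
Context (R : realType) (J : choiceType) (J_infinite : infinite_set [set: J]).
Context (sg : bool) (l : J -> R) (lev : R).
Hypothesis lev0 : lev != 0.
Hypothesis int_pairs : forall j i a b (n : int), j != i -> sign_allowed sg a ->
  sign_allowed sg b -> a * l j - b * l i - lev * n%:~R \is a Num.int.

(** Comparing the offsets 0 and 1 shows that the level is an integer; offset 0 puts all [l j] in one
    coset of the integers; and a sum and a difference of two coordinates together give that [2 o] is
    an integer. *)
Lemma integral_lattice : exists (tau : nat) (u : int) (o : R),
  [/\ (0 < tau)%N, u * u = 1, lev = tau%:R * u%:~R,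
      forall j, lattice o (l j) & sg -> 2 * o \is a Num.int].
Proof.
have [j0 _ _] := infinite_pick [::] J_infinite.
have [j1 _] := infinite_pick [:: j0] J_infinite; rewrite inE => j10.
have one : sign_allowed sg (1 : R) by left.
have h0 := int_pairs 0 j10 one one; have h1 := int_pairs 1 j10 one one.
rewrite mulr0 subr0 in h0.
have /intrP[z zE] : lev \is a Num.int.
  rewrite (_ : lev = (1 * l j1 - 1 * l j0) - (1 * l j1 - 1 * l j0 - lev * 1%:~R)).
    by rewrite rpredB.
  by rewrite mulr1; ring.
have z0 : z != 0 by apply: contra lev0 => /eqP z0; rewrite zE z0.
exists `|z|%N, (sgz z), (l j0); split.
- by rewrite absz_gt0.
- by rewrite /sgz (negPf z0); case: ifP.
- by rewrite zE {1}(intEsg z) mulrC intrM.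
- move=> j; rewrite /lattice /=; have [->|jj0] := eqVneq j j0; first by rewrite subrr.
  by have := int_pairs 0 jj0 one one; rewrite mulr0 subr0 !mul1r.
move=> sgT; have m1 : sign_allowed sg (-1 : R) by right.
have := int_pairs 0 j10 one m1; rewrite mulr0 subr0 mulN1r opprK => h2.
rewrite (_ : 2 * l j0 = (1 * l j1 + l j0) - (1 * l j1 - 1 * l j0)); last by ring.
by rewrite rpredB.
Qed.

End Integrality.

(** * Splitting off the summable error *)

Lemma clamp_dist (R : realType) (x t t' s : R) : t <= t' -> 0 <= s ->
  t - s <= x -> x <= t' + s -> `|x - Num.max t (Num.min x t')| <= s.
Proof.
move=> tt' s0 h1 h2; rewrite ler_norml; have [h|h] := leP x t'.
  by have [h'|h'] := leP t x; apply/andP; split; lra.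
by have [h'|h'] := leP t t'; apply/andP; split; lra.
Qed.

Theorem corollary2 (R : realType) (k : hilbertLie R)
  (k_simple : simple_hilbertLie k) (k_infinite : infinite_dimensional k)
  (phi : k -> k) (Nphi : nat)
  (phi_aut : lie_automorphism phi) (phi_order : has_order phi Nphi)
  (t0 : submodClosed k) (t0_max : maximal_abelian phi t0)
  (J : choiceType) (J_infinite : infinite_set [set: J])
  (e : J -> it0 t0) (eps : J -> alg_dual (it0 t0))
  (psi : k -> k) (Npsi : nat)
  (psi_standard : standard_automorphism e eps psi Npsi)
  (mu : alg_dual (it0 t0)) (phi_untwisted : untwisting phi Nphi psi Npsi mu)
  (nu : alg_dual (it0 t0)) (nu_slant : slant nu)
  (lambda : ite_dual t0)
  (lambda_integral : integral_weight phi Nphi nu lambda)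
  (lambda_c : lambda.1.1 != 0)
  (chi : {linear ite_dual t0 -> R^o})
  (lambda_chi : 0 < (lambda.1.1 : R) * chi (0, 0, 1)) :
  (-oo < orbit_inf phi Nphi nu chi lambda)%E
  <->
  (exists chi_min chi_sum : {linear ite_dual t0 -> R^o},
     [/\ minimal_energy phi Nphi nu lambda chi_min,
         summable_character eps chi_sum
       & forall m : ite_dual t0, chi m = chi_min m + chi_sum m]).
Proof.
have [psi_aut psi_order psi_max [[[c c0 e_orth] e_dense] dual] cases] := psi_standard.
have [nu'_slant iso] := phi_untwisted nu nu_slant.
set nu' := _ *: nu + _ in nu'_slant iso; pose Q : R := Npsi%:R / Nphi%:R.
have Npsi12 : Npsi = 1%N \/ Npsi = 2%N by case: cases => -[-> _]; [left|right].
have Q0 : Q != 0.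
  by rewrite mulf_neq0 ?invr_neq0// pnatr_eq0 -lt0n; [case: psi_order|case: phi_order].
have [sg [sigma [sigma12 shape]]] := index_pairs_shape cases.
have eps_rep := dual_system_rep e_orth e_dense dual; have [eps_e _] := dual.
have X_root alpha (r : R) : compact_root phi Nphi nu (0, alpha, r) <->
    exists n : int, index_pairs psi Npsi (alpha, n) /\ Q * r = n%:~R + nu' (sharp alpha).
  split; first exact: (compact_root_index psi_aut phi_order psi_order t0_max psi_max nu_slant
      nu'_slant iso).
  by move=> [n [ipn rE]]; exact: (index_compact_root phi_aut psi_aut phi_order psi_order
    t0_max psi_max nu_slant nu'_slant Npsi12 iso ipn rE).
pose l := shifted_weight nu' Q e lambda lambda; pose lev := level Q c lambda.
have lev0 : lev * sigma%:~R != 0.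
  have s0 : (sigma%:~R : R) != 0 by rewrite intr_eq0; case: sigma12 => ->.
  apply: mulf_neq0 => //; apply: mulf_neq0; first exact: lambda_c.
  by rewrite invr_eq0 mulf_neq0// gt_eqF.
have int_pairs j i a b (n : int) : j != i -> sign_allowed sg a -> sign_allowed sg b ->
    a * l j - b * l i - lev * sigma%:~R * n%:~R \is a Num.int.
  move=> ji aS bS.
  have [r [cr rE]] := pair_root_compact Q0 X_root shape n ji aS bS.
  have := lambda_integral _ cr.
  rewrite (pairing_pair phi_aut t0_max nu_slant Q0 c0 e_orth eps_rep (erefl _) ji aS bS cr rE).
  by rewrite intrM mulrA.
have [tau [u [org [tau0 uu tauE lL oL]]]] := integral_lattice J_infinite lev0 int_pairs.
pose p := centre nu' Q e eps c lambda; pose sc := scale c lambda.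
have lower (ch : {linear ite_dual t0 -> R^o}) (theta : R -> R) (s : J -> R) (S : R) :
    0 < (lambda.1.1 : R) * ch (0, 0, 1) -> threshold sg org tau%:R theta ->
    (forall j, 0 <= s j) -> sums_bounded s S -> in_window theta l (p ch) s ->
    ((sc ch * - (S ^+ 2 / 2 + tau%:R * S))%:E <= orbit_inf phi Nphi nu ch lambda)%E.
  move=> lch th s0 sS win.
  have := orbit_inf_reach phi_aut t0_max nu_slant Q0 c0 e_orth
    eps_e eps_rep X_root shape lambda_c lch tauE.
  apply => y v; exact: (reach_ge tau0 lL oL th s0 sS win).
have upper (ch : {linear ite_dual t0 -> R^o}) (C : R) :
    0 < (lambda.1.1 : R) * ch (0, 0, 1) -> (C%:E <= orbit_inf phi Nphi nu ch lambda)%E ->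
    exists theta s S, [/\ threshold sg org tau%:R theta, forall j, 0 <= s j,
      sums_bounded s S & in_window theta l (p ch) s].
  move=> lch hC; have := reach_bounded phi_aut t0_max nu_slant Q0 c0 e_orth
    eps_e eps_rep X_root shape lambda_c lch uu tauE hC => bd.
  apply: (exists_threshold J_infinite tau0 lL oL (C := - (C / sc ch))) => y v rch.
  by rewrite opprK; exact: bd rch.
(* The scale depends on a character only through its last component, so a summable correction merely
   moves the centre. *)
have centreD (ch ch' : {linear ite_dual t0 -> R^o}) j : ch' (0, 0, 1) = ch (0, 0, 1) ->
    p ch' j = p ch j + ((ch (0, eps j, 0) : R) - (ch' (0, eps j, 0) : R)) / sc ch.
  by rewrite /p /centre /sc /scale => ->; ring.
have id_le (ch : {linear ite_dual t0 -> R^o}) : (orbit_inf phi Nphi nu ch lambda <= 0)%E.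
  have := orbit_inf_le lambda ch (weyl_id phi Nphi nu).
  by rewrite subrr linear0.
split=> [inf_gt|[chi_min [chi_sum [min_energy [sum_c sum_d sum_fin] chiE]]]].
  have [C hC] : exists C : R, (C%:E <= orbit_inf phi Nphi nu chi lambda)%E.
    case: (orbit_inf _ _ _ _ _) inf_gt => [r _|_|//]; first by exists r.
    by exists 0; rewrite leey.
  have [theta [s [S [th s0 sS win]]]] := upper chi C lambda_chi hC.
  have [th1 _ _] := th.
  (* The point nearest to [p chi j] in the exact window; the slack bounds how far it has moved. *)
  pose q j := Num.max (theta (l j)) (Num.min (p chi j) (theta (l j + 1))).
  have sc0 : 0 < sc chi := scale_gt0 c0 lambda_c lambda_chi.
  have pq j : `|p chi j - q j| <= s j.
    have /andP[w1 w2] := win j; have t1 := th1 _ (lL j); exact: clamp_dist.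
  (* These values make [q] the centre of [chi - chi_sum]. *)
  have [L LE] := linear_extension (fun j => - sc chi * (p chi j - q j))
    (coord := fun j (f : alg_dual (it0 t0)) => f (e j) : R)
    (fun _ _ _ _ => erefl) (fun i j => etrans (eps_e j i) (congr1 (fun b : bool => b%:R) (eq_sym
        j i))).
  have [chi_sum sumE] := linear_bundle (f := fun m : ite_dual t0 => L m.1.2)
    (fun a x y => linearP L a x.1.2 y.1.2).
  have min_linear : linear (fun m : ite_dual t0 => chi m - chi_sum m).
    move=> a x y; rewrite (linearP chi) (linearP chi_sum).
    move: (chi x : R) (chi y : R) (chi_sum x : R) (chi_sum y : R) => A B A' B'.
    by rewrite -[LHS]/(a * A + B - (a * A' + B')) -[RHS]/(a * (A - A') + (B - B')); ring.
  have [chi_min minE] := linear_bundle min_linear.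
  have sum0 (x z : R) : chi_sum (x, 0, z) = 0 by rewrite sumE linear0.
  have min_d : chi_min (0, 0, 1) = chi (0, 0, 1) by rewrite minE sum0 subr0.
  have lambda_min : 0 < (lambda.1.1 : R) * chi_min (0, 0, 1) by rewrite min_d.
  exists chi_min, chi_sum; split.
  - apply/eqP; rewrite eq_le id_le /=.
    (* Without slack the lower bound is 0, and the identity attains it. *)
    have := lower chi_min theta (fun=> 0) 0 lambda_min th (fun _ => lexx 0).
    rewrite expr0n mul0r mulr0 addr0 oppr0 mulr0; apply.
      by move=> F _; rewrite big1.
    move=> j; rewrite subr0 addr0.
    have -> : p chi_min j = q j.
      rewrite (centreD chi chi_min j min_d) minE sumE LE.
      by field; rewrite gt_eqF.
    rewrite /q le_max lexx /= ge_max th1//=.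
    by rewrite ge_min lexx orbT.
  - split; rewrite ?sum0//; apply/summable_sums; exists (sc chi * S) => F uF.
    apply: (@le_trans _ _ (\sum_(j <- F) sc chi * s j)); last first.
      by rewrite -mulr_sumr ler_wpM2l// ?sS// ltW.
    apply: ler_sum => j _; rewrite sumE LE normrM normrN (gtr0_norm sc0).
    by rewrite ler_wpM2l// ltW.
  - by move=> m; rewrite minE subrK.
have min_d : chi_min (0, 0, 1) = chi (0, 0, 1) by rewrite chiE sum_d addr0.
have lambda_min : 0 < (lambda.1.1 : R) * chi_min (0, 0, 1) by rewrite min_d.
have [|theta [s [S [th s0 sS win]]]] := upper chi_min 0 lambda_min.
  by rewrite min_energy.
have /summable_sums[S' hS'] := sum_fin.
have sc0 : 0 < sc chi := scale_gt0 c0 lambda_c lambda_chi.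
(* Adding [chi_sum] moves the centre by at most [d], so the threshold of [chi_min] serves for [chi]
   with slack [s + d]. *)
pose d j : R := `|chi_sum (0, eps j, 0) : R| / sc chi.
have d0 j : 0 <= d j by rewrite divr_ge0// ltW.
apply: (@lt_le_trans _ _ (sc chi * - ((S + S' / sc chi) ^+ 2 / 2 + tau%:R * (S + S' / sc chi)))%:E).
  exact: ltNyr.
apply: (lower chi theta (fun j => s j + d j)) => // [j|F uF|j].
- by rewrite addr_ge0.
- rewrite big_split/= lerD ?sS// /d -mulr_suml ler_pM2r ?invr_gt0//; exact: hS'.
have /andP[w1 w2] := win j.
have pE : p chi j = p chi_min j - (chi_sum (0, eps j, 0) : R) / sc chi.
  have chij : (chi (0, eps j, 0) : R) = (chi_min (0, eps j, 0) : R) + (chi_sum (0, eps j, 0) : R).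
    exact: chiE.
  by rewrite (centreD chi chi_min j min_d) chij; ring.
have : `|(chi_sum (0, eps j, 0) : R) / sc chi| <= d j.
  by rewrite normrM normfV (gtr0_norm sc0).
rewrite ler_norml => /andP[d1 d2].
by rewrite pE; apply/andP; split; lra.
Qed.
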